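(* Consider the interacting urn process on a finite weakly connected directed graph $\mathcal G=(V,\mathcal E)$, $V=[N]=S\cup F$, with parameters $(q_i,m_i,\alpha_i,\beta_i)_{i\in V}$, as defined in the context, and let $\mathbf W=\mathcal I B\widetilde A$ and $\rho=\lambda_{\min}(I-\mathbf W_F)$. Suppose $\mathbf Z_F^t\to\mathbf Z_F^\star$ almost surely as $t\to\infty$. Let $\Theta$ be the $N\times N$ diagonal matrix with $[\Theta]_{i,i}=(Z_i^\star-\frac12)^2$, and $$\Gamma=\Big(-\mathbf W^\top\Theta\mathbf W+\tfrac14\widetilde A^\top B^2\widetilde A\Big)_F.$$ Then: 1. If $\rho>1/2$, then as $t\to\infty$, $\sqrt t\,(\mathbf Z_F^t-\mathbf Z_F^\star)\xrightarrow{d}\mathcal N(\mathbf 0,\Sigma)$ with $$\Sigma=\int_0^\infty\big(e^{-(\frac12I-\mathbf W_F)u}\big)^\top\,\Gamma\,e^{-(\frac12I-\mathbf W_F)u}\,du.$$ 2. If $\rho=1/2$ with multiplicity 1, then as $t\to\infty$, $\sqrt{\frac{t}{\log t}}\,(\mathbf Z_F^t-\mathbf Z_F^\star)\xrightarrow{d}\mathcal N(\mathbf 0,\Sigma)$ with $$\Sigma=\lim_{t\to\infty}\frac1{\log t}\int_0^{\log t}\big(e^{-(\frac12I-\mathbf W_F)u}\big)^\top\,\Gamma\,e^{-(\frac12I-\mathbf W_F)u}\,du.$$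
   Context: Graph. $\mathcal G=(V,\mathcal E)$ is a finite directed graph, $V=[N]=\{1,\dots,N\}$, weakly connected; $i\to j$ means there is a directed edge from $i$ to $j$. In-neighbourhood: $N_i=\{j\in V:j\to i\}$. Stubborn nodes: $S=\{i:N_i=\emptyset\}$; flexible nodes: $F=V\setminus S$, labelled so that $F=\{1,\dots,|F|\}$. $A$ is the adjacency matrix, $[A]_{i,j}=1$ if $i\to j$ and $0$ otherwise. Urn process. Each node $i$ has an urn with $W_i^t$ white and $B_i^t$ black balls at time $t$; $T_i^t=W_i^t+B_i^t$, $T_i^0>0$, $Z_i^t=W_i^t/T_i^t$, $\mathbf Z^t=(Z_1^t,\dots,Z_N^t)$ (row vector), $\mathcal F_t=\sigma(\mathbf Z^0,\dots,\mathbf Z^t)$; the initial configuration is fixed. Each node has parameters $q_i\in[0,1]$ and integers $m_i\ge1$, $\alpha_i,\beta_i\in\{0,\dots,m_i\}$. Given $\mathcal F_t$, the variables $\chi_i^{t+1}$, $i\in V$ (indicator that a white ball is drawn from urn $i$) are independent Bernoulli with $P(\chi_i^{t+1}=1\mid\mathcal F_t)=q_iZ_i^t+(1-q_i)(1-Z_i^t)$. Then for all $i\in V$, $W_i^{t+1}=W_i^t+\sum_{j\in N_i}[\alpha_j\chi_j^{t+1}+(m_j-\beta_j)(1-\chi_j^{t+1})]$ and $B_i^{t+1}=B_i^t+\sum_{j\in N_i}[(m_j-\alpha_j)\chi_j^{t+1}+\beta_j(1-\chi_j^{t+1})]$. Every node is assumed to be either of Pólya type ($\alpha_i=\beta_i=m_i$)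 or of non-Pólya type ($0<\alpha_i+\beta_i<2m_i$). Matrix notation. Vectors are row vectors. $a_i=\alpha_i/m_i$, $b_i=\beta_i/m_i$, $\mathbf a=(a_1,\dots,a_N)$, $\mathbf q=(q_1,\dots,q_N)$, $\overline m_i=\sum_{j\in N_i}m_j$, $\mathcal I=\mathrm{Diag}(2q_1-1,\dots,2q_N-1)$, $B=\mathrm{Diag}(a_1+b_1-1,\dots,a_N+b_N-1)$, $M=\mathrm{Diag}(m_1,\dots,m_N)$, $\overline M^{-1}=\mathrm{Diag}(\overline m_1^{-1},\dots,\overline m_{|F|}^{-1},0,\dots,0)$ (zeros on $S$), $\widetilde A=MA\overline M^{-1}$. For a matrix $Q$, $Q_{SF}$ is the submatrix with rows in $S$ and columns in $F$, $Q_F=Q_{FF}$; for a vector $x$, $x_F$ is its restriction to $F$. $I$ is the identity of size $|F|$. Limit. $\mathbf Z^\star=(\mathbf Z_F^\star,\mathbf Z_S^0)$ with $\mathbf Z_F^\star=[\mathbf Z_S^0(\mathcal I B\widetilde A)_{SF}+(\mathbf a\widetilde A)_F-(\mathbf qB\widetilde A)_F](I-(\mathcal I B\widetilde A)_F)^{-1}$. Spectral conventions. $\lambda_{\min}(Q)$ is the smallest real part among the eigenvalues of $Q$. ''$\rho=1/2$ with multiplicity 1'' means that exactly one eigenvalue of $I-\mathbf W_F$, counted with multiplicity, has real part $1/2$. In the case $q_i\ne1/2$ for all $i$, $\mathbf W$ is assumed diagonalisable. *)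

(* Defs.v *)
From HB Require Import structures.
From mathcomp Require Import all_boot all_order all_algebra.
From mathcomp Require Export complex.
From mathcomp Require Import all_classical all_reals all_analysis.
Set Implicit Arguments.
Unset Strict Implicit.
Unset Printing Implicit Defensive.
Import Order.TTheory GRing.Theory Num.Theory.
Import numFieldNormedType.Exports.
Local Open Scope classical_set_scope.
Local Open Scope ring_scope.

Section Spectrum.
Variables (R : realType) (n : nat).
Implicit Type Q : 'M[R]_n.

(* All complex eigenvalues, repeated according to algebraic multiplicity. *)
Definition eigenvalues Q : seq R[i] :=
  sval (closed_field_poly_normal (char_poly (map_mx (real_complex R) Q))).

(* By convention 0 for the empty matrix. *)
Definition lambda_min Q : R :=
  let s := [seq complex.Re z | z <- eigenvalues Q] in
  \big[Order.min/head 0 s]_(x <- s) x.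

Definition expmx Q : 'M[R]_n :=
  \matrix_(i, j) limn (series (fun k => (k`!%:R)^-1 * (Q ^+ k) i j)).

End Spectrum.

Section Probability.
Context {d : measure_display} {T : measurableType d} {R : realType}.
Variable P : probability T R.

(* [f] is a version of the conditional probability of [E] given the
   sigma-algebra [G]. *)
Definition is_cond_prob (G : set (set T)) (E : set T) (f : T -> R) : Prop :=
  (forall B : set R, measurable B -> G (f @^-1` B)) /\
  (forall A, G A -> (P (A `&` E) = \int[P]_(w in A) (f w)%:E)%E).

(* Given [G], the variables [X i] are independent Bernoulli of parameters
   [p i]: product rule for every subfamily and all values. *)
Definition cond_indep_bernoulli (I : finType) (G : set (set T))
    (X : I -> T -> bool) (p : I -> T -> R) : Prop :=
  forall (J : {set I}) (x : I -> bool),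
    is_cond_prob G [set w | forall i, i \in J -> X i w = x i]
      (fun w => \prod_(i in J) (if x i then p i w else 1 - p i w)).

Definition borel_rV (n : nat) := g_sigma_algebraType (@open 'rV[R]_n).

Definition cvg_distribution (n : nat) (X : nat -> T -> 'rV[R]_n)
    (mu : probability (borel_rV n) R) : Prop :=
  forall f : 'rV[R]_n -> R, continuous f ->
    (exists M : R, forall x, `|f x| <= M) ->
    ('E_P[f \o X t] @[t --> \oo] --> \int[mu]_x (f x)%:E)%E.

(* The univariate centred normal law of variance [v >= 0]; [normal_prob] is not
   the Dirac mass when its deviation is 0. *)
Definition normal0 (v : R) (A : set R) : \bar R :=
  if v == 0 then \d_(0 : R) A else normal_prob 0 (Num.sqrt v) A.

(* [mu] is the (possibly degenerate) multivariate normal law N(0, Sigma) on row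
   vectors: every linear functional x |-> x u^T is normal with mean 0 and
   variance u Sigma u^T. *)
Definition is_normal0 (n : nat) (Sigma : 'M[R]_n)
    (mu : probability (borel_rV n) R) : Prop :=
  Sigma^T = Sigma /\
  forall u : 'rV[R]_n,
    let v := (u *m Sigma *m u^T) 0 0 in
    0 <= v /\
    forall A : set R, measurable A ->
      mu [set x : 'rV[R]_n | A ((x *m u^T) 0 0)] = normal0 v A.

Definition cvg_normal0 (n : nat) (X : nat -> T -> 'rV[R]_n)
    (Sigma : 'M[R]_n) : Prop :=
  exists mu : probability (borel_rV n) R,
    is_normal0 Sigma mu /\ cvg_distribution X mu.

End Probability.

(* The nodes are 'I_(nF + nS): the first nF are the flexible ones and the last
   nS the stubborn ones. *)
Record urn_network (R : realType) (nF nS : nat) := UrnNetwork {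
  edge : rel 'I_(nF + nS);
  edge_connected :
    forall i j, connect (fun x y => edge x y || edge y x) i j;
  flexibleP : forall i : 'I_(nF + nS), (i < nF)%N <-> exists j, edge j i;
  q : 'I_(nF + nS) -> R;
  q_01 : forall i, 0 <= q i <= 1;
  m : 'I_(nF + nS) -> nat;
  m_gt0 : forall i, (0 < m i)%N;
  alpha : 'I_(nF + nS) -> nat;
  alpha_le : forall i, (alpha i <= m i)%N;
  beta : 'I_(nF + nS) -> nat;
  beta_le : forall i, (beta i <= m i)%N;
  node_type : forall i,
    (alpha i = m i /\ beta i = m i) \/ (0 < alpha i + beta i < 2 * m i)%N;
  W0 : 'I_(nF + nS) -> nat;
  B0 : 'I_(nF + nS) -> nat;
  T0_gt0 : forall i, (0 < W0 i + B0 i)%N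
}.

Section Process.
Context {R : realType} {nF nS : nat} (U : urn_network R nF nS).
Context {d : measure_display} {T : measurableType d}.
Local Notation V := 'I_(nF + nS).

(* [chi t i] is the indicator of a white draw from urn [i] at time [t];
   [chi 0] is never used. *)
Variable chi : nat -> V -> T -> bool.

Fixpoint white (t : nat) (i : V) (w : T) : nat :=
  match t with
  | 0 => W0 U i
  | t'.+1 => white t' i w +
      \sum_(j | edge U j i)
        (alpha U j * chi t j w + (m U j - beta U j) * ~~ chi t j w)
  end%N.

Fixpoint black (t : nat) (i : V) (w : T) : nat :=
  match t with
  | 0 => B0 U i
  | t'.+1 => black t' i w +
      \sum_(j | edge U j i)
        ((m U j - alpha U j) * chi t j w + beta U j * ~~ chi t j w)
  end%N.

Definition total t i w : nat := (white t i w + black t i w)%N.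

Definition Z (t : nat) (i : V) (w : T) : R :=
  (white t i w)%:R / (total t i w)%:R.

Definition ZF (t : nat) (w : T) : 'rV[R]_nF := \row_i Z t (lshift nS i) w.

Definition history (t : nat) : set (set T) :=
  <<s [set A | exists s i, (s <= t)%N /\
                 preimage_set_system setT (Z s i) measurable A] >>.

Definition draw_prob (t : nat) (i : V) (w : T) : R :=
  q U i * Z t i w + (1 - q U i) * (1 - Z t i w).

Definition urn_draws (P : probability T R) : Prop :=
  (forall t i, measurable_fun setT (chi t.+1 i)) /\
  (forall t, cond_indep_bernoulli P (history t) (chi t.+1) (draw_prob t)).

End Process.

Section Matrices.
Context {R : realType} {nF nS : nat} (U : urn_network R nF nS).
Local Notation V := 'I_(nF + nS).

Definition a (i : V) : R := (alpha U i)%:R / (m U i)%:R.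
Definition b (i : V) : R := (beta U i)%:R / (m U i)%:R.
Definition a_row : 'rV[R]_(nF + nS) := \row_i a i.
Definition q_row : 'rV[R]_(nF + nS) := \row_i q U i.
Definition mbar (i : V) : nat := (\sum_(j | edge U j i) m U j)%N.

Definition adj : 'M[R]_(nF + nS) := \matrix_(i, j) (edge U i j)%:R.
Definition Imx : 'M[R]_(nF + nS) := diag_mx (\row_i (2 * q U i - 1)).
Definition Bmx : 'M[R]_(nF + nS) := diag_mx (\row_i (a i + b i - 1)).
Definition Mmx : 'M[R]_(nF + nS) := diag_mx (\row_i (m U i)%:R).
Definition Mbar_inv : 'M[R]_(nF + nS) :=
  diag_mx (\row_i (if (i < nF)%N then (mbar i)%:R^-1 else 0)).
Definition Atilde : 'M[R]_(nF + nS) := Mmx *m adj *m Mbar_inv.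
Definition Wmx : 'M[R]_(nF + nS) := Imx *m Bmx *m Atilde.

(* With the flexible nodes first, the blocks Q_FF and Q_SF of a matrix are
   [ulsubmx Q] and [dlsubmx Q], and x_F, x_S are [lsubmx x], [rsubmx x]. *)
Definition WF : 'M[R]_nF := ulsubmx Wmx.

Definition Z0 : 'rV[R]_(nF + nS) :=
  \row_i ((W0 U i)%:R / (W0 U i + B0 U i)%:R).

Definition ZstarF : 'rV[R]_nF :=
  (rsubmx Z0 *m dlsubmx Wmx + lsubmx (a_row *m Atilde)
     - lsubmx (q_row *m Bmx *m Atilde)) *m invmx (1%:M - WF).

Definition Zstar : 'rV[R]_(nF + nS) := row_mx ZstarF (rsubmx Z0).

Definition Theta : 'M[R]_(nF + nS) :=
  diag_mx (\row_i (Zstar 0 i - 2^-1) ^+ 2).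

Definition Gamma : 'M[R]_nF :=
  ulsubmx (- (Wmx^T *m Theta *m Wmx)
           + 4^-1 *: (Atilde^T *m Bmx ^+ 2 *m Atilde)).

Definition rho : R := lambda_min (1%:M - WF).

Definition rho_mult : nat :=
  count (fun z => complex.Re z == rho) (eigenvalues (1%:M - WF)).

Definition cov_integrand (u : R) : 'M[R]_nF :=
  let E := expmx (- (u *: ((2^-1)%:M - WF))) in E^T *m Gamma *m E.

Definition cov_integral (D : set R) : 'M[R]_nF :=
  \matrix_(i, j) \int[lebesgue_measure]_(u in D) cov_integrand u i j.

End Matrices.

(* Main.v *)
(** Let [N_t] have coordinates [(t + c_i) (Z_i^t - z_i)], where [z] is the limit
    and [c_i] the initial number of balls of urn [i] divided by [mbar_i].  Since [z]
    solves the equilibrium equation, [N_(t+1) = N_t (I + D_t W_F) + xi_(t+1)], where [D_t] is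
    the diagonal matrix of the [1 / (t + c_i)] and the noise [xi] is bounded, centred
    given the past, and of conditional covariance tending to [Gamma].  Hence the
    characteristic functions of the [N_t] satisfy
    [phi_(t+1)(u) = exp(- u^T Gamma u / 2) phi_t((I + D_t W_F) u) + o(|u|^2) + O(|u|^3)].
    With [B = I/2 - W_F] and [Y(L)] the integral of [e^(-Bu)^T Gamma e^(-Bu)] over
    [0, L], the Lyapunov equation [Gamma - Y' = B^T Y + Y B] shows that
    [exp(- t u^T Y(ln t) u / 2)] satisfies the same recursion up to
    [O(|u|^2 ln t / t)].  In a norm adapted to the spectrum of [W_F], the matrix
    [I + D_t W_F] expands by at most [1 + w/t + O(1/t^2)] with [w < 1/2], respectively
    [w = 1/2], so that the accumulated errors vanish for [u] of order [t^(-1/2)],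
    respectively [(t ln t)^(-1/2)].  The same recursion for second moments gives
    tightness, and convergence in distribution follows by approximating continuous
    functions by trigonometric polynomials. *)

(* The factors [t + c_i] are no approximation: a draw from [j] adds [m_j] balls whatever its colour,
   so urn [i] holds exactly [mbar_i (t + c_i)] balls and the drift is linear without remainder. Laws
   are tested against [cos (lin x u + th)], the real form of a character, the phase [th] carrying
   the imaginary part. Transposing the drift onto [u] turns a recursion between random vectors into
   a scalar one in which only the test vector moves, so that contraction is measured on test vectors
   alone. The logarithm enters because the steps [1/t] add up to [ln t], the natural time of the
   semigroup of [B]. The comparison starts at time 1, where [Y (ln 1) = 0] makes the Gaussian
   candidate equal to [cos th]. Errors of degree 1, 2 and 3 in [u] (initial mismatch, covariance
   defect, Taylor remainder) are propagated separately, since they grow at different powers.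
   Conditioning is reduced to finite sums: the ball counts at a given time take finitely many
   values, and the conditional law of the draws is read on events fixing all counts. The adapted
   norm is built from the list of eigenvalues and the Cayley-Hamilton theorem. *)
Require Import Defs.
From mathcomp Require Import all_boot all_order all_algebra.
From mathcomp Require Import all_classical all_reals all_analysis measurable_realfun.
From mathcomp Require Import ring lra.
Set Implicit Arguments.
Unset Strict Implicit.
Unset Printing Implicit Defensive.
Import Order.TTheory GRing.Theory Num.Theory.
Import numFieldNormedType.Exports.
Local Open Scope classical_set_scope.
Local Open Scope ring_scope.

(** * Expectations *)

Section ProductLaw.
Variables (R : realType) (I : finType) (w : I -> bool -> R).

(** Used twice: with weights [s_j] and [1 - s_j] it produces Bernstein polynomials, and with the
    draw probabilities it is the mean of one urn step given the past. *)
Definition prod_mean (F : {ffun I -> bool} -> R) : R :=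
  \sum_(x : {ffun I -> bool}) (\prod_i w i (x i)) * F x.

Hypothesis w_ge0 : forall i e, 0 <= w i e.
Hypothesis w_sum1 : forall i, w i true + w i false = 1.

(** Distributivity of products over sums is the whole content of independence here; means of
    functions of one or two coordinates follow by setting the other factors to 1. *)
Lemma prod_mean_prod (F : I -> bool -> R) :
  prod_mean (fun x => \prod_i F i (x i)) =
  \prod_i (w i true * F i true + w i false * F i false).
Proof.
rewrite /prod_mean/=.
under eq_bigr => x _ do rewrite -big_split.
rewrite -(bigA_distr_bigA (fun i e => w i e * F i e)).
by apply: eq_bigr => i _; rewrite big_bool.
Qed.

Lemma prod_mean_cst c : prod_mean (fun=> c) = c.
Proof.
have := prod_mean_prod (fun _ _ => 1).
rewrite /prod_mean/=.
under eq_bigr => x _ do rewrite big1_eq mulr1.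
rewrite -mulr_suml => ->; rewrite big1 ?mul1r// => i _.
by rewrite !mulr1 w_sum1.
Qed.

Lemma prod_meanD F G : prod_mean (fun x => F x + G x) = prod_mean F + prod_mean G.
Proof. by rewrite /prod_mean -big_split; apply: eq_bigr => x _; rewrite mulrDr. Qed.

Lemma prod_meanZ c F : prod_mean (fun x => c * F x) = c * prod_mean F.
Proof. by rewrite /prod_mean mulr_sumr; apply: eq_bigr => x _; rewrite mulrCA. Qed.

Lemma prod_mean_sum (J : finType) (F : J -> {ffun I -> bool} -> R) :
  prod_mean (fun x => \sum_j F j x) = \sum_j prod_mean (F j).
Proof.
rewrite /prod_mean exchange_big /=; apply: eq_bigr => x _; exact: mulr_sumr.
Qed.

Lemma prod_mean_le F G : (forall x, F x <= G x) -> prod_mean F <= prod_mean G.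
Proof.
by move=> FG; apply: ler_sum => x _; rewrite ler_wpM2l// prodr_ge0.
Qed.

Lemma prod_mean_norm F : `|prod_mean F| <= prod_mean (fun x => `|F x|).
Proof.
apply: (le_trans (ler_norm_sum _ _ _)); apply: ler_sum => x _.
by rewrite normrM ger0_norm// prodr_ge0.
Qed.

Lemma prod_mean1 i (g : bool -> R) :
  prod_mean (fun x => g (x i)) = w i true * g true + w i false * g false.
Proof.
have := prod_mean_prod (fun k e => if k == i then g e else 1).
rewrite (bigD1 i)//= eqxx [X in _ * X]big1 ?mulr1; last first.
  by move=> k /negPf ->; rewrite !mulr1 w_sum1.
move=> <-; apply: eq_bigr => x _; congr (_ * _).
by rewrite (bigD1 i)//= eqxx big1 ?mulr1// => k /negPf ->.
Qed.

Lemma prod_mean2 i j (g h : bool -> R) : i != j ->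
  prod_mean (fun x => g (x i) * h (x j)) =
  (w i true * g true + w i false * g false) *
  (w j true * h true + w j false * h false).
Proof.
move=> ij.
have := prod_mean_prod (fun k e => if k == i then g e else if k == j then h e else 1).
rewrite (bigD1 i)//= (bigD1 j)/= 1?eq_sym// !eqxx.
rewrite eq_sym (negPf ij) [X in _ * (_ * X)]big1 ?mulr1; last first.
  by move=> k /andP[/negPf -> /negPf ->]; rewrite !mulr1 w_sum1.
move=> <-; apply: eq_bigr => x _; congr (_ * _).
rewrite (bigD1 i)//= (bigD1 j)/= 1?eq_sym// !eqxx eq_sym (negPf ij).
by rewrite big1 ?mulr1// => k /andP[/negPf -> /negPf ->].
Qed.

Variable g : I -> bool -> R.
Hypothesis g_mean0 : forall i, w i true * g i true + w i false * g i false = 0.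

Lemma prod_mean_centered : prod_mean (fun x => \sum_i g i (x i)) = 0.
Proof.
by rewrite prod_mean_sum big1// => i _; rewrite (prod_mean1 i (g i)).
Qed.

(** After expanding the square, an off-diagonal term factors into two means, which vanish by
    [g_mean0]. *)
Lemma prod_mean_variance :
  prod_mean (fun x => (\sum_i g i (x i)) ^+ 2) =
  \sum_i (w i true * g i true ^+ 2 + w i false * g i false ^+ 2).
Proof.
under [X in prod_mean X]funext do rewrite expr2 mulr_suml.
rewrite prod_mean_sum; apply: eq_bigr => i _.
under [X in prod_mean X]funext do rewrite mulr_sumr.
rewrite prod_mean_sum (bigD1 i)//= (prod_mean1 i (fun e => g i e * g i e)).
by rewrite big1 ?addr0// => j ji; rewrite prod_mean2 1?eq_sym// g_mean0 mul0r.
Qed.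

End ProductLaw.

Section BoundedExpectation.
Context {d : measure_display} {T : measurableType d} {R : realType}.
Variable P : probability T R.
Implicit Types f g : T -> R.

(** A class stable under sums and products on which integrability under a probability is automatic,
    so that [Ex] is linear without further side conditions. *)
Definition mbounded f :=
  measurable_fun setT f /\ exists M : R, forall x, `|f x| <= M.

Definition Ex f : R := (\int[P]_x f x)%R.

Lemma mbounded_integrable f : mbounded f -> P.-integrable setT (EFin \o f).
Proof.
move=> [mf [M fM]]; apply: measurable_bounded_integrable => //.
  by rewrite [X in (X < _)%E](probability_setT P) ltry.
exists M; split; first exact: num_real.
by move=> y My x _; apply: (le_trans (fM x)); exact: ltW.
Qed.

Lemma mbounded_integral f : mbounded f -> (\int[P]_x (f x)%:E = (Ex f)%:E)%E.
Proof.
move=> bf; rewrite /Ex /Rintegral fineK//.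
exact: (integrable_fin_num measurableT (mbounded_integrable bf)).
Qed.

Lemma mboundedD f g : mbounded f -> mbounded g -> mbounded (fun x => f x + g x).
Proof.
move=> [mf [M fM]] [mg [N gN]]; split; first exact: measurable_funD.
exists (M + N) => x; apply: (le_trans (ler_normD _ _)); exact: lerD.
Qed.

Lemma mboundedM f g : mbounded f -> mbounded g -> mbounded (fun x => f x * g x).
Proof.
move=> [mf [M fM]] [mg [N gN]]; split; first exact: measurable_funM.
by exists (M * N) => x; rewrite normrM ler_pM.
Qed.

Lemma mbounded_cst c : mbounded (fun=> c).
Proof. by split; [exact: measurable_cst|exists `|c|]. Qed.

Lemma mboundedZ c f : mbounded f -> mbounded (fun x => c * f x).
Proof. by move=> bf; apply: mboundedM => //; exact: mbounded_cst. Qed.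

Lemma mboundedB f g : mbounded f -> mbounded g -> mbounded (fun x => f x - g x).
Proof.
move=> bf bg; have := mboundedD bf (mboundedZ (-1) bg).
by congr mbounded; apply/funext => x; rewrite mulN1r.
Qed.

Lemma mbounded_norm f : mbounded f -> mbounded (fun x => `|f x|).
Proof.
move=> [mf [M fM]]; split; first exact: measurableT_comp.
by exists M => x; rewrite normr_id.
Qed.

Lemma mbounded_sum (I : Type) (s : seq I) (F : I -> T -> R) :
  (forall i, mbounded (F i)) -> mbounded (fun x => \sum_(i <- s) F i x).
Proof.
move=> bF; elim: s => [|i s ih].
  rewrite (_ : (fun _ => _) = fun=> 0); first exact: mbounded_cst.
  by apply/funext => x; rewrite big_nil.
rewrite (_ : (fun _ => _) = fun x => F i x + \sum_(j <- s) F j x).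
  exact: mboundedD.
by apply/funext => x; rewrite big_cons.
Qed.

Lemma Ex_cst c : Ex (fun=> c) = c.
Proof.
by rewrite /Ex Rintegral_cst// [X in fine X](probability_setT P) mulr1.
Qed.

Lemma ExD f g : mbounded f -> mbounded g -> Ex (fun x => f x + g x) = Ex f + Ex g.
Proof. by move=> bf bg; rewrite /Ex RintegralD//; exact: mbounded_integrable. Qed.

Lemma ExZ c f : mbounded f -> Ex (fun x => c * f x) = c * Ex f.
Proof. by move=> bf; rewrite /Ex RintegralZl//; exact: mbounded_integrable. Qed.

Lemma ExB f g : mbounded f -> mbounded g -> Ex (fun x => f x - g x) = Ex f - Ex g.
Proof. by move=> bf bg; rewrite /Ex RintegralB//; exact: mbounded_integrable. Qed.

Lemma Ex_sum (I : Type) (s : seq I) (F : I -> T -> R) :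
  (forall i, mbounded (F i)) -> Ex (fun x => \sum_(i <- s) F i x) = \sum_(i <- s) Ex (F i).
Proof.
move=> bF; elim: s => [|i s ih].
  rewrite big_nil -[RHS]Ex_cst; congr Ex.
  by apply/funext => x; rewrite big_nil.
rewrite big_cons -ih -ExD//; last exact: mbounded_sum.
by congr Ex; apply/funext => x; rewrite big_cons.
Qed.

Lemma Ex_le f g : mbounded f -> mbounded g -> (forall x, f x <= g x) -> Ex f <= Ex g.
Proof.
by move=> bf bg fg; apply: le_Rintegral => //; exact: mbounded_integrable.
Qed.

Lemma Ex_ge0 f : (forall x, 0 <= f x) -> 0 <= Ex f.
Proof. by move=> f0; exact: Rintegral_ge0. Qed.

Lemma Ex_norm f : mbounded f -> `|Ex f| <= Ex (fun x => `|f x|).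
Proof. by move=> bf; apply: le_normr_Rintegral => //; exact: mbounded_integrable. Qed.

Lemma Ex_dist_le f g h : mbounded f -> mbounded g -> mbounded h ->
  (forall x, `|f x - g x| <= h x) -> `|Ex f - Ex g| <= Ex h.
Proof.
move=> bf bg bh fgh; rewrite -ExB//.
apply: (le_trans (Ex_norm (mboundedB bf bg))); apply: Ex_le => //.
exact/mbounded_norm/mboundedB.
Qed.

Lemma Ex_cvg (f : nat -> T -> R) g M : (forall n, measurable_fun setT (f n)) ->
  (forall n x, `|f n x| <= M) -> measurable_fun setT g ->
  {ae P, forall x, f n x @[n --> \oo] --> g x} ->
  Ex (f n) @[n --> \oo] --> Ex g.
Proof.
move=> mf fM mg fg.
have [|||||gi _ H] := @dominated_convergence _ T R P setT measurableT
  (fun n => EFin \o f n) (EFin \o g) (cst M%:E).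
- by move=> n; exact/measurable_EFinP.
- exact/measurable_EFinP.
- by apply: filterS fg => x fgx _; apply: cvg_EFin => //; exact: nearW.
- exact: (mbounded_integrable (mbounded_cst M)).
- by apply: aeW => x n _; rewrite /= lee_fin.
have fing := integrable_fin_num measurableT gi.
rewrite /Ex /Rintegral; apply: (fine_cvg (f := fun n => \int[P]_x (f n x)%:E)%E).
by rewrite fineK.
Qed.

End BoundedExpectation.

Lemma continuous_row {R : realType} (T : topologicalType) n (g : 'I_n -> T -> R) :
  (forall j, continuous (g j)) -> continuous (fun x => \row_j g j x : 'rV[R]_n).
Proof.
move=> cg x; apply/cvg_ballP => e e0.
have : \forall y \near x, forall j, ball (g j x) e (g j y).
  by apply: filter_forall => j; have /cvg_ballP := cg j x; apply.
apply: filterS => y H; split=> // i j; rewrite !mxE; exact: H.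
Qed.

Lemma continuous_sum {R : realType} (T : topologicalType) (I : Type) (s : seq I)
    (F : I -> T -> R) :
  (forall i, continuous (F i)) -> continuous (fun x => \sum_(i <- s) F i x).
Proof.
move=> cF; elim: s => [|i s ih].
  rewrite (_ : (fun _ => _) = fun=> 0); first by move=> x; exact: cvg_cst.
  by apply/funext => x; rewrite big_nil.
rewrite (_ : (fun _ => _) = fun x => F i x + \sum_(j <- s) F j x).
  by move=> x; apply: cvgD; [exact: cF|exact: ih].
by apply/funext => x; rewrite big_cons.
Qed.

Lemma cvg_sumr {R : realType} (T : Type) (F : set_system T) (FF : Filter F)
    (I : Type) (s : seq I) (f : I -> T -> R) (l : I -> R) :
  (forall i, f i x @[x --> F] --> l i) ->
  \sum_(i <- s) f i x @[x --> F] --> \sum_(i <- s) l i.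
Proof.
move=> cf; elim: s => [|i s ih].
  rewrite big_nil (_ : (fun _ => _) = fun=> 0); first exact: cvg_cst.
  by apply/funext => x; rewrite big_nil.
rewrite big_cons (_ : (fun _ => _) = fun x => f i x + \sum_(j <- s) f j x).
  by apply: cvgD; [exact: cf|exact: ih].
by apply/funext => x; rewrite big_cons.
Qed.

Definition lin {R : realType} {n} (x : 'rV[R]_n) (c : 'cV[R]_n) : R := (x *m c) 0 0.

Lemma linE {R : realType} n (x : 'rV[R]_n) c : lin x c = \sum_j x 0 j * c j 0.
Proof. by rewrite /lin mxE. Qed.

Lemma linD {R : realType} n (x : 'rV[R]_n) c e : lin x (c + e) = lin x c + lin x e.
Proof. by rewrite /lin mulmxDr mxE. Qed.

Lemma linB {R : realType} n (x : 'rV[R]_n) c e : lin x (c - e) = lin x c - lin x e.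
Proof. by rewrite /lin mulmxBr !mxE. Qed.

Lemma linDl {R : realType} n (x y : 'rV[R]_n) c : lin (x + y) c = lin x c + lin y c.
Proof. by rewrite /lin mulmxDl mxE. Qed.

Lemma linZl {R : realType} n a (x : 'rV[R]_n) c : lin (a *: x) c = a * lin x c.
Proof. by rewrite /lin -scalemxAl mxE. Qed.

Lemma linZr {R : realType} n a (x : 'rV[R]_n) c : lin x (a *: c) = a * lin x c.
Proof. by rewrite /lin -scalemxAr mxE. Qed.

Lemma continuous_lin {R : realType} n (c : 'cV[R]_n) : continuous (lin ^~ c).
Proof.
rewrite (_ : lin ^~ c = fun x => \sum_j x 0 j * c j 0).
  apply: continuous_sum => j x.
  by apply: (@cvgM R _ (nbhs x)); [exact: coord_continuous|exact: cvg_cst].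
by apply/funext => x; rewrite linE.
Qed.

Section BorelVector.
Context {R : realType}.

(** [borel_rV] is generated by open sets rather than by coordinates. Writing an open set as a union
    over the countably many rational boxes inside it is what lets coordinatewise measurability
    suffice. *)
Lemma open_rV_bigcup n (U : set 'rV[R]_n) : open U ->
  U = \bigcup_(k in [set k : 'rV[rat]_n * rat |
         [set x : 'rV[R]_n | forall j, `|ratr (k.1 0 j) - x 0 j| < ratr k.2] `<=` U])
       [set x : 'rV[R]_n | forall j, `|ratr (k.1 0 j) - x 0 j| < ratr k.2].
Proof.
move=> oU; apply/seteqP; split => [x Ux|x [k kU]]; last exact: kU.
have /nbhs_ballP[e /= e0 xeU] := open_nbhs_nbhs (conj oU Ux).
(* Below [e / 2], so that a box of half-width [r] containing [x] lies in the ball of radius [e]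
   around [x]. *)
have [r /andP[r0 re]] : exists r : rat, (0 : R) < ratr r < e / 2.
  have e2 : 0 < e / 2 by rewrite divr_gt0.
  have [r] := rat_in_itvoo e2.
  by rewrite in_itv/= => ?; exists r.
have cj j : exists c : rat, `|ratr c - x 0 j| < ratr r.
  have xr : x 0 j - ratr r < x 0 j + ratr r by lra.
  have [c] := rat_in_itvoo xr.
  by rewrite in_itv/= => /andP[? ?]; exists c; rewrite ltr_norml; lra.
pose c j := sval (cid (cj j)).
have cP j : `|ratr (c j) - x 0 j| < ratr r by exact: (svalP (cid (cj j))).
exists (\row_j c j, r) => /=; last by move=> j; rewrite mxE.
move=> y yc; apply: xeU; split=> // i j; rewrite ord1 /ball/=.
have := yc j; rewrite mxE; have := cP j; rewrite !ltr_norml; lra.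
Qed.

Lemma measurable_fun_rV d (T : measurableType d) n (X : T -> 'rV[R]_n) :
  (forall j, measurable_fun setT (fun w => X w 0 j)) ->
  measurable_fun setT (X : T -> borel_rV n).
Proof.
move=> mX; apply: (@measurability _ _ T (borel_rV n) setT X (@open 'rV[R]_n)) => //.
move=> _ [U oU <-]; rewrite setTI (open_rV_bigcup oU) preimage_bigcup.
rewrite bigcup_mkcond; apply: countable_bigcupT_measurable => [|k].
  exact: countableP.
case: ifP => // _.
rewrite (_ : _ @^-1` _ =
    \bigcap_(j in [set: 'I_n]) [set w | `|ratr (k.1 0 j) - X w 0 j| < ratr k.2]).
  apply: fin_bigcap_measurable => // j _.
  rewrite -[X in measurable X]setTI.
  have : measurable_fun setT (fun w => `|ratr (k.1 0 j) - X w 0 j|).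
    by apply: measurableT_comp => //; apply: measurable_funB.
  move=> /(_ measurableT `]-oo, ratr k.2[%classic (measurable_itv _)).
  by congr measurable; apply/seteqP; split => w /=; rewrite in_itv.
by apply/seteqP; split => w /= H j; [move=> _; exact: H|exact: (H j Logic.I)].
Qed.

Lemma continuous_measurable_rV n (f : 'rV[R]_n -> R) : continuous f ->
  measurable_fun setT (f : borel_rV n -> R).
Proof.
move=> cf; apply: (measurability _ (RGenOpens.measurableE R)) => //.
move=> _ [_ [a [b ->]] <-]; rewrite setTI; apply: sub_sigma_algebra.
by move/continuousP: cf; apply; exact: itv_open.
Qed.

Lemma continuous_measurable_comp d (T : measurableType d) n (X : T -> 'rV[R]_n)
    (f : 'rV[R]_n -> R) :
  (forall j, measurable_fun setT (fun w => X w 0 j)) -> continuous f ->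
  measurable_fun setT (f \o X).
Proof.
move=> mX cf; apply: (measurableT_comp (continuous_measurable_rV cf)).
exact: measurable_fun_rV.
Qed.

End BorelVector.

(** * Weak convergence *)

Lemma sum_pair {R : realType} (I J : finType) (F : I * J -> R) :
  \sum_p F p = \sum_i \sum_j F (i, j).
Proof. by rewrite pair_bigA; apply: eq_bigr => -[]. Qed.

(** * Bernstein approximation on the unit cube *)

Section Bernstein.
Context {R : realType}.

Lemma unit_box_compact n : compact [set s : 'rV[R]_n | forall j, 0 <= s 0 j <= 1].
Proof.
have := @rV_compact R n (fun _ => `[0, 1]%classic) (fun _ => @segment_compact R 0 1).
by congr compact; apply/seteqP; split => s /= H i; have := H i; rewrite in_itv.
Qed.

(** Heine-Cantor through the covering form of compactness, with [delta] tending to 0 from the right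
    as the parameter. Only [s] is kept in the box, which spares a membership check for the second
    point. *)
Lemma unit_box_uniform n (h : 'rV[R]_n -> R) (e : R) : continuous h -> 0 < e ->
  exists2 delta : R, 0 < delta & forall s t : 'rV[R]_n,
    (forall j, 0 <= s 0 j <= 1) -> (forall j, `|s 0 j - t 0 j| < delta) ->
    `|h s - h t| < e.
Proof.
move=> ch e0.
have /compact_near_coveringP K := @unit_box_compact n.
have := K R 0^'+ (fun delta s => forall t : 'rV[R]_n,
  (forall j, `|s 0 j - t 0 j| < delta) -> `|h s - h t| < e) _.
case.
  move=> x _.
  have /cvgrPdist_lt /(_ (e / 2)) : h y @[y --> x] --> h x by exact: ch.
  rewrite divr_gt0// => /(_ isT) /nbhs_ballP[r /= r0 hr].
  exists (ball x (r / 2), [set z : R | z < r / 2]).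
    split; first by apply: nbhsx_ballx; rewrite divr_gt0.
    by apply: nbhs_right_lt; rewrite divr_gt0.
  move=> [s dl] /= [[_ sx] dr] t st.
  have hs : `|h x - h s| < e / 2.
    by apply: hr; split=> // i j; apply: (lt_trans (sx i j)); lra.
  have ht : `|h x - h t| < e / 2.
    apply: hr; split=> // i j; have := sx i j; have := st j.
    by rewrite ord1 /ball/= !ltr_norml; lra.
  by move: hs ht; rewrite !ltr_norml; lra.
move=> dl /= dl0 H.
exists (dl / 2); first by rewrite divr_gt0.
move=> s t sb st; apply: (H (dl / 2)) => //=.
  by rewrite sub0r normrN gtr0_norm ?divr_gt0//; lra.
by rewrite divr_gt0.
Qed.

(** The multivariate Bernstein polynomial seen as a mean: [h] is evaluated at the empirical
    frequencies of [N] coin tosses per coordinate, the coin of coordinate [j] showing heads with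
    probability [s_j]. *)
Definition bernstein n N (h : 'rV[R]_n -> R) (s : 'rV[R]_n) : R :=
  prod_mean (fun (ji : 'I_n * 'I_N) (e : bool) => if e then s 0 ji.1 else 1 - s 0 ji.1)
    (fun x => h (\row_j (N%:R^-1 * \sum_i (x (j, i))%:R))).

Lemma bernstein_bound n N (h : 'rV[R]_n -> R) (M : R) (s : 'rV[R]_n) :
  (forall x, `|h x| <= M) -> (forall j, 0 <= s 0 j <= 1) -> `|bernstein N h s| <= M.
Proof.
move=> hM sb.
have w0 (i : 'I_n * 'I_N) (e : bool) : 0 <= (if e then s 0 i.1 else 1 - s 0 i.1).
  by have := sb i.1; case: e; lra.
apply: (le_trans (prod_mean_norm w0 _)).
rewrite -[leRHS](@prod_mean_cst _ _ (fun (ji : 'I_n * 'I_N) (e : bool) =>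
  if e then s 0 ji.1 else 1 - s 0 ji.1)); last by move=> i; rewrite subrKC.
exact: prod_mean_le.
Qed.

(* Chebyshev: the empirical means of the [N] draws of each coordinate are
   within [delta] of [s] except on a set of weight [n / (4 N delta^2)]. *)
Lemma bernstein_cvg n (h : 'rV[R]_n -> R) (M : R) (e : R) : continuous h ->
  (forall x, `|h x| <= M) -> 0 < e -> exists N, forall s : 'rV[R]_n,
    (forall j, 0 <= s 0 j <= 1) -> `|h s - bernstein N h s| <= e.
Proof.
move=> ch hM e0.
have e20 : 0 < e / 2 by rewrite divr_gt0.
have [dl dl0 hdl] := unit_box_uniform ch e20.
have M0 : 0 <= M by apply: le_trans (hM 0).
(* When a coordinate of the empirical mean is at least [dl] away from [s], the trivial bound [2 M]
   is at most [D] times its squared distance. [N] is then chosen so that the mean of that term, at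
   most [D n / N], stays below [e / 2]. *)
pose D := 2 * M / dl ^+ 2.
have D0 : 0 <= D by rewrite divr_ge0 ?mulr_ge0// ltW// exprn_gt0.
pose N := (Num.trunc (D * n%:R / (e / 2))).+1.
have NP : D * n%:R / (e / 2) < N%:R.
  by apply: truncnS_gt.
have N0 : 0 < N%:R :> R by rewrite ltr0n.
exists N => s sb.
set w := fun (ji : 'I_n * 'I_N) (e : bool) => if e then s 0 ji.1 else 1 - s 0 ji.1.
have w0 (i : 'I_n * 'I_N) e' : 0 <= w i e'.
  by have := sb i.1; rewrite /w; case: e'; lra.
have w1 (i : 'I_n * 'I_N) : w i true + w i false = 1 by rewrite /w subrKC.
pose avg (x : {ffun 'I_n * 'I_N -> bool}) j : R := N%:R^-1 * \sum_i (x (j, i))%:R.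
have -> : h s - bernstein N h s = prod_mean w (fun x => h s + (- 1) * h (\row_j avg x j)).
  by rewrite prod_meanD prod_mean_cst// prod_meanZ mulN1r.
apply: (le_trans (prod_mean_norm w0 _)).
apply: (@le_trans _ _ (prod_mean w (fun x => e / 2 + D * \sum_j (avg x j - s 0 j) ^+ 2))).
  apply: prod_mean_le => // x; rewrite mulN1r.
  have sq0 j : 0 <= (avg x j - s 0 j) ^+ 2 by exact: sqr_ge0.
  have [near|/existsNP[j /negP]] := pselect (forall j, `|s 0 j - avg x j| < dl).
    apply: (@le_trans _ _ (e / 2)).
      by apply/ltW/hdl => // j; rewrite mxE.
    by rewrite lerDl mulr_ge0// sumr_ge0.
  rewrite -leNgt => far.
  apply: (@le_trans _ _ (2 * M)).
    apply: (le_trans (ler_normB _ _)).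
    by rewrite mulr2n mulrDl !mul1r lerD.
  apply: (@le_trans _ _ (D * (avg x j - s 0 j) ^+ 2)).
    rewrite /D -mulrA ler_peMr ?mulr_ge0// mulrC ler_pdivlMr ?exprn_gt0// mul1r.
    rewrite -[X in _ <= X]real_normK ?num_real// distrC.
    by rewrite lerXn2r// nnegrE// ltW.
  rewrite (bigD1 j)//= mulrDr addrA ler_wpDr ?mulr_ge0 ?sumr_ge0//.
    by rewrite invr_ge0 exprn_ge0// ltW.
  by rewrite ler_wpDl// ltW.
rewrite prod_meanD prod_mean_cst// prod_meanZ prod_mean_sum.
have var j : prod_mean w (fun x => (avg x j - s 0 j) ^+ 2) <= N%:R^-1.
  pose g (ki : 'I_n * 'I_N) (b : bool) : R :=
    if ki.1 == j then N%:R^-1 * (b%:R - s 0 j) else 0.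
  have -> : (fun x => (avg x j - s 0 j) ^+ 2) = fun x => (\sum_i g i (x i)) ^+ 2.
    apply/funext => x; congr (_ ^+ 2).
    rewrite sum_pair (bigD1 j)//=.
    rewrite [X in _ = _ + X]big1 ?addr0; last first.
      by move=> k /negPf kj; rewrite big1// => i _; rewrite /g/= kj.
    under eq_bigr => i _ do rewrite /g/= eqxx.
    rewrite -mulr_sumr sumrB mulrBr; congr (_ - _).
    rewrite sumr_const card_ord -[X in _ = _ * X]mulr_natl mulrA mulVf ?mul1r//.
    by rewrite gt_eqF.
  rewrite prod_mean_variance//; last first.
    by move=> [k i]; rewrite /w/g/=; case: eqP => [->|_]; ring.
  rewrite sum_pair (bigD1 j)//=.
  rewrite [X in _ + X]big1 ?addr0; last first.
    by move=> k /negPf kj; rewrite big1// => i _; rewrite /g/= kj expr0n/= !mulr0 addr0.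
  apply: (@le_trans _ _ (\sum_(i < N) N%:R^-1 ^+ 2)).
    apply: ler_sum => i _; rewrite /g/w/= eqxx/= mulr0n mulr1n !exprMn.
    rewrite [leLHS](_ : _ = N%:R^-1 ^+ 2 * (s 0 j * (1 - s 0 j))); last by ring.
    rewrite -[leRHS]mulr1 ler_wpM2l ?sqr_ge0//; have := sb j; nra.
  rewrite sumr_const card_ord -[X in X <= _]mulr_natl expr2 mulrA mulfV ?mul1r//.
  by rewrite gt_eqF.
have : D * (\sum_j prod_mean w (fun x => (avg x j - s 0 j) ^+ 2)) <= e / 2.
  apply: (@le_trans _ _ (D * (n%:R / N%:R))).
    rewrite ler_wpM2l//; apply: (le_trans (ler_sum _ (fun j _ => var j))).
    by rewrite sumr_const card_ord -[X in X <= _]mulr_natl.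
  by rewrite mulrA ler_pdivrMr// [X in _ <= X]mulrC -ler_pdivrMr// ltW.
by move=> /(lerD (lexx (e / 2))) H; apply: (le_trans H); rewrite -splitr.
Qed.

End Bernstein.

(** * Trigonometric polynomials on row vectors *)

Section TrigonometricPolynomials.
Context {R : realType}.
Variable n : nat.
Implicit Types p : 'rV[R]_n -> R.

(** The triples are amplitude, frequency and phase. With phases, cosines alone are stable under
    products by the product-to-sum formula, and sines are cosines shifted by [pi / 2]. *)
Definition is_trig p := exists s : seq (R * 'cV[R]_n * R),
  forall x, p x = \sum_(a <- s) a.1.1 * cos (lin x a.1.2 + a.2).

Lemma trigD p r : is_trig p -> is_trig r -> is_trig (fun x => p x + r x).
Proof.
move=> [s ps] [t rt]; exists (s ++ t) => x.
by rewrite big_cat/= -ps -rt.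
Qed.

Lemma trigZ c p : is_trig p -> is_trig (fun x => c * p x).
Proof.
move=> [s ps]; exists [seq (c * a.1.1, a.1.2, a.2) | a <- s] => x.
by rewrite big_map ps mulr_sumr; apply: eq_bigr => a _; rewrite mulrA.
Qed.

Lemma trig_cst c : is_trig (fun=> c).
Proof.
exists [:: (c, 0, 0)] => x.
by rewrite big_seq1/= /lin mulmx0 mxE addr0 cos0 mulr1.
Qed.

Lemma trig_cos c th : is_trig (fun x => cos (lin x c + th)).
Proof. by exists [:: (1, c, th)] => x; rewrite big_seq1 mul1r. Qed.

Lemma trig_sum (I : Type) (s : seq I) (F : I -> 'rV[R]_n -> R) :
  (forall i, is_trig (F i)) -> is_trig (fun x => \sum_(i <- s) F i x).
Proof.
move=> tF; elim: s => [|i s ih].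
  rewrite (_ : (fun _ => _) = fun=> 0); first exact: trig_cst.
  by apply/funext => x; rewrite big_nil.
rewrite (_ : (fun _ => _) = fun x => F i x + \sum_(j <- s) F j x).
  exact: trigD.
by apply/funext => x; rewrite big_cons.
Qed.

Lemma trigM p r : is_trig p -> is_trig r -> is_trig (fun x => p x * r x).
Proof.
move=> [s ps] [t rt].
have -> : (fun x => p x * r x) = fun x => \sum_(a <- s) \sum_(b <- t)
    (a.1.1 * b.1.1 / 2) * (cos (lin x (a.1.2 + b.1.2) + (a.2 + b.2)) +
                     cos (lin x (a.1.2 - b.1.2) + (a.2 - b.2))).
  apply/funext => x; rewrite ps rt mulr_suml; apply: eq_bigr => a _.
  rewrite mulr_sumr; apply: eq_bigr => b _.
  rewrite linD linB addrACA.
  rewrite (_ : lin x a.1.2 - lin x b.1.2 + (a.2 - b.2) =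
    lin x a.1.2 + a.2 - (lin x b.1.2 + b.2)); last by ring.
  by rewrite cosB (cosD (lin x a.1.2 + a.2)); field.
apply: trig_sum => a; apply: trig_sum => b; apply: trigZ.
by apply: trigD; exact: trig_cos.
Qed.

Lemma trig_prod (I : Type) (s : seq I) (F : I -> 'rV[R]_n -> R) :
  (forall i, is_trig (F i)) -> is_trig (fun x => \prod_(i <- s) F i x).
Proof.
move=> tF; elim: s => [|i s ih].
  rewrite (_ : (fun _ => _) = fun=> 1); first exact: trig_cst.
  by apply/funext => x; rewrite big_nil.
rewrite (_ : (fun _ => _) = fun x => F i x * \prod_(j <- s) F j x).
  exact: trigM.
by apply/funext => x; rewrite big_cons.
Qed.

(* Bernstein approximation in the variables [s_j = (1 + sin (x_j / (2K))) / 2],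
   which turns polynomials in [s] into trigonometric polynomials in [x]. *)
Lemma trig_approx (f : 'rV[R]_n -> R) (M K e : R) : continuous f ->
  (forall x, `|f x| <= M) -> 0 < K -> 0 < e ->
  exists2 p, is_trig p & (forall x, `|p x| <= M) /\
    (forall x : 'rV[R]_n, (forall j, `|x 0 j| <= K) -> `|f x - p x| <= e).
Proof.
move=> cf fM K0 e0.
have pi2 := @pihalf_ge1 R.
(* For [|x_j| <= K] the angle [x_j / (2K)] lies in [[-1/2, 1/2]], where [sin] is invertible, and its
   sine stays in [[-a, a]] with [a < 1]. *)
pose a : R := sin (1 / 2).
have a1 : a < 1.
  by rewrite -[X in _ < X]sin_pihalf ltr_sin ?in_itv/=; lra.
have a0 : 0 < a by rewrite sin_gt0_pihalf//; lra.
(* Clamping keeps the argument of [asin] away from the endpoints, so that [nu] below is continuous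
   everywhere. It changes nothing on the cube, where [nu] inverts [sg]. *)
pose cl (y : R) : R := Num.max (- a) (Num.min a y).
have cl_bd y : -1 < cl y < 1.
  by rewrite /cl; case: (leP a y) => ?; case: (leP (- a) _) => ?; lra.
have cl_id y : - a <= y <= a -> cl y = y.
  by move=> ?; rewrite /cl; case: (leP a y) => ?; case: (leP (- a) _) => ?; lra.
have ccl : continuous cl.
  move=> y; apply: (@continuous_max R R (fun=> - a) (fun y => Num.min a y)); first exact: cvg_cst.
  by apply: (@continuous_min R R (fun=> a) id); [exact: cvg_cst|exact: cvg_id].
pose nu (s : 'rV[R]_n) : 'rV[R]_n := \row_j (2 * K * asin (cl (2 * s 0 j - 1))).
have cnu : continuous nu.
  apply: continuous_row => j s.
  apply: (@cvgM R _ (nbhs s)); first exact: cvg_cst.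
  apply: (@continuous_comp _ _ _ (fun s : 'rV[R]_n => cl (2 * s 0 j - 1)) asin).
    apply: (@continuous_comp _ _ _ (fun s : 'rV[R]_n => 2 * s 0 j - 1) cl); last exact: ccl.
    apply: (@cvgB R _ _ (nbhs s)); last exact: cvg_cst.
    apply: (@cvgM R _ (nbhs s)); [exact: cvg_cst|exact: coord_continuous].
  by apply: continuous_asin; exact: cl_bd.
pose sg (x : 'rV[R]_n) : 'rV[R]_n := \row_j ((1 + sin (x 0 j / (2 * K))) / 2).
have sg01 x j : 0 <= sg x 0 j <= 1.
  by rewrite mxE; have := sin_geN1 (x 0 j / (2 * K)); have := sin_le1 (x 0 j / (2 * K)); lra.
have nusg (x : 'rV[R]_n) : (forall j, `|x 0 j| <= K) -> nu (sg x) = x.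
  move=> xK; apply/rowP => j; rewrite !mxE.
  have xj : - (1 / 2) <= x 0 j / (2 * K) <= 1 / 2.
    have := xK j; rewrite ler_norml => /andP[? ?].
    by rewrite ler_pdivlMr ?ler_pdivrMr; nra.
  rewrite (_ : 2 * _ - 1 = sin (x 0 j / (2 * K))); last by field.
  have pinu : x 0 j / (2 * K) \in `[(- (pi / 2)), pi / 2] by rewrite in_itv/=; lra.
  rewrite cl_id; last first.
    have := @ltr_sin R; rewrite /a -sinN => H.
    by rewrite !leNgt !H -?leNgt ?in_itv/=; lra.
  by rewrite sinK//; field; rewrite gt_eqF.
have chn : continuous (f \o nu) by move=> s; apply: continuous_comp; [exact: cnu|exact: cf].
have [N HN] := bernstein_cvg chn (fun s => fM (nu s)) e0.
exists (bernstein N (f \o nu) \o sg); last split.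
- rewrite /bernstein /prod_mean /comp; apply: trig_sum => x.
  rewrite (_ : (fun _ => _) = fun y => f (nu (\row_j (N%:R^-1 * \sum_i (x (j, i))%:R))) *
    (\prod_(i : 'I_n * 'I_N) (if x i then sg y 0 i.1 else 1 - sg y 0 i.1))); last first.
    by apply/funext => y; rewrite mulrC.
  apply: trigZ; apply: trig_prod => -[j i].
  have tsg : is_trig (fun y => sg y 0 j).
    rewrite (_ : (fun _ => _) = fun y => 1 / 2 +
      (1 / 2) * cos (lin y (((2 * K)^-1 *: delta_mx j 0) : 'cV[R]_n) + - (pi / 2))).
      by apply: trigD; [exact: trig_cst|apply: trigZ; exact: trig_cos].
    apply/funext => y; rewrite mxE cosBpihalf linE (bigD1 j)//= !mxE !eqxx big1.
      by rewrite /= mulr1 addr0; field.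
    by move=> k /negPf kj; rewrite !mxE kj !mulr0.
  case: (x (j, i)) => //=.
  rewrite (_ : (fun _ => _) = fun y => 1 + (-1) * sg y 0 j).
    by apply: trigD; [exact: trig_cst|exact: trigZ].
  by apply/funext => y; rewrite mulN1r.
- by move=> x; apply: bernstein_bound => // s; exact: fM.
- by move=> x xK; have := HN (sg x) (sg01 x); rewrite /= nusg.
Qed.

Lemma trig_mbounded d (T : measurableType d) (X : T -> 'rV[R]_n) p :
  (forall j, measurable_fun setT (fun w => X w 0 j)) -> is_trig p ->
  mbounded (p \o X).
Proof.
move=> mX [s ps]; rewrite (_ : p \o X = fun w => \sum_(a <- s) a.1.1 * cos (lin (X w) a.1.2 + a.2)).
  apply: mbounded_sum => a; apply: mboundedZ; split; last by exists 1 => x; exact: cos_max.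
  apply: (measurableT_comp (continuous_measurable_fun (@continuous_cos R))); apply: measurable_funD => //.
  exact: (continuous_measurable_comp mX (@continuous_lin _ _ _)).
by apply/funext => w; rewrite /= ps.
Qed.

End TrigonometricPolynomials.

(** * From characteristic functions to weak convergence *)

Section WeakConvergence.
Context {R : realType}.
Variable n : nat.

(** A continuous stand-in for the indicator of the complement of the cube of half-side [K]: it
    equals 1 there, and its mean is at most the second moment over [K^2]. *)
Definition tail (K : R) (x : 'rV[R]_n) : R :=
  Num.min 1 ((\sum_j x 0 j ^+ 2) / K ^+ 2).

Lemma tail_ge0 K x : 0 <= tail K x.
Proof.
rewrite le_min ler01 divr_ge0 ?sqr_ge0// sumr_ge0// => j _; exact: sqr_ge0.
Qed.

Lemma tail_le1 K x : tail K x <= 1.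
Proof. by rewrite ge_min lexx. Qed.

Lemma continuous_tail K : continuous (tail K).
Proof.
move=> x.
apply: (@continuous_min R 'rV[R]_n (fun=> 1) (fun x => (\sum_j x 0 j ^+ 2) / K ^+ 2)).
  exact: cst_continuous.
apply: (@cvgM R _ (nbhs x)); last exact: cvg_cst.
apply: continuous_sum => j {}x.
have -> : (fun y : 'rV[R]_n => y 0 j ^+ 2) = (fun y => y 0 j * y 0 j).
  by apply/funext => y; rewrite expr2.
by apply: (@cvgM R _ (nbhs x)); exact: coord_continuous.
Qed.

Lemma tail_mbounded d (T : measurableType d) (X : T -> 'rV[R]_n) K :
  (forall j, measurable_fun setT (fun w => X w 0 j)) -> mbounded (tail K \o X).
Proof.
move=> mX; split.
  exact: (continuous_measurable_comp mX (@continuous_tail K)).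
by exists 1 => w; rewrite ger0_norm ?tail_ge0 ?tail_le1.
Qed.

(** Outside the cube only [|p| <= M] is available, and the error [2 M] there is charged to [tail],
    which equals 1. *)
Lemma trig_approx_tail (f : 'rV[R]_n -> R) (M K e : R) : continuous f ->
  (forall x, `|f x| <= M) -> 0 < K -> 0 < e ->
  exists2 p, is_trig p & forall x, `|f x - p x| <= e + 2 * M * tail K x.
Proof.
move=> cf fM K0 e0; have [p tp [pM pf]] := trig_approx cf fM K0 e0.
have M0 : 0 <= M by apply: le_trans (fM 0).
exists p => // x.
have [small|/existsNP[j /negP]] := pselect (forall j, `|x 0 j| <= K).
  by apply: (le_trans (pf x small)); rewrite lerDl !mulr_ge0// tail_ge0.
rewrite -ltNge => big.
have -> : tail K x = 1.
  apply/min_idPl; rewrite ler_pdivlMr ?exprn_gt0// mul1r (bigD1 j)//=.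
  rewrite ler_wpDr ?sumr_ge0// => [i _|]; first exact: sqr_ge0.
  by rewrite -[leRHS]real_normK ?num_real// lerXn2r ?nnegrE// ltW.
apply: (le_trans (ler_normB _ _)); have := fM x; have := pM x; lra.
Qed.

Definition tight {d} {T : measurableType d} (P : probability T R)
    (X : nat -> T -> 'rV[R]_n) :=
  forall e : R, 0 < e -> exists2 K, 0 < K & \forall t \near \oo, Ex P (tail K \o X t) <= e.

(** The truncation at 1 lets dominated convergence act as [K] grows, in place of a moment bound. *)
Lemma tight_cst d (T : measurableType d) (P : probability T R) (X : T -> 'rV[R]_n) :
  (forall j, measurable_fun setT (fun w => X w 0 j)) -> tight P (fun=> X).
Proof.
move=> mX e e0.
have : Ex P (tail k.+1%:R \o X) @[k --> \oo] --> Ex P (fun=> 0).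
  apply: (@Ex_cvg _ _ _ P _ _ 1) => //.
  - by move=> k; have [] := tail_mbounded k.+1%:R mX.
  - by move=> k x; rewrite ger0_norm ?tail_ge0 ?tail_le1.
  - apply: aeW => w; set S := \sum_j X w 0 j ^+ 2.
    apply: (@squeeze_cvgr _ _ _ _ (fun=> 0) (fun k => S * k.+1%:R^-1)).
    + apply: nearW => k; rewrite tail_ge0 /= /tail ge_min; apply/orP; right.
      rewrite ler_wpM2l ?sumr_ge0// => [j _|]; first exact: sqr_ge0.
      rewrite lef_pV2 ?posrE ?exprn_gt0 ?ltr0n//.
      by rewrite expr2 ler_peMl// ler1n.
    + exact: cvg_cst.
    + rewrite -[X in _ --> X](mulr0 S); apply: cvgM; first exact: cvg_cst.
      exact: cvg_harmonic.
rewrite Ex_cst => /cvgrPdist_lt /(_ e e0)[k0 _ H].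
exists k0.+1%:R; first by rewrite ltr0n.
apply: nearW => _; have := H k0 (leqnn _); rewrite sub0r normrN => /ltW.
apply: le_trans; exact: ler_norm.
Qed.

(** Levy's continuity theorem with the limit law given: one trigonometric polynomial serves all
    large [t], and tightness bounds its error uniformly. With a constant sequence it also yields
    uniqueness. *)
Lemma charfun_cvg_Ex d (T : measurableType d) (P : probability T R)
    (X : nat -> T -> 'rV[R]_n) d' (T' : measurableType d') (Q : probability T' R)
    (Y : T' -> 'rV[R]_n) (f : 'rV[R]_n -> R) (M : R) :
  (forall t j, measurable_fun setT (fun w => X t w 0 j)) ->
  (forall j, measurable_fun setT (fun w => Y w 0 j)) -> tight P X ->
  (forall c th, Ex P (fun w => cos (lin (X t w) c + th)) @[t --> \oo] -->
                Ex Q (fun w => cos (lin (Y w) c + th))) ->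
  continuous f -> (forall x, `|f x| <= M) ->
  Ex P (f \o X t) @[t --> \oo] --> Ex Q (f \o Y).
Proof.
move=> mX mY tX cX cf fM.
have M0 : 0 <= M by apply: le_trans (fM 0).
have bf t : mbounded (f \o X t).
  by split; [exact: continuous_measurable_comp|exists M => w; exact: fM].
have bfY : mbounded (f \o Y).
  by split; [exact: continuous_measurable_comp|exists M => w; exact: fM].
have trigcvg p : is_trig p -> Ex P (p \o X t) @[t --> \oo] --> Ex Q (p \o Y).
  move=> [s ps].
  have bcos d0 (T0 : measurableType d0) (Z : T0 -> 'rV[R]_n) (a : R * 'cV[R]_n * R) :
      (forall j, measurable_fun setT (fun w => Z w 0 j)) ->
      mbounded (fun w => cos (lin (Z w) a.1.2 + a.2)).
    by move=> mZ; apply: (trig_mbounded mZ (trig_cos a.1.2 a.2)).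
  have E d0 (T0 : measurableType d0) (P0 : probability T0 R) (Z : T0 -> 'rV[R]_n) :
      (forall j, measurable_fun setT (fun w => Z w 0 j)) ->
      Ex P0 (p \o Z) = \sum_(a <- s) a.1.1 * Ex P0 (fun w => cos (lin (Z w) a.1.2 + a.2)).
    move=> mZ; have -> : p \o Z = fun w => \sum_(a <- s) a.1.1 * cos (lin (Z w) a.1.2 + a.2).
      by apply/funext => w; rewrite /= ps.
    rewrite Ex_sum => [|a]; last exact/mboundedZ/bcos.
    by apply: eq_bigr => a _; rewrite ExZ//; exact: bcos.
  rewrite E//; under eq_fun => t do rewrite E//.
  elim: s {ps E} => [|a s ih].
    rewrite big_nil (_ : (fun t => _) = fun=> 0); first exact: cvg_cst.
    by apply/funext => t; rewrite big_nil.
  rewrite big_cons (_ : (fun t => _) = fun t => a.1.1 * Ex P (fun w => cos (lin (X t w) a.1.2 + a.2)) +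
    \sum_(b <- s) b.1.1 * Ex P (fun w => cos (lin (X t w) b.1.2 + b.2))); last first.
    by apply/funext => t; rewrite big_cons.
  apply: cvgD => //; apply: cvgM; [exact: cvg_cst|exact: cX].
apply/cvgrPdist_le => e e0.
(* Two approximation errors [e1 + 2 M e1] and one gap [e1] between trigonometric means have to fit
   in [e]. *)
pose e1 := e / (5 * (1 + 2 * M)).
have e10 : 0 < e1 by rewrite divr_gt0// mulr_gt0//; lra.
have [K1 K10 tX1] := tX e1 e10.
have [K2 K20 tY1] := tight_cst Q mY e10.
pose K := Num.max K1 K2.
have K0 : 0 < K by rewrite lt_max K10.
have tailK (a : R) x : 0 < a -> a <= K -> tail K x <= tail a x.
  move=> a0 aK; rewrite /tail le_min ge_min lexx/= ge_min; apply/orP; right.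
  rewrite ler_wpM2l ?sumr_ge0// => [j _|]; first exact: sqr_ge0.
  by rewrite lef_pV2 ?posrE ?exprn_gt0// lerXn2r// nnegrE ltW.
have [p tp fp] := trig_approx_tail cf fM K0 e10.
have bT d0 (T0 : measurableType d0) (P0 : probability T0 R) (Z : T0 -> 'rV[R]_n) (a : R) :
    (forall j, measurable_fun setT (fun w => Z w 0 j)) -> mbounded (f \o Z) ->
    0 < a -> a <= K -> Ex P0 (tail a \o Z) <= e1 ->
    `|Ex P0 (f \o Z) - Ex P0 (p \o Z)| <= e1 + 2 * M * e1.
  move=> mZ bfZ a0 aK taile.
  have bt := tail_mbounded a mZ.
  apply: (@le_trans _ _ (Ex P0 (fun w => e1 + 2 * M * (tail a \o Z) w))).
    apply: Ex_dist_le => //.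
    - exact: trig_mbounded.
    - by apply: mboundedD; [exact: mbounded_cst|exact: mboundedZ].
    - move=> w; apply: (le_trans (fp (Z w))); rewrite lerD2l ler_wpM2l ?mulr_ge0//.
      exact: tailK.
  rewrite ExD; [|exact: mbounded_cst|exact: mboundedZ].
  by rewrite Ex_cst ExZ// lerD2l ler_wpM2l// mulr_ge0.
have HY : `|Ex Q (f \o Y) - Ex Q (p \o Y)| <= e1 + 2 * M * e1.
  apply: (bT _ _ _ _ K2) => //; first by rewrite le_max lexx orbT.
  by case: tY1 => k0 _ /(_ k0 (leqnn _)).
have /cvgrPdist_le /(_ e1 e10) pcvg := trigcvg _ tp.
have ee : e = 5 * e1 + 10 * M * e1.
  by rewrite /e1; field; apply/eqP; lra.
near=> t.
have HX : `|Ex P (f \o X t) - Ex P (p \o X t)| <= e1 + 2 * M * e1.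
  apply: (bT _ _ _ _ K1) => //; first by rewrite le_max lexx.
  by near: t.
have Hp : `|Ex Q (p \o Y) - Ex P (p \o X t)| <= e1 by near: t.
have : 0 <= M * e1 by rewrite mulr_ge0// ltW.
by move: HY HX Hp; rewrite !ler_norml; lra.
Unshelve. all: by end_near. Qed.

End WeakConvergence.

Lemma coord_measurable {R : realType} n (j : 'I_n) :
  measurable_fun setT (fun x : borel_rV n => x 0 j : R).
Proof. exact: (continuous_measurable_rV (@coord_continuous R 1 n 0 j)). Qed.

Lemma charfun_cvg_distribution {R : realType} n d (T : measurableType d)
    (P : probability T R) (X : nat -> T -> 'rV[R]_n) (mu : probability (borel_rV n) R) :
  (forall t j, measurable_fun setT (fun w => X t w 0 j)) -> tight P X ->
  (forall c th, Ex P (fun w => cos (lin (X t w) c + th)) @[t --> \oo] -->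
                Ex mu (fun x => cos (lin x c + th))) ->
  cvg_distribution P X mu.
Proof.
move=> mX tX cX f cf [M fM].
have bf t : mbounded (f \o X t).
  by split; [exact: continuous_measurable_comp|exists M => w; exact: fM].
have bfm : mbounded (f : borel_rV n -> R).
  by split; [exact: continuous_measurable_rV|exists M].
rewrite mbounded_integral//.
under eq_fun => t do rewrite unlock mbounded_integral//.
apply: cvg_EFin; first exact: nearW.
exact: (@charfun_cvg_Ex R n d T P X _ _ mu (fun x : borel_rV n => x : 'rV[R]_n) f M mX
  (@coord_measurable R n) tX cX cf fM).
Qed.

(* One-dimensional uniqueness: bounded continuous functions are limits of
   trigonometric polynomials, and indicators of half-lines are limits of
   bounded continuous functions. *)
Lemma charfun_unique {R : realType} (P Q : probability R R) :
  (forall s th, Ex P (fun x => cos (s * x + th)) = Ex Q (fun x => cos (s * x + th))) ->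
  forall A, measurable A -> P A = Q A.
Proof.
move=> PQ.
have mX : forall j : 'I_1, measurable_fun setT (fun y : R => (const_mx y : 'rV[R]_1) 0 j).
  move=> j; have -> : (fun y : R => (const_mx y : 'rV[R]_1) 0 j) = id.
    by apply/funext => y; rewrite mxE.
  exact: measurable_id.
have Ef (f : R -> R) : continuous f -> (forall x, 0 <= f x <= 1) -> Ex P f = Ex Q f.
  move=> cf f01.
  have cf' : continuous (fun x : 'rV[R]_1 => f (x 0 0)).
    by move=> x; apply: continuous_comp; [exact: coord_continuous|exact: cf].
  (* Applied to the constant sequence [P] on vectors with one entry, the convergence theorem becomes
     an equality of means. *)
  have := @charfun_cvg_Ex R 1 _ _ P (fun _ y => const_mx y) _ _ Q (fun y => const_mx y)
    (fun x => f (x 0 0)) 1 (fun=> mX) mX (tight_cst P mX) _ cf' _.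
  have E (P0 : probability R R) : Ex P0 ((fun x : 'rV[R]_1 => f (x 0 0)) \o (fun y => const_mx y)) = Ex P0 f.
    by congr Ex; apply/funext => y; rewrite /= mxE.
  rewrite !E => H.
  have H1 : (fun _ : nat => Ex P f) @ \oo --> Ex P f by exact: cvg_cst.
  suff H2 : (fun _ : nat => Ex P f) @ \oo --> Ex Q f.
    exact: (cvg_unique _ H1 H2).
  apply: H => [c th|x]; last by rewrite ger0_norm; have /andP[] := f01 (x 0 0).
  have Ec (P0 : probability R R) : Ex P0 (fun w => cos (lin (const_mx w : 'rV[R]_1) c + th)) =
      Ex P0 (fun x => cos (c 0 0 * x + th)).
    by congr Ex; apply/funext => y; rewrite linE big_ord1 mxE mulrC.
  by rewrite !Ec PQ; exact: cvg_cst.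
(* Ramps equal to 1 up to [r] and falling to 0 at [r + 1/(k+1)] decrease to the indicator of the
   closed half-line. *)
have Pray (P0 : probability R R) (r : R) :
    Ex P0 (fun x => Num.min 1 (Num.max 0 (1 - k.+1%:R * (x - r)))) @[k --> \oo] -->
    fine (P0 `]-oo, r]%classic).
  have -> : fine (P0 `]-oo, r]%classic) = Ex P0 (\1_(`]-oo, r]%classic)).
    by rewrite /Ex /Rintegral integral_indic// setIT.
  apply: (@Ex_cvg _ _ _ _ _ _ 1) => //.
  - move=> k; apply: measurable_minr => //; apply: measurable_maxr => //.
    apply: measurable_funB => //; apply: measurable_funM => //.
    exact: measurable_funB.
  - move=> k x; rewrite ger0_norm; first by rewrite ge_min lexx.
    by rewrite le_min ler01 le_max lexx.
  - apply: aeW => x; rewrite indicE; case: (lerP x r) => xr.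
      rewrite mem_set/= ?in_itv//=; apply: cvg_near_cst; apply: nearW => k.
      apply/min_idPl; rewrite le_max; apply/orP; right.
      have : k.+1%:R * (x - r) <= 0 by rewrite mulr_ge0_le0// subr_le0.
      by lra.
    rewrite memNset/= ?in_itv/= ?leNgt ?xr//; apply: cvg_near_cst.
    exists (Num.trunc ((x - r)^-1)) => // k /= kx.
    have : 1 < k.+1%:R * (x - r).
      rewrite -ltr_pdivrMr ?subr_gt0// mul1r.
      by apply: (lt_le_trans (truncnS_gt _)); rewrite ler_nat.
    by move=> H; case: (leP 0 (1 - k.+1%:R * (x - r))) => ?; case: (leP 1 _) => ?; lra.
have ray (r : R) : P `]-oo, r]%classic = Q `]-oo, r]%classic.
  suff : fine (P `]-oo, r]%classic) = fine (Q `]-oo, r]%classic).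
    move=> H; rewrite -[LHS]fineK ?fin_num_measure//.
    by rewrite -[RHS]fineK ?fin_num_measure// H.
  apply: (@cvg_unique _ (@norm_hausdorff _ R) _ _ _ _ (Pray P r)).
  apply: cvg_trans (Pray Q r); apply: near_eq_cvg; apply: nearW => k; apply/esym/Ef.
    move=> x; apply: (@continuous_min R R (fun=> 1) (fun x => Num.max 0 _)); first exact: cvg_cst.
    apply: (@continuous_max R R (fun=> 0) (fun x => 1 - _)); first exact: cvg_cst.
    apply: (@cvgB R _ _ (nbhs x)); first exact: cvg_cst.
    apply: (@cvgM R _ (nbhs x)); first exact: cvg_cst.
    by apply: (@cvgB R _ _ (nbhs x)); [exact: cvg_id|exact: cvg_cst].
  by move=> x; rewrite ge_min lexx le_min ler01 le_max lexx.
move=> A mA.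
have E : @measurable _ R = <<s @RGenOInfty.G R >>.
  exact: RGenOInfty.measurableE.
apply: (@g_sigma_algebra_measure_unique _ R R (@RGenOInfty.G R) _
  (fun k => `]- k%:R, +oo[%classic)).
- by move=> _ [r ->]; exact: measurable_itv.
- by move=> k; exists (- k%:R).
- apply/seteqP; split => // x _.
  exists (Num.trunc (- x)).+1 => //=; rewrite in_itv/= andbT ltrNl; exact/truncnS_gt.
- move=> _ _ [r ->] [s ->]; exists (Num.max r s).
  by apply/seteqP; split => x /=; rewrite !in_itv/= gt_max !andbT; [move=> [-> ->]|move=> /andP].
- move=> _ [r ->].
  have Pc (P0 : probability R R) : P0 `]r, +oo[%classic = (1 - P0 `]-oo, r]%classic)%E.
    by rewrite -setCitvl; apply: probability_setC; exact: measurable_itv.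
  apply: (etrans (Pc P)); rewrite ray; exact/esym/Pc.
- by move=> k; rewrite (le_lt_trans (probability_le1 _ _))// ltry.
- by rewrite -E.
Qed.

(** * Gaussian vectors *)

Section NormalCharacteristic.
Context {R : realType}.
Variable s : R.
Hypothesis s0 : 0 < s.
Local Notation mu := (@lebesgue_measure R).
Local Notation pdf := (normal_pdf 0 s).

Let s_neq0 : s != 0. Proof. by rewrite gt_eqF. Qed.

(** [normal_prob] is known through its values on sets; its density is recovered as the Radon-Nikodym
    derivative, which equals [pdf] almost everywhere. *)
Lemma integral_normal_prob (f : R -> R) : mbounded f ->
  Ex (normal_prob 0 s) f = (\int[mu]_x (f x * pdf x))%R.
Proof.
move=> bf; rewrite /Ex /Rintegral; congr fine.
have dom := normal_prob_dominates 0 s.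
under [RHS]eq_integral => x _ do rewrite EFinM.
rewrite -(Radon_Nikodym_change_of_variables dom)//=; last first.
  exact: (mbounded_integrable (normal_prob 0 s) bf).
have mf : measurable_fun setT (EFin \o f) by apply/measurable_EFinP; case: bf.
apply: ae_eq_integral => //.
- apply: emeasurable_funM => //.
- apply: emeasurable_funM => //=; apply/measurableT_comp => //=.
  exact: measurable_normal_pdf.
- apply: ae_eqe_mul2l => /=.
  rewrite Radon_NikodymE//=.
  case: cid => /= h [h1 h2 h3].
  apply: integral_ae_eq => //=.
  + by apply/measurableT_comp => //; exact: measurable_normal_pdf.
  + by move=> E E01 mE; rewrite -h3.
Qed.

Lemma normal_pdf_expR x : pdf x = normal_peak s * expR (- x ^+ 2 / (s ^+ 2 *+ 2)).
Proof. by rewrite normal_pdfE// /normal_fun subr0. Qed.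

Lemma is_derive_normal_pdf (x : R) : is_derive x 1 pdf (- (x / s ^+ 2) * pdf x).
Proof.
have -> : pdf = fun x => normal_peak s * expR (- x ^+ 2 / (s ^+ 2 *+ 2)).
  by apply/funext => y; rewrite normal_pdf_expR.
apply: is_derive_eq.
move: (expR _) (normal_peak s) => E p.
have -> : x%:A = x :> R by rewrite /GRing.scale/= mulr1.
rewrite scaler0 add0r /GRing.scale/= -(mulr_natr (s ^+ 2)).
have e (u v y z : R) : u * (v * (y^-1 * - (z + z))) = - (z / (y/2)) * (u * v).
  rewrite invf_div; ring.
rewrite e mulfK//.
Qed.

(** A factor [|x|] is absorbed by doubling the deviation, which reduces the integrability of first
    moments to that of a Gaussian density. *)
Lemma normal_pdf_moment_le x : `|x| * pdf x <= 2 * s * normal_pdf 0 (2 * s) x.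
Proof.
have s20 : 2 * s != 0 by rewrite mulf_neq0.
rewrite normal_pdf_expR normal_pdfE// /normal_fun subr0.
have pk : normal_peak s = 2 * normal_peak (2 * s).
  rewrite /normal_peak (_ : (2 * s) ^+ 2 * pi *+ 2 = 2 ^+ 2 * (s ^+ 2 * pi *+ 2)).
    rewrite (sqrtrM _ (sqr_ge0 2)) sqrtr_sqr.
    by rewrite ger0_norm// invfM mulrA mulfV ?mul1r.
  by ring.
have pk0 := normal_peak_gt0 s20.
(* The exponent is the difference [x^2/(2 s^2) - x^2/(8 s^2)] between the two Gaussians. With
   [y = |x|/s] the claim reduces to [y <= 1 + 3 y^2/8]. *)
have : `|x| <= s * expR (3 * x ^+ 2 / (8 * s ^+ 2)).
  apply: (@le_trans _ _ (s * (1 + 3 * x ^+ 2 / (8 * s ^+ 2)))); last first.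
    by rewrite ler_pM2l// expR_ge1Dx.
  rewrite -ler_pdivrMl// -[x ^+ 2](@real_normK _ x) ?num_real//.
  have -> : 3 * `|x| ^+ 2 / (8 * s ^+ 2) = 3 / 8 * (s^-1 * `|x|) ^+ 2 by field.
  by have := sqr_ge0 (s^-1 * `|x| - 4 / 3); nra.
rewrite pk => /(ler_wpM2r (expR_ge0 (- x ^+ 2 / (s ^+ 2 *+ 2)))).
rewrite -[X in _ <= X -> _]mulrA -expRD => /(ler_wpM2l (ltW pk0)) H.
rewrite [leLHS](_ : _ = 2 * (normal_peak (2 * s) * (`|x| * expR (- x ^+ 2 / (s ^+ 2 *+ 2))))); last by ring.
rewrite -[leRHS]mulrA ler_pM2l//; apply: (le_trans H).
rewrite mulrCA ler_pM2l// ler_pM2l// ler_expR le_eqVlt; apply/orP; left; apply/eqP.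
by field.
Qed.

(** [C = 1, D = 0] serves the characteristic function, and [C = 0, D = 1] its derivative in [t]. *)
Lemma integrable_dominated_pdf (g : R -> R) (C D : R) : 0 <= C -> 0 <= D ->
  measurable_fun setT g -> (forall x, `|g x| <= (C + D * `|x|) * pdf x) ->
  mu.-integrable setT (EFin \o g).
Proof.
move=> C0 D0 mg gle.
have iC := integrableZl measurableT C (integrable_normal_pdf 0 s).
have iD := integrableZl measurableT (D * (2 * s)) (integrable_normal_pdf 0 (2 * s)).
apply: (le_integrable measurableT _ _ (integrableD measurableT iC iD)).
  exact/measurable_EFinP.
move=> x _ /=; rewrite lee_fin; apply: (le_trans (gle x)).
apply: le_trans (ler_norm _); rewrite mulrDl lerD2l -!mulrA ler_wpM2l//.
by rewrite mulrA; exact: normal_pdf_moment_le.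
Qed.

Variable th : R.
Definition normal_cos (t : R^o) : R := (\int[mu]_x (cos (t * x + th) * pdf x))%R.

Lemma cvg_normal_pdf_infty : pdf k%:R @[k --> \oo] --> 0.
Proof.
apply: (@squeeze_cvgr _ _ _ _ (fun=> 0)
  (fun k => (normal_peak s * (s ^+ 2 *+ 2)) * k%:R^-1)); last 2 first.
- exact: cvg_cst.
- rewrite -[X in _ --> X](mulr0 (normal_peak s * (s ^+ 2 *+ 2))); apply: cvgM; first exact: cvg_cst.
  apply/(@cvgrPdist_lt _ R^o) => e e0; exists (Num.trunc e^-1).+1 => // k /= ke.
  have k0 : 0 < k%:R :> R by rewrite ltr0n (leq_trans _ ke).
  rewrite sub0r normrN gtr0_norm ?invr_gt0// invf_plt ?posrE//.
  by apply: (lt_le_trans (truncnS_gt _)); rewrite ler_nat.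
exists 1%N => // k /= k1; rewrite normal_pdf_ge0/= normal_pdf_expR -mulrA ler_wpM2l ?normal_peak_ge0//.
have k0 : 0 < k%:R :> R by rewrite ltr0n.
have k1' : 1 <= k%:R :> R by rewrite ler1n.
rewrite mulNr expRN invf_ple ?posrE ?expR_gt0 ?divr_gt0 ?invr_gt0//; last first.
  by rewrite mulrn_wgt0// exprn_gt0.
rewrite invfM invrK; apply: le_trans (expR_ge1Dx _).
rewrite ler_wpDl// mulrC ler_wpM2r ?invr_ge0 ?mulrn_wge0 ?sqr_ge0//.
by rewrite expr2 ler_peMl// ltW.
Qed.

Lemma measurable_trig_pdf (f : R -> R) (t : R) : measurable_fun setT f ->
  measurable_fun setT (fun x : R => f (t * x + th)) /\
  measurable_fun setT (fun x : R => f (t * x + th) * pdf x).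
Proof.
move=> mf; have H : measurable_fun setT (fun x : R => f (t * x + th)).
  by apply: (measurableT_comp mf); apply: measurable_funD.
by split=> //; apply: measurable_funM => //; exact: measurable_normal_pdf.
Qed.

Lemma integrable_cos_pdf (t : R) : mu.-integrable setT (fun x => (cos (t * x + th) * pdf x)%:E).
Proof.
apply: (@integrable_dominated_pdf _ 1 0) => //.
  exact: (measurable_trig_pdf t (continuous_measurable_fun (@continuous_cos R))).2.
move=> x; rewrite mul0r addr0 normrM (ger0_norm (normal_pdf_ge0 _ _ _)).
by rewrite ler_wpM2r ?normal_pdf_ge0 ?cos_max.
Qed.

Lemma integrable_xsin_pdf (t : R) :
  mu.-integrable setT (fun x => (- x * sin (t * x + th) * pdf x)%:E).
Proof.
apply: (@integrable_dominated_pdf _ 0 1) => //.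
  apply: measurable_funM; last exact: measurable_normal_pdf.
  apply: measurable_funM; first exact: measurable_funN.
  exact: (measurable_trig_pdf t (continuous_measurable_fun (@continuous_sin R))).1.
move=> x; rewrite add0r mul1r !normrM normrN (ger0_norm (normal_pdf_ge0 _ _ _)).
by rewrite ler_wpM2r ?normal_pdf_ge0// ler_piMr ?sin_max.
Qed.

(* Integrating the derivative of [s^2 sin (t x + th) pdf x] over the line. *)
Lemma normal_stein (t : R) :
  (\int[mu]_x (- x * sin (t * x + th) * pdf x))%R = - (s ^+ 2 * t) * normal_cos t.
Proof.
pose G x := s ^+ 2 * (sin (t * x + th) * pdf x).
pose g x := s ^+ 2 * t * (cos (t * x + th) * pdf x) + - x * sin (t * x + th) * pdf x.
have dG (x : R) : is_derive x 1 G (g x).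
  have dp := is_derive_normal_pdf x.
  apply: is_derive_eq.
  rewrite /g; move: (sin _) (cos _) (pdf x) => S C p.
  rewrite /GRing.scale/= !mulr1; field.
  exact: s_neq0.
have ig : mu.-integrable setT (EFin \o g).
  have := integrableD measurableT
    (integrableZl measurableT (s ^+ 2 * t) (integrable_cos_pdf t)) (integrable_xsin_pdf t).
  by apply: eq_integrable => // x _; rewrite /g /= EFinD EFinM.
have cG : continuous G by move=> x; apply/differentiable_continuous/derivable1_diffP; have [] := dG x.
have cg : continuous g.
  move=> x; apply: cvgD.
    apply: cvgM; first exact: cvg_cst.
    apply: cvgM; last exact: continuous_normal_pdf.
    apply: continuous_comp; last exact: continuous_cos.
    by apply: cvgD; [apply: cvgM; [exact: cvg_cst|exact: cvg_id]|exact: cvg_cst].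
  apply: cvgM; last exact: continuous_normal_pdf.
  apply: cvgM; first by apply: cvgN; exact: cvg_id.
  apply: continuous_comp; last exact: continuous_sin.
  by apply: cvgD; [apply: cvgM; [exact: cvg_cst|exact: cvg_id]|exact: cvg_cst].
(* The derivative is integrated over [[-k, k]] and [k] sent to infinity: dominated convergence on
   one side, and on the other a boundary term of size at most [2 s^2 pdf k]. *)
pose gk (k : nat) := g \_ `[- k%:R, k%:R].
have Ik (k : nat) : (0 < k)%N -> (\int[mu]_x (gk k x)%:E = (G k%:R - G (- k%:R))%:E)%E.
  move=> k0; have k0' : 0 < k%:R :> R by rewrite ltr0n.
  have -> : (\int[mu]_x (gk k x)%:E = \int[mu]_(x in `[(- k%:R)%R, (k%:R)%R]) (g x)%:E)%E.
    rewrite [RHS]integral_mkcond; apply: eq_integral => x _.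
    by rewrite /gk !patchE; case: ifP.
  rewrite (@continuous_FTC2 _ g G) ?EFinB//; first by lra.
  - exact: continuous_subspaceT.
  - split; first by move=> x _; have [] := dG x.
      by apply: cvg_at_right_filter; exact: cG.
    by apply: cvg_at_left_filter; exact: cG.
  - by move=> x _; rewrite derive1E; have [_ ->] := dG x.
have [|||||_ _ lim] := @dominated_convergence _ (measurableTypeR R) R mu setT measurableT
  (fun k => EFin \o gk k) (EFin \o g) (fun x => `|(g x)%:E|%E).
- move=> k; apply/measurable_EFinP; apply/(measurable_restrictT _ _).1 => //.
  by apply: measurable_funTS; exact: continuous_measurable_fun.
- by apply/measurable_EFinP; exact: continuous_measurable_fun.
- apply: aeW => x _; apply: cvg_near_cst; exists (Num.trunc `|x|).+1 => // k /= xk.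
  have xk' : `|x| <= k%:R.
    by apply: (le_trans (ltW (truncnS_gt _))); rewrite ler_nat.
  by rewrite /gk patchE mem_set//= in_itv/= -ler_norml.
- exact: integrable_abse.
- apply: aeW => x k _; rewrite /gk /= patchE; case: ifP => // _.
  by rewrite lee_fin (_ : point = 0 :> R) // normr0.
have Gb x : `|G x| <= s ^+ 2 * pdf x.
  rewrite /G normrM (ger0_norm (sqr_ge0 s)) ler_wpM2l ?sqr_ge0// normrM.
  by rewrite (ger0_norm (normal_pdf_ge0 _ _ _)) ler_piMl ?sin_max ?normal_pdf_ge0.
have pdfN x : pdf (- x) = pdf x by rewrite !normal_pdf_expR sqrrN.
have lim0 : [sequence \int[mu]_x (EFin \o gk k) x]_k%E @ \oo --> (0 : \bar R)%E.
  apply: (@cvg_trans _ ((fun k => (G k%:R - G (- k%:R))%:E) @ \oo)).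
    apply: near_eq_cvg; exists 1%N => // k /= k1; exact/esym/Ik.
  apply: cvg_EFin; first exact: nearW.
  apply/(@cvgrPdist_le _ R^o) => e e0.
  have /cvgrPdist_le /(_ (e / (2 * s ^+ 2))) := cvg_normal_pdf_infty.
  rewrite divr_gt0 ?mulr_gt0 ?exprn_gt0// => /(_ isT).
  apply: filterS => k; rewrite !sub0r !normrN ger0_norm ?normal_pdf_ge0//.
  rewrite ler_pdivlMr ?mulr_gt0 ?exprn_gt0// => H.
  apply: (le_trans (ler_normB _ _)); have := Gb k%:R; have := Gb (- k%:R).
  by rewrite pdfN /=; lra.
have := cvg_unique _ lim lim0 => I0.
have : (\int[mu]_x g x)%R = 0 by rewrite /Rintegral [X in fine X]I0.
rewrite RintegralD//; last 2 first.
- by have := integrableZl measurableT (s ^+ 2 * t) (integrable_cos_pdf t).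
- exact: integrable_xsin_pdf.
rewrite RintegralZl//; last exact: integrable_cos_pdf.
by rewrite -/(normal_cos t) => /eqP; rewrite addrC addr_eq0 mulNr => /eqP.
Qed.

(** Differentiation under the integral, the derivative in [t] being at most [|x| pdf x] for all [t]
    at once. *)
Lemma is_derive_normal_cos (t : R) :
  is_derive t (1 : R) normal_cos (\int[mu]_x (- x * sin (t * x + th) * pdf x))%R.
Proof.
pose f (t x : R) := cos (t * x + th) * pdf x.
have df (u x : R) : is_derive u (1 : R) (f ^~ x) (- x * sin (u * x + th) * pdf x).
  apply: is_derive_eq.
  by rewrite /GRing.scale/=; ring.
pose G (x : R) := `|x| * pdf x.
have tI : `]t - 1, t + 1[%classic t by rewrite /= in_itv/=; lra.
have fi u : `]t - 1, t + 1[%classic u -> mu.-integrable setT (EFin \o f u).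
  by move=> _; exact: integrable_cos_pdf.
have dfi (u x : R) : `]t - 1, t + 1[%classic u -> setT x -> derivable (f ^~ x) u 1.
  by move=> _ _; have [] := df u x.
have G0 x : 0 <= G x by rewrite mulr_ge0 ?normal_pdf_ge0.
have iG : mu.-integrable setT (EFin \o G).
  apply: (@integrable_dominated_pdf _ 0 1) => //.
    by apply: measurable_funM; [exact: normr_measurable|exact: measurable_normal_pdf].
  by move=> x; rewrite add0r mul1r ger0_norm.
have Gub (u x : R) : `]t - 1, t + 1[%classic u -> setT x -> `|partial1of2 f u x| <= G x.
  move=> _ _; rewrite partial1of2E; have [_ ->] := df u x.
  rewrite !normrM normrN (ger0_norm (normal_pdf_ge0 _ _ _)).
  by rewrite ler_wpM2r ?normal_pdf_ge0// ler_piMr ?sin_max.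
have D := derivable_under_integral measurableT tI fi dfi G0 iG Gub.
apply: DeriveDef; first exact: D.
rewrite -derive1E (differentiation_under_integral measurableT tI fi dfi G0 iG Gub).
by apply: eq_Rintegral => x _; rewrite partial1of2E; have [_ ->] := df t x.
Qed.


(** Stein's identity turns the derivative into the equation [f' = - s^2 t f], so
    [expR (s^2 t^2 / 2) f] is constant; its value at 0 is [cos th] because the density has mass
    1. *)
Lemma normal_charfun (t : R) :
  Ex (normal_prob 0 s) (fun x => cos (t * x + th)) = expR (- (s ^+ 2 * t ^+ 2 / 2)) * cos th.
Proof.
rewrite integral_normal_prob; last first.
  split; last by exists 1 => x; exact: cos_max.
  exact: (measurable_trig_pdf t (continuous_measurable_fun (@continuous_cos R))).1.
pose H (t : R) := expR (s ^+ 2 * t ^+ 2 / 2) * normal_cos t.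
have dH (x : R) : is_derive x (1 : R) H 0.
  have := is_derive_normal_cos x; rewrite normal_stein => dc.
  apply: is_derive_eq.
  by rewrite /GRing.scale/=; field.
have := is_derive_0_is_cst t 0 dH.
rewrite /H expr0n/= mulr0 mul0r expR0 mul1r -/(normal_cos t) => /(canRL (mulKf _)) ->; last first.
  by rewrite expR_eq0.
rewrite -expRN; congr (_ * _); rewrite /normal_cos.
under eq_Rintegral => x _ do rewrite mul0r add0r.
by rewrite RintegralZl//; [rewrite /Rintegral integral_normal_pdf mulr1|exact: integrable_normal_pdf].
Qed.

End NormalCharacteristic.

Section Law.
Context d d' (T : measurableType d) (T' : measurableType d') (R : realType).
Variables (P : probability T R) (X : T -> T') (mX : measurable_fun setT X).

Let X_mixin := isMeasurableFun.Build _ _ _ _ _ mX.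
Let X_mfun : {mfun T >-> T'} := MeasurableFun.Pack (MeasurableFun.Class X_mixin).

Definition law : probability T' R := distribution P X_mfun.

Lemma Ex_law f : mbounded f -> Ex law f = Ex P (f \o X).
Proof.
move=> bf; rewrite /Ex /Rintegral; congr fine.
apply: (@integral_distribution _ _ _ _ _ P X_mfun (EFin \o f)).
  by apply/measurable_EFinP; case: bf.
apply: (@mbounded_integrable _ _ _ P (f \o X)).
case: bf => mf [M fM]; split; first exact: measurableT_comp.
by exists M => x; exact: fM.
Qed.

End Law.

Lemma Ex_prod d d' (T : measurableType d) (T' : measurableType d') (R : realType)
    (P : probability T R) (Q : probability T' R) (f : T * T' -> R) :
  mbounded f -> Ex (P \x Q)%E f = Ex P (fun x => Ex Q (fun y => f (x, y))).
Proof.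
move=> bf; rewrite /Ex /Rintegral; congr fine.
rewrite -(@integral12_prod_meas1 _ _ _ _ _ P Q); last exact: (mbounded_integrable (P \x Q)%E bf).
apply: eq_integral => x _; rewrite /fubini_F fineK//=.
apply: (integrable_fin_num measurableT).
apply: (@mbounded_integrable _ _ _ Q (fun y => f (x, y))).
case: bf => mf [M fM]; split; last by exists M => y; exact: fM.
by apply: (measurableT_comp mf); exact: measurable_pair1.
Qed.

Lemma Ex_dirac d (T : measurableType d) (R : realType) (a : T) (f : T -> R) :
  measurable_fun setT f -> Ex (\d_a : probability T R) f = f a.
Proof.
move=> mf; rewrite /Ex /Rintegral integral_dirac//.
  by rewrite diracE in_setT mul1e.
exact/measurable_EFinP.
Qed.

(** * Gaussian vectors with a given covariance *)

Section GaussianVector.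
Context {R : realType} {n : nat}.

Lemma measurable_cos_lin (c : 'cV[R]_n) (th : R) :
  mbounded (fun x : borel_rV n => cos (lin x c + th)).
Proof. exact: (trig_mbounded (@coord_measurable R n) (trig_cos c th)). Qed.

Lemma measurable_shift_line (v : 'rV[R]_n) :
  measurable_fun setT (fun z : borel_rV n * R => (z.1 + z.2 *: v : borel_rV n)).
Proof.
apply: (@measurable_fun_rV R _ _ n (fun z : borel_rV n * R => z.1 + z.2 *: v)) => j.
rewrite (_ : (fun _ => _) = fun z : borel_rV n * R => z.1 0 j + z.2 * v 0 j); last first.
  by apply/funext => z; rewrite !mxE.
apply: measurable_funD.
  by apply: (measurableT_comp (@coord_measurable R n j)); exact: measurable_fst.
by apply: measurable_funM; [exact: measurable_snd|exact: measurable_cst].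
Qed.

(** The law of a sum of independent standard normal multiples of the [v], obtained one vector at a
    time as an image of a product measure. No density is involved, so degenerate covariances are
    included. *)
Lemma gaussian_vector_exists (vs : seq 'rV[R]_n) :
  exists mu : probability (borel_rV n) R, forall (c : 'cV[R]_n) (th : R),
    Ex mu (fun x => cos (lin x c + th)) =
    expR (- ((\sum_(v <- vs) lin v c ^+ 2) / 2)) * cos th.
Proof.
elim: vs => [|v vs [mu mu_cos]].
  exists (\d_(0 : borel_rV n)) => c th.
  rewrite Ex_dirac; last by have [] := measurable_cos_lin c th.
  by rewrite big_nil mul0r oppr0 expR0 mul1r /lin mul0mx mxE add0r.
exists (law (mu \x normal_prob 0 1)%E (measurable_shift_line v)) => c th.
rewrite Ex_law; last exact: measurable_cos_lin.
rewrite Ex_prod; last first.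
  have [mc [M cM]] := measurable_cos_lin c th; split; last by exists M => z; exact: cM.
  exact: (measurableT_comp mc (measurable_shift_line v)).
transitivity (Ex mu (fun x => expR (- (lin v c ^+ 2 / 2)) * cos (lin x c + th))).
  congr Ex; apply/funext => x; rewrite /=.
  transitivity (Ex (normal_prob 0 1) (fun y : R => cos (lin v c * y + (lin x c + th)))).
    by congr Ex; apply/funext => y; rewrite linDl linZl; congr cos; ring.
  by rewrite normal_charfun// expr1n mul1r.
rewrite ExZ; last exact: measurable_cos_lin.
by rewrite mu_cos mulrA -expRD big_cons; congr (expR _ * _); field.
Qed.

End GaussianVector.

Lemma trmxZ {R : realType} m n (a : R) (A : 'M[R]_(m, n)) : (a *: A)^T = a *: A^T.
Proof. by apply/matrixP => i j; rewrite !mxE. Qed.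

Lemma trmxD {R : realType} m n (A B : 'M[R]_(m, n)) : (A + B)^T = A^T + B^T.
Proof. by apply/matrixP => i j; rewrite !mxE. Qed.

Lemma trmxB {R : realType} m n (A B : 'M[R]_(m, n)) : (A - B)^T = A^T - B^T.
Proof. by apply/matrixP => i j; rewrite !mxE. Qed.

Section Entries.
Context {R : realType}.
Implicit Types A B : 'M[R]_1.

Lemma entryD A B : (A + B) 0 0 = A 0 0 + B 0 0. Proof. by rewrite mxE. Qed.

Lemma entryB A B : (A - B) 0 0 = A 0 0 - B 0 0. Proof. by rewrite !mxE. Qed.

Lemma entryZ x A : (x *: A) 0 0 = x * A 0 0. Proof. by rewrite mxE. Qed.

End Entries.

Section PositiveSemidefinite.
Context {R : realType} {n : nat}.
Implicit Types S : 'M[R]_n.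

Definition quad S (u : 'cV[R]_n) : R := (u^T *m S *m u) 0 0.

Lemma quadE S u : quad S u = \sum_i \sum_j u i 0 * S i j * u j 0.
Proof.
rewrite /quad mxE exchange_big/=; apply: eq_bigr => j _.
by rewrite mxE mulr_suml; apply: eq_bigr => i _; rewrite !mxE.
Qed.

Lemma quadD S S' u : quad (S + S') u = quad S u + quad S' u.
Proof. by rewrite /quad mulmxDr mulmxDl mxE. Qed.

Lemma quad_rank1 (v : 'rV[R]_n) u : quad (v^T *m v) u = lin v u ^+ 2.
Proof.
rewrite /quad mulmxA -mulmxA -trmx_mul mxE big_ord1 mxE expr2.
by rewrite /lin.
Qed.

(* Cholesky: subtracting [v^T v], with [v] the normalised [i]-th row, annihilates
   the [i]-th diagonal entry and keeps the others that are already zero. *)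
Lemma psd_decomposition S : S^T = S -> (forall u, 0 <= quad S u) ->
  exists vs : seq 'rV[R]_n, S = \sum_(v <- vs) v^T *m v.
Proof.
have [k] := ubnP #|[pred i | S i i != 0]|.
elim: k S => // k ih S cardS symS psdS.
have symE i j : S i j = S j i by rewrite -[in LHS]symS mxE.
have quad_line i j (x y : R) : quad S (x *: delta_mx i 0 + y *: delta_mx j 0) =
    x ^+ 2 * S i i + 2 * x * y * S i j + y ^+ 2 * S j j.
  have E a b (z t : R) : ((z *: delta_mx a 0 : 'cV[R]_n)^T *m S *m (t *: delta_mx b 0 : 'cV[R]_n)) 0 0 = z * t * S a b.
    rewrite trmxZ -scalemxAr -!scalemxAl scalerA trmx_delta.
    rewrite -rowE -colE !mxE.
    by rewrite [t * z]mulrC.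
  rewrite /quad trmxD !mulmxDl !mulmxDr !entryD.
  rewrite !E (symE j i); ring.
have [i Si|S0] := pickP [pred i | S i i != 0]; last first.
  exists [::]; rewrite big_nil; apply/matrixP => i j; rewrite mxE.
  have d0 l : S l l = 0 by have := S0 l; move=> /negbFE/eqP.
  (* With a zero diagonal the form at this vector is [- 2 S_ij^2], which forces [S_ij = 0]. *)
  have := psdS (1 *: delta_mx i 0 + (- S i j) *: delta_mx j 0).
  rewrite quad_line !d0 => H; apply/eqP; rewrite -sqrf_eq0 eq_le sqr_ge0 andbT; nra.
have Sii : 0 < S i i.
  have := psdS (1 *: delta_mx i 0 + 0 *: delta_mx i 0); rewrite quad_line => H.
  have Si' : S i i != 0 by exact: Si.
  by rewrite lt_neqAle eq_sym Si'/=; lra.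
pose v : 'rV[R]_n := (Num.sqrt (S i i))^-1 *: row i S.
have sq : (Num.sqrt (S i i))^-1 * (Num.sqrt (S i i))^-1 = (S i i)^-1.
  by rewrite -invfM -expr2 sqr_sqrtr ?ltW.
have vE a b : (v^T *m v) a b = S i a * S i b / S i i.
  rewrite mxE big_ord1 !mxE -sq; ring.
pose S' := S - v^T *m v.
have S'E a b : S' a b = S a b - S i a * S i b / S i i by rewrite !mxE -vE mxE.
have [||| vs Svs] := ih S'.
- rewrite -ltnS; apply: leq_ltn_trans cardS.
  apply: proper_card; apply/properP; split.
    apply/fintype.subsetP => j; rewrite !inE S'E; apply: contraNneq => Sjj.
    (* If [S_jj = 0] the form at this vector is [- S_ij^2 / S_ii], so [S_ij = 0] and entry [j] of
       the new diagonal is still zero. *)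
    have := psdS (1 *: delta_mx j 0 + (- S i j / S i i) *: delta_mx i 0).
    rewrite quad_line Sjj (symE j i) => H.
    have : S i j ^+ 2 / S i i <= 0.
      have -> : S i j ^+ 2 / S i i = - (1 ^+ 2 * 0 + 2 * 1 * (- S i j / S i i) * S i j + (- S i j / S i i) ^+ 2 * S i i) by field.
      by rewrite oppr_le0.
    rewrite -expr2 sub0r oppr_eq0 eq_le => ->.
    by rewrite divr_ge0 ?sqr_ge0// ltW.
  by exists i; rewrite !inE// S'E; rewrite mulfK ?subrr ?eqxx// gt_eqF.
- by rewrite /S' trmxB trmx_mul trmxK symS.
(* Completing the square: this vector minimises the form of [S] on the line through [u] in direction
   [i], and the minimum is the form of [S'] at [u]. *)
- move=> u; have := psdS (u - ((row i S *m u) 0 0 / S i i) *: delta_mx i 0).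
  set r := (row i S *m u) 0 0; set x := r / S i i.
  have rE : (u^T *m S *m (delta_mx i 0 : 'cV[R]_n)) 0 0 = r.
    rewrite -colE [LHS]mxE [LHS]mxE /r mxE; apply: eq_bigr => j _.
    by rewrite !mxE symE mulrC.
  have rE' : ((delta_mx i 0 : 'cV[R]_n)^T *m S *m u) 0 0 = r by rewrite trmx_delta -rowE.
  have iE : ((delta_mx i 0 : 'cV[R]_n)^T *m S *m (delta_mx i 0 : 'cV[R]_n)) 0 0 = S i i.
    by rewrite trmx_delta -rowE -colE !mxE.
  have -> : quad S (u - x *: delta_mx i 0) = quad S u - 2 * x * r + x ^+ 2 * S i i.
    rewrite {1}/quad trmxB trmxZ !mulmxBl !mulmxBr -!scalemxAl -!scalemxAr.
    by rewrite !(entryB, entryZ) rE rE' iE /quad; ring.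
  rewrite /S' /quad mulmxBr mulmxBl entryB -/(quad _ u) -/(quad _ u) quad_rank1.
  have -> : lin v u = (Num.sqrt (S i i))^-1 * r by rewrite /v linZl.
  have -> : ((Num.sqrt (S i i))^-1 * r) ^+ 2 = r ^+ 2 / S i i.
    by rewrite exprMn [_^-1 ^+ 2]expr2 sq mulrC.
  rewrite /x => H; apply: (le_trans H).
  by rewrite le_eqVlt; apply/orP; left; apply/eqP; field; rewrite gt_eqF.
by exists (v :: vs); rewrite big_cons -Svs /S' addrC subrK.
Qed.

End PositiveSemidefinite.

(** The decomposition of [S] into the [v^T v] gives a law with the right characteristic function.
    Its linear images are then identified by uniqueness in dimension one, variance 0 being compared
    with a Dirac mass. *)
Lemma gaussian_exists {R : realType} n (S : 'M[R]_n) : S^T = S ->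
  (forall u, 0 <= quad S u) ->
  exists2 mu : probability (borel_rV n) R, is_normal0 S mu &
    forall c th, Ex mu (fun x => cos (lin x c + th)) = expR (- (quad S c / 2)) * cos th.
Proof.
move=> symS psdS; have [vs Svs] := psd_decomposition symS psdS.
have qS c : quad S c = \sum_(v <- vs) lin v c ^+ 2.
  rewrite Svs; elim: (vs) => [|v s ih].
    by rewrite !big_nil /quad mulmx0 mul0mx mxE.
  by rewrite !big_cons quadD ih quad_rank1.
have [mu mu_cos] := gaussian_vector_exists vs.
exists mu => [|c th]; last by rewrite mu_cos qS.
split=> // u v; split; first by have := psdS u^T; rewrite /quad trmxK.
have vq : v = quad S u^T by rewrite /quad trmxK.
have v0 : 0 <= v by rewrite vq.
have mlin : measurable_fun setT (fun x : borel_rV n => lin x u^T).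
  exact: (continuous_measurable_rV (@continuous_lin _ _ u^T)).
have mucos s th : Ex (law mu mlin) (fun y : R => cos (s * y + th)) = expR (- (v * s ^+ 2 / 2)) * cos th.
  rewrite Ex_law; last first.
    split; last by exists 1 => x; exact: cos_max.
    by apply: (measurableT_comp (continuous_measurable_fun (@continuous_cos R)));
      apply: measurable_funD => //; apply: measurable_funM.
  transitivity (Ex mu (fun x => cos (lin x (s *: u^T) + th))).
    by congr Ex; apply/funext => x; rewrite /= linZr.
  rewrite mu_cos -qS vq; congr (expR (- (_ / 2)) * _).
  rewrite /quad trmxZ -scalemxAr -!scalemxAl scalerA [LHS]mxE; ring.
move=> A mA; rewrite /normal0; case: ifPn => [/eqP v00|v_neq0].
  apply: (@charfun_unique R (law mu mlin) (\d_(0 : R)) _ A mA) => s th.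
  rewrite mucos v00 !mul0r oppr0 expR0 mul1r Ex_dirac ?mulr0 ?add0r//.
  by apply: (measurableT_comp (continuous_measurable_fun (@continuous_cos R)));
      apply: measurable_funD => //; apply: measurable_funM.
have vpos : 0 < v by rewrite lt_neqAle eq_sym v_neq0.
have mid : measurable_fun setT (fun x : measurableTypeR R => x : R) by exact: measurable_id.
have H := @charfun_unique R (law mu mlin) (law (normal_prob 0 (Num.sqrt v)) mid).
suff : law mu mlin A = law (normal_prob 0 (Num.sqrt v)) mid A by [].
apply: H => // s th; rewrite mucos Ex_law.
  by rewrite normal_charfun ?sqrtr_gt0// sqr_sqrtr.
split; last by exists 1 => x; exact: cos_max.
by apply: (measurableT_comp (continuous_measurable_fun (@continuous_cos R)));
  apply: measurable_funD => //; apply: measurable_funM.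
Qed.

(** * Adapted norms and matrix semigroups *)

Section ChainNorm.
Context {R : realType} {n : nat}.
Variable X : 'M[R[i]]_n.
Implicit Types (v : 'cV[R[i]]_n) (s : seq R[i]) (z : R[i]).
Local Notation normc := Normc.normc.

Lemma normc_ge0 z : 0 <= normc z.
Proof. by case: z => a b; rewrite sqrtr_ge0. Qed.

Lemma normc_real (x : R) : normc (x%:C)%C = `|x|.
Proof. by rewrite /normc /= expr0n/= addr0 sqrtr_sqr. Qed.

Definition l1 v : R := \sum_j normc (v j 0).

Lemma l1_ge0 v : 0 <= l1 v.
Proof. by apply: sumr_ge0 => j _; exact: normc_ge0. Qed.

Lemma l1D v u : l1 (v + u) <= l1 v + l1 u.
Proof.
by rewrite -big_split; apply: ler_sum => j _; rewrite mxE; exact: le_normcD.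
Qed.

Lemma l1Z z v : l1 (z *: v) = normc z * l1 v.
Proof.
by rewrite mulr_sumr; apply: eq_bigr => j _; rewrite mxE Normc.normcM.
Qed.

Lemma l1_0 : l1 0 = 0.
Proof. by rewrite /l1 big1// => j _; rewrite mxE Normc.normc0. Qed.

Lemma l1_mul (Y : 'M[R[i]]_n) : exists2 C, 0 <= C & forall v, l1 (Y *m v) <= C * l1 v.
Proof.
exists (\sum_i \sum_j normc (Y i j)).
  by apply: sumr_ge0 => i _; apply: sumr_ge0 => j _; exact: normc_ge0.
move=> v; rewrite mulr_suml; apply: ler_sum => i _; rewrite mxE mulr_suml.
apply: (@le_trans _ _ (\sum_j normc (Y i j * v j 0))).
  elim/big_ind2 : _ => [|x x' y y' xx' yy'|//]; first by rewrite Normc.normc0.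
  by apply: (le_trans (le_normcD _ _)); exact: lerD.
apply: ler_sum => j _; rewrite Normc.normcM ler_wpM2l ?normc_ge0//.
rewrite /l1 (bigD1 j)//= lerDl; apply: sumr_ge0 => k _; exact: normc_ge0.
Qed.

(* Along the vectors [v, (X - z1) v, (X - z2) (X - z1) v, ...] the matrix [X] is
   triangular; weighting them by powers of a large [K] makes its off-diagonal
   entries negligible. *)
Variable K : R.
Hypothesis K0 : 0 < K.

Fixpoint chain s v : R :=
  if s is z :: s' then l1 v + K * chain s' ((X - z%:M) *m v) else 0.

(** Expresses that the product of the [X - z] over [s] kills [v], in the recursive shape of [chain]:
    the vectors weighed by [chain] then end at 0. *)
Fixpoint annihilated s v : Prop :=
  if s is z :: s' then annihilated s' ((X - z%:M) *m v) else v = 0.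

Lemma chain_ge0 s v : 0 <= chain s v.
Proof.
elim: s v => //= z s ih v; rewrite addr_ge0 ?l1_ge0// mulr_ge0//; exact: ltW.
Qed.

Lemma chainD s v u : chain s (v + u) <= chain s v + chain s u.
Proof.
elim: s v u => [|z s ih] v u /=; first by rewrite addr0.
rewrite addrACA -mulrDr lerD ?l1D// ler_pM2l// mulmxDr; exact: ih.
Qed.

Lemma l1_le_chain z s v : l1 v <= chain (z :: s) v.
Proof. by rewrite lerDl mulr_ge0 ?chain_ge0// ltW. Qed.

Lemma chain_le_l1 s : exists2 C, 0 <= C & forall v, chain s v <= C * l1 v.
Proof.
elim: s => [|z s [C C0 ih]] /=; first by exists 0 => // v; rewrite mul0r.
have [D D0 hD] := l1_mul (X - z%:M).
exists (1 + K * (C * D)); first by rewrite addr_ge0// !mulr_ge0// ltW.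
move=> v; rewrite mulrDl mul1r lerD2l -mulrA ler_pM2l//.
by apply: (le_trans (ih _)); rewrite -mulrA ler_wpM2l.
Qed.

Lemma annihilated_mul (Y : 'M[R[i]]_n) s v : X *m Y = Y *m X ->
  annihilated s v -> annihilated s (Y *m v).
Proof.
move=> XY; elim: s v => [v ->|z s ih v /ih] /=; first by rewrite mulmx0.
congr annihilated; rewrite !mulmxA; congr (_ *m _).
by rewrite mulmxBr mulmxBl XY scalar_mxC.
Qed.

(** An explicit Euler step of size [h] for [v' = - X v]; being a polynomial in [X], it commutes with
    every [X - z]. *)
Definition damp (h : R) v : 'cV[R[i]]_n := v - (h%:C)%C *: (X *m v).

Lemma damp_shift h z v : (X - z%:M) *m damp h v = damp h ((X - z%:M) *m v).
Proof.
rewrite /damp mulmxBr -scalemxAr; congr (_ - _ *: _).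
by rewrite !mulmxA mulmxBl mulmxBr scalar_mxC.
Qed.

(** [(1 - h X) v = (1 - h z) v - h (X - z) v], and [y = |1 - h z|] is bounded through
    [2 y <= 1 + y^2], which costs only a term of order [h^2]. *)
Lemma l1_damp (h : R) z v : 0 <= h ->
  l1 (damp h v) <= (1 - h * complex.Re z + h ^+ 2 * normc z ^+ 2) * l1 v +
                   h * l1 ((X - z%:M) *m v).
Proof.
move=> h0.
have -> : damp h v = (1 - (h%:C)%C * z) *: v + (- (h%:C)%C) *: ((X - z%:M) *m v).
  rewrite /damp mulmxBl mul_scalar_mx scalerBr !scalerBl scale1r !scaleNr scalerA.
  by rewrite opprK addrA addrAC subrK.
apply: (le_trans (l1D _ _)); rewrite !l1Z normcN normc_real ger0_norm// lerD2r.
rewrite ler_wpM2r ?l1_ge0//.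
case: z => a b; rewrite /normc /=.
set y := Num.sqrt _.
have y0 : 0 <= y by rewrite sqrtr_ge0.
have y2 : y ^+ 2 = (1 - h * a) ^+ 2 + (h * b) ^+ 2.
  rewrite sqr_sqrtr ?addr_ge0 ?sqr_ge0//; ring.
rewrite sqr_sqrtr ?addr_ge0 ?sqr_ge0//.
have := sqr_ge0 (y - 1); have := sqr_ge0 (h * a); have := sqr_ge0 (h * b).
rewrite !exprMn => *; nra.
Qed.

(** The summand [h * l1 v] is the coupling that the preceding link of the chain charges to [v]. Each
    link pays for it out of its margin [delta], magnified by the weight [K]; hence
    [1 <= K * delta]. *)
Lemma chain_damp_strict (mu delta C h : R) s v : 0 <= h -> 1 <= K * delta ->
  (forall z, z \in s -> mu + delta <= complex.Re z) ->
  (forall z, z \in s -> normc z ^+ 2 <= C) -> annihilated s v ->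
  K * chain s (damp h v) + h * l1 v <=
  (1 - h * mu + C * h ^+ 2) * (K * chain s v).
Proof.
move=> h0 Kd; elim: s v => [|z s ih] v /= res sizes ann.
  by rewrite ann l1_0 !mulr0 addr0.
have rz := res z (mem_head _ _); have sz := sizes z (mem_head _ _).
have sub y : y \in s -> y \in z :: s by rewrite inE orbC => ->.
have /= ih' := ih _ (fun y ys => res y (sub y ys)) (fun y ys => sizes y (sub y ys)) ann.
have L := l1_damp z v h0; rewrite damp_shift.
set a := l1 v in L *; set b := l1 _ in ih' L *; set c := chain s _ in ih' *.
set c' := chain s _ in ih' *.
have a0 : 0 <= a by exact: l1_ge0.
have La : (1 - h * complex.Re z + h ^+ 2 * normc z ^+ 2) * a <=
          (1 - h * mu - h * delta + C * h ^+ 2) * a.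
  rewrite ler_wpM2r// [C * _]mulrC lerD ?ler_wpM2l ?sqr_ge0//.
  by have := ler_wpM2l h0 rz; lra.
have {L La} L : l1 (damp h v) <= (1 - h * mu - h * delta + C * h ^+ 2) * a + h * b by lra.
have hd : h * a <= K * (h * delta * a).
  have -> : K * (h * delta * a) = (K * delta) * (h * a) by ring.
  by rewrite ler_peMl// mulr_ge0.
have := lerD L ih' => /(ler_wpM2l (ltW K0)) H.
nra.
Qed.

(** No earlier link charges the head of the list, so its eigenvalue may have real part exactly [mu]
    while the others need the margin [delta]. This keeps the exact rate when the critical eigenvalue
    is simple. *)
Lemma chain_damp (mu delta C h : R) z0 s v : 0 <= h -> 1 <= K * delta ->
  mu <= complex.Re z0 -> (forall z, z \in s -> mu + delta <= complex.Re z) ->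
  (forall z, z \in z0 :: s -> normc z ^+ 2 <= C) -> annihilated (z0 :: s) v ->
  chain (z0 :: s) (damp h v) <= (1 - h * mu + C * h ^+ 2) * chain (z0 :: s) v.
Proof.
move=> h0 Kd r0 res sizes /= ann.
have sz := sizes z0 (mem_head _ _).
have sub y : y \in s -> y \in z0 :: s by rewrite inE orbC => ->.
have S := chain_damp_strict h0 Kd res (fun y ys => sizes y (sub y ys)) ann.
have L := l1_damp z0 v h0; rewrite damp_shift.
apply: (le_trans (lerD L (lexx _))); rewrite mulrDr.
rewrite -addrA lerD//; last by rewrite addrC.
rewrite ler_wpM2r ?l1_ge0// [C * _]mulrC lerD ?ler_wpM2l ?sqr_ge0//.
by have := ler_wpM2l h0 r0; lra.
Qed.

End ChainNorm.

Section Annihilation.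
Context {R : realType}.

Lemma annihilated_horner n (X : 'M[R[i]]_n.+1) s v :
  annihilated X s v <-> horner_mx X (\prod_(z <- s) ('X - z%:P)) *m v = 0.
Proof.
elim: s v => [|z s ih] v /=.
  by rewrite big_nil rmorph1 mul1mx.
rewrite ih big_cons mulrC rmorphM /= rmorphB /= horner_mx_X horner_mx_C.
by rewrite -mulmxE -mulmxA.
Qed.

(** As a polynomial in [X], the product does not see the order of its factors; in dimension 0 every
    vector is 0. *)
Lemma annihilated_perm n (X : 'M[R[i]]_n) s s' v : perm_eq s s' ->
  annihilated X s v -> annihilated X s' v.
Proof.
case: n X v => [|n] X v ss'.
  move=> _; elim: (s') v => [|z t ih] v /=; last exact: ih.
  by apply/matrixP => -[].
by move/annihilated_horner => H; apply/annihilated_horner; rewrite -(perm_big _ ss').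
Qed.

(** Cayley-Hamilton, the list being the roots of the characteristic polynomial with multiplicity. *)
Lemma annihilated_eigenvalues n (A : 'M[R]_n) v :
  annihilated (map_mx (real_complex R) A) (eigenvalues A) v.
Proof.
case: n A v => [|n] A v.
  elim: (eigenvalues A) v => [|z t ih] v /=; last exact: ih.
  by apply/matrixP => -[].
apply/annihilated_horner; rewrite /eigenvalues; case: closed_field_poly_normal => s /=.
rewrite (monicP (char_poly_monic _)) scale1r => <-.
by rewrite Cayley_Hamilton mul0mx.
Qed.

Lemma eigenvalues_conj n (A : 'M[R]_n) z :
  z \in eigenvalues A -> (z^*)%C \in eigenvalues A.
Proof.
rewrite /eigenvalues; case: closed_field_poly_normal => s /= sE.
have rt y : (y \in s) = root (char_poly (map_mx (real_complex R) A)) y.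
  rewrite sE (monicP (char_poly_monic _)) scale1r.
  by rewrite root_prod_XsubC.
rewrite !rt -map_char_poly => /rootP r; apply/rootP.
have := congr1 (@conjc R) r; rewrite rmorph0 => <-.
rewrite -horner_map /= -map_poly_comp.
by congr (_.[_]); apply: eq_map_poly => x; exact/esym/conjc_real.
Qed.

End Annihilation.

(** * The semigroup generated by [- B] *)

Section MatrixExponential.
Context {R : realType} {n : nat}.
Variable B : 'M[R]_n.

Definition semigroup (u : R) : 'M[R]_n := expmx (- (u *: B)).

Let coef i j k : R := (k`!%:R)^-1 * ((- B) ^+ k) i j.
Let beta : R := \sum_i \sum_j `|B i j|.

Let beta_ge0 : 0 <= beta.
Proof. by apply: sumr_ge0 => i _; apply: sumr_ge0. Qed.

Lemma mx_exp_entry_le k i j : `|((- B) ^+ k) i j| <= beta ^+ k.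
Proof.
elim: k i j => [|k ih] i j.
  by rewrite !expr0 mxE; case: (i == j); rewrite ?normr1// normr0.
rewrite !exprS mxE; apply: (le_trans (ler_norm_sum _ _ _)).
apply: (@le_trans _ _ (\sum_l `|B i l| * beta ^+ k)).
  by apply: ler_sum => l _; rewrite normrM mxE normrN ler_wpM2l.
rewrite -mulr_suml ler_wpM2r ?exprn_ge0//.
rewrite /beta [leRHS](bigD1 i)//= lerDl; apply: sumr_ge0 => k' _.
by apply: sumr_ge0.
Qed.

(** Moving [u] out of the matrix power makes each entry a scalar power series in [u], to which
    termwise differentiation applies. *)
Lemma semigroup_pseries u i j : semigroup u i j = limn (pseries (coef i j) u).
Proof.
rewrite mxE; congr (limn (series _)); apply/funext => k.
rewrite /= /coef -mulrA; congr (_ * _).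
have -> : - (u *: B) = u *: (- B) by rewrite scalerN.
elim: k i j => [|k ih] i j; first by rewrite !expr0 mulr1.
rewrite !exprS !mxE mulr_suml; apply: eq_bigr => l _.
by rewrite ih !mxE; ring.
Qed.

Let cvg_coef i j x : cvgn (pseries (coef i j) x).
Proof.
apply: normed_cvg; rewrite /normed_series_of /=.
apply: (@series_le_cvg _ _ (exp_coeff (beta * `|x|))).
- by move=> k; exact: normr_ge0.
- by move=> k; apply: exp_coeff_ge0; rewrite mulr_ge0.
- move=> k; rewrite /exp_coeff/= /coef !normrM normrX exprMn.
  rewrite normfV normr_nat -mulrA mulrCA -[leRHS]mulrA [_ / _]mulrC ler_wpM2r//.
  exact: mx_exp_entry_le.
- exact: is_cvg_series_exp_coeff.
Qed.

Let lim_pseries_sum (a : 'I_n -> R) (f : 'I_n -> nat -> R) x :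
  (forall l, cvgn (pseries (f l) x)) ->
  pseries (fun k => \sum_l a l * f l k) x @ \oo --> \sum_l a l * limn (pseries (f l) x).
Proof.
move=> cf.
have -> : pseries (fun k => \sum_l a l * f l k) x = fun N => \sum_l a l * pseries (f l) x N.
  apply/funext => N; rewrite /pseries /series /=.
  under eq_bigr do rewrite mulr_suml.
  rewrite exchange_big; apply: eq_bigr => l _; rewrite mulr_sumr.
  by apply: eq_bigr => k _; rewrite mulrA.
apply: cvg_sumr => l; apply: cvgM; [exact: cvg_cst|exact: cf].
Qed.

Let diffs_coefl i j : pseries_diffs (coef i j) = fun k => \sum_l (- B i l) * coef l j k.
Proof.
apply/funext => k; rewrite /pseries_diffs /coef factS natrM invfM exprS mxE.
rewrite mulrA mulrA mulfV ?mul1r ?pnatr_eq0// mulr_sumr.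
by apply: eq_bigr => l _; rewrite mxE mulrCA.
Qed.

Let diffs_coefr i j : pseries_diffs (coef i j) = fun k => \sum_l (- B l j) * coef i l k.
Proof.
apply/funext => k; rewrite /pseries_diffs /coef factS natrM invfM exprSr mxE.
rewrite mulrA mulrA mulfV ?mul1r ?pnatr_eq0// mulr_sumr.
by apply: eq_bigr => l _; rewrite [(- B) l j]mxE; ring.
Qed.

Let lim_diffs i j x : limn (pseries (pseries_diffs (coef i j)) x) = - (B *m semigroup x) i j.
Proof.
rewrite diffs_coefl (cvg_lim (@Rhausdorff R) (@lim_pseries_sum (fun l => - B i l) (fun l => coef l j) x (fun l => @cvg_coef l j x)))//.
rewrite mxE -sumrN; apply: eq_bigr => l _.
by rewrite semigroup_pseries mulNr.
Qed.

Let cvg_diffs i j x : cvgn (pseries (pseries_diffs (coef i j)) x).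
Proof.
rewrite diffs_coefl.
apply/cvg_ex; exists (\sum_l - B i l * limn (pseries (coef l j) x)).
exact: (@lim_pseries_sum (fun l => - B i l) (fun l => coef l j) x (fun l => @cvg_coef l j x)).
Qed.

(** The differentiated series can factor [(- B)^(k+1)] on either side, and both factorisations have
    the same sum. *)
Lemma semigroup_comm x : B *m semigroup x = semigroup x *m B.
Proof.
apply/matrixP => i j; apply: oppr_inj; rewrite -lim_diffs diffs_coefr.
rewrite (cvg_lim (@Rhausdorff R) (@lim_pseries_sum (fun l => - B l j) (fun l => coef i l) x (fun l => @cvg_coef i l x)))//.
rewrite mxE -sumrN; apply: eq_bigr => l _.
by rewrite semigroup_pseries mulNr mulrC.
Qed.

Lemma is_derive_semigroup i j (u : R) :
  is_derive u (1 : R) (fun u => semigroup u i j) (- (B *m semigroup u) i j).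
Proof.
have -> : (fun u => semigroup u i j) = fun u => limn (pseries (coef i j) u).
  by apply/funext => x; rewrite semigroup_pseries.
rewrite -lim_diffs.
apply: (@pseries_snd_diffs _ _ (`|u| + 1)).
- exact: cvg_coef.
- exact: cvg_diffs.
- rewrite diffs_coefl.
  have -> : pseries_diffs (fun k => \sum_l - B i l * coef l j k) =
            fun k => \sum_l - B i l * pseries_diffs (coef l j) k.
    apply/funext => k; rewrite /pseries_diffs mulr_sumr.
    by apply: eq_bigr => l _; rewrite mulrCA.
  apply/cvg_ex; exists (\sum_l - B i l * limn (pseries (pseries_diffs (coef l j)) (`|u| + 1))).
  exact: (@lim_pseries_sum (fun l => - B i l) (fun l => pseries_diffs (coef l j)) _ (fun l => @cvg_diffs l j _)).
- by rewrite [ltRHS]ger0_norm ?addr_ge0// ltrDl.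
Qed.

Lemma semigroup0 : semigroup 0 = 1%:M.
Proof.
apply/matrixP => i j; rewrite semigroup_pseries; apply: cvg_lim => //.
apply: cvg_near_cst; exists 1%N => // N /= N1.
rewrite /pseries/series/= big_ltn// big1_seq ?addr0.
  by rewrite /coef fact0 invr1 mul1r !expr0 mulr1.
move=> k /=; rewrite mem_index_iota => /andP[k1 _].
by rewrite expr0n; case: k k1 => // k _; rewrite mulr0.
Qed.

Lemma continuous_semigroup i j : continuous (fun u => semigroup u i j).
Proof.
move=> u; apply/differentiable_continuous/derivable1_diffP.
by have [] := is_derive_semigroup i j u.
Qed.

Lemma is_derive_bigsum (I : Type) (s : seq I) (f : I -> R -> R) (df : I -> R) (x : R) :
  (forall i, is_derive x (1 : R) (f i) (df i)) ->
  is_derive x (1 : R) (fun y => \sum_(i <- s) f i y) (\sum_(i <- s) df i).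
Proof.
move=> H; elim: s => [|i s ih].
  rewrite big_nil (_ : (fun _ => _) = cst 0); first exact: is_derive_cst.
  by apply/funext => y; rewrite big_nil.
rewrite big_cons (_ : (fun _ => _) = f i \+ (fun y => \sum_(j <- s) f j y)).
  exact: is_deriveD.
by apply/funext => y; rewrite big_cons.
Qed.

(* [s |-> E(t - s) E(s)] has zero derivative. *)
Lemma semigroupD s t : semigroup (s + t) = semigroup s *m semigroup t.
Proof.
suff H (x t' : R) : semigroup (t' - x) *m semigroup x = semigroup t'.
  by rewrite -(H t (s + t)) addrK.
apply/matrixP => i j.
pose f (x : R) := (semigroup (t' - x) *m semigroup x) i j.
have df (y : R) : is_derive y (1 : R) f 0.
  have -> : f = fun y => \sum_l semigroup (t' - y) i l * semigroup y l j.
    by apply/funext => z; rewrite /f mxE.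
  have d1 l : is_derive y (1 : R) (fun y => semigroup (t' - y) i l) ((B *m semigroup (t' - y)) i l).
    have H1 := is_derive_semigroup i l (t' - y).
    apply: is_derive_eq.
      apply: (@is_derive1_comp _ (fun u => semigroup u i l) (fun y => t' - y)).
    by rewrite add0r mul1r mulrN1 opprK.
  have d2 l : is_derive y (1 : R) (fun y => semigroup (t' - y) i l * semigroup y l j)
     ((B *m semigroup (t' - y)) i l * semigroup y l j - semigroup (t' - y) i l * (B *m semigroup y) l j).
    have H1 := d1 l; have H2 := is_derive_semigroup l j y.
    apply: is_derive_eq.
    by rewrite /GRing.scale/=; ring.
  apply: is_derive_eq; first exact: (is_derive_bigsum _ d2).
  rewrite sumrB; have -> : \sum_l (B *m semigroup (t' - y)) i l * semigroup y l j =
      (B *m semigroup (t' - y) *m semigroup y) i j by rewrite [RHS]mxE.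
  have -> : \sum_l semigroup (t' - y) i l * (B *m semigroup y) l j =
      (semigroup (t' - y) *m (B *m semigroup y)) i j by rewrite [RHS]mxE.
  by rewrite mulmxA semigroup_comm subrr.
have := is_derive_0_is_cst x 0 df; rewrite /f => ->.
by rewrite subr0 semigroup0 mulmx1.
Qed.

Lemma mvt_bound (f f' : R -> R) (C h : R) : 0 <= h ->
  (forall x : R, is_derive x (1 : R) f (f' x)) ->
  (forall x, 0 <= x <= h -> `|f' x| <= C) -> `|f h - f 0| <= C * h.
Proof.
move=> h0 df f'C; have [->|hn0] := eqVneq h 0; first by rewrite subrr normr0 mulr0.
have hpos : 0 < h by rewrite lt_neqAle eq_sym hn0.
have cf : {within `[0, h], continuous f}.
  apply: continuous_subspaceT => x.
  by apply/differentiable_continuous/derivable1_diffP; have [] := df x.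
have [c] := @MVT _ f f' _ _ hpos (fun x _ => df x) cf.
rewrite in_itv/= => /andP[c0 ch] ->.
by rewrite subr0 normrM (ger0_norm h0) ler_wpM2r// f'C// !ltW.
Qed.

Lemma semigroup_bounded_unit : exists2 C : R, 0 <= C &
  forall i j (h : R), 0 <= h <= 1 -> `|semigroup h i j| <= C.
Proof.
have H (ij : 'I_n * 'I_n) : exists C : R,
    forall h : R, 0 <= h <= 1 -> `|semigroup h ij.1 ij.2| <= C.
  have cE : {within `[(0 : R), 1], continuous (fun h => `|semigroup h ij.1 ij.2|)}.
    apply: continuous_subspaceT => x; apply: continuous_comp.
      exact: continuous_semigroup.
    exact: norm_continuous.
  have [c _ cmax] := EVT_max ler01 cE.
  by exists `|semigroup c ij.1 ij.2| => h h01; apply: cmax; rewrite in_itv.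
pose C ij := sval (cid (H ij)).
have CP ij h : 0 <= h <= 1 -> `|semigroup h ij.1 ij.2| <= C ij by exact: (svalP (cid (H ij))).
exists (\sum_ij `|C ij|); first by apply: sumr_ge0.
move=> i j h h01; apply: (le_trans (CP (i, j) h h01)).
apply: (le_trans (ler_norm _)); rewrite (bigD1 (i, j))//= lerDl.
by apply: sumr_ge0.
Qed.

(** Two applications of the mean value bound: the derivative of [semigroup x + x B] is
    [B (1 - semigroup x)], itself of order [x]. *)
Lemma semigroup_expansion : exists2 C : R, 0 <= C &
  forall i j (h : R), 0 <= h <= 1 -> `|(semigroup h - (1%:M - h *: B)) i j| <= C * h ^+ 2.
Proof.
have [C C0 EC] := semigroup_bounded_unit.
have BE i j h : 0 <= h <= 1 -> `|(B *m semigroup h) i j| <= beta * C.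
  move=> h01; rewrite mxE; apply: (le_trans (ler_norm_sum _ _ _)).
  apply: (@le_trans _ _ (\sum_l `|B i l| * C)).
    by apply: ler_sum => l _; rewrite normrM ler_wpM2l// EC.
  rewrite -mulr_suml ler_wpM2r// /beta [leRHS](bigD1 i)//= lerDl.
  by apply: sumr_ge0 => k _; apply: sumr_ge0.
have E1 i j h : 0 <= h <= 1 -> `|semigroup h i j - (1%:M : 'M[R]_n) i j| <= beta * C * h.
  move=> /andP[h0 h1]; rewrite -semigroup0.
  apply: (mvt_bound h0 (is_derive_semigroup i j)) => x /andP[x0 xh].
  by rewrite normrN BE// x0 (le_trans xh).
exists (beta * (beta * C)); first by rewrite !mulr_ge0.
move=> i j h /andP[h0 h1].
pose f (x : R) := semigroup x i j + x * B i j.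
pose f' (x : R) := - (B *m semigroup x) i j + B i j.
have df (x : R) : is_derive x (1 : R) f (f' x).
  have := is_derive_semigroup i j x => d; apply: is_derive_eq.
  by rewrite scaler0 add0r /GRing.scale/= mulr1.
have -> : (semigroup h - (1%:M - h *: B)) i j = f h - f 0.
  by rewrite /f semigroup0 !mxE mul0r addr0; ring.
rewrite expr2 mulrA; apply: (mvt_bound h0 df) => x /andP[x0 xh].
have -> : f' x = - (\sum_l B i l * (semigroup x l j - (1%:M : 'M[R]_n) l j)).
  rewrite /f' mxE; under [in RHS]eq_bigr do rewrite mulrBr.
  rewrite sumrB opprB addrC; congr (_ - _).
  by rewrite -[in LHS](mulmx1 B) mxE.
rewrite normrN; apply: (le_trans (ler_norm_sum _ _ _)).
apply: (@le_trans _ _ (\sum_l `|B i l| * (beta * C * h))).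
  apply: ler_sum => l _; rewrite normrM ler_wpM2l//.
  apply: (le_trans (E1 l j x _)); first by rewrite x0 (le_trans xh).
  by rewrite ler_wpM2l// mulr_ge0.
rewrite -mulr_suml -[leRHS]mulrA ler_wpM2r ?mulr_ge0//.
rewrite /beta [leRHS](bigD1 i)//= lerDl.
by apply: sumr_ge0 => k _; apply: sumr_ge0.
Qed.

End MatrixExponential.

Section Decay.
Context {R : realType} {n : nat}.
Local Notation normc := Normc.normc.

Definition cplx {m p} (A : 'M[R]_(m, p)) : 'M[R[i]]_(m, p) := map_mx (real_complex R) A.

Lemma l1_cplx (v : 'cV[R]_n) : l1 (cplx v) = \sum_j `|v j 0|.
Proof. by apply: eq_bigr => j _; rewrite mxE normc_real. Qed.

(** Only the differences [X - z] occur, so [A], [A - 1 = - W] and [A - 1/2 = B] share one chain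
    norm. *)
Lemma annihilated_shift (X : 'M[R[i]]_n) c s v :
  annihilated (X - c%:M) [seq z - c | z <- s] v = annihilated X s v.
Proof.
elim: s v => //= z s ih v; rewrite ih; congr (annihilated _ _ (_ *m _)).
by rewrite raddfB/= opprB addrA subrK.
Qed.

Lemma chain_shift (X : 'M[R[i]]_n) K c s v :
  chain (X - c%:M) K [seq z - c | z <- s] v = chain X K s v.
Proof.
elim: s v => //= z s ih v; rewrite ih; congr (_ + _ * chain _ _ _ (_ *m _)).
by rewrite raddfB/= opprB addrA subrK.
Qed.

Variables (B : 'M[R]_n) (K mu delta : R) (z0 : R[i]) (s : seq R[i]).
Hypothesis K0 : 0 < K.
Hypothesis Kd : 1 <= K * delta.
Hypothesis z0_mu : mu <= complex.Re z0.
Hypothesis s_mu : forall z, z \in s -> mu + delta <= complex.Re z.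

Local Notation X := (cplx B).
Local Notation N := (fun v : 'cV[R]_n => chain X K (z0 :: s) (cplx v)).

Lemma normc_sqr_bounded : exists2 C, 0 <= C & forall z, z \in z0 :: s -> normc z ^+ 2 <= C.
Proof.
exists (\sum_(z <- z0 :: s) normc z ^+ 2); first by apply: sumr_ge0 => z _; exact: sqr_ge0.
move=> z zs; rewrite (big_rem z)//= lerDl; apply: sumr_ge0 => y _; exact: sqr_ge0.
Qed.

Lemma chain_step : exists2 C, 0 <= C & forall h v, 0 <= h -> annihilated X (z0 :: s) (cplx v) ->
  N (v - h *: (B *m v)) <= (1 - h * mu + C * h ^+ 2) * N v.
Proof.
have [C C0 HC] := normc_sqr_bounded.
exists C => // h v h0 ann.
have -> : cplx (v - h *: (B *m v)) = damp X h (cplx v).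
  by rewrite /damp /cplx map_mxB map_mxZ map_mxM.
exact: (chain_damp K0 h0 Kd z0_mu s_mu HC ann).
Qed.

Lemma chain_semigroup_small : exists2 C, 0 <= C & forall h v, 0 <= h <= 1 ->
  annihilated X (z0 :: s) (cplx v) ->
  N (semigroup B h *m v) <= expR (- (h * mu) + C * h ^+ 2) * N v.
Proof.
have [C C0 HC] := chain_step.
have [D D0 HD] := semigroup_expansion B.
have [L L0 HL] := chain_le_l1 X K0 (z0 :: s).
exists (C + L * (n%:R * n%:R * D)); first by rewrite addr_ge0// !mulr_ge0.
move=> h v h01 ann; have h0 : 0 <= h by case/andP: h01.
pose Q := semigroup B h - (1%:M - h *: B).
have -> : semigroup B h *m v = (v - h *: (B *m v)) + Q *m v.
  rewrite /Q mulmxBl mulmxBl mul1mx -scalemxAl; by rewrite addrCA subrr addr0.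
have -> : cplx (v - h *: (B *m v) + Q *m v) = cplx (v - h *: (B *m v)) + cplx (Q *m v).
  by rewrite /cplx map_mxD.
apply: (le_trans (chainD X K0 _ _ _)).
have NQ : chain X K (z0 :: s) (cplx (Q *m v)) <= L * (n%:R * n%:R * D) * h ^+ 2 * N v.
  apply: (le_trans (HL _)); rewrite -[leRHS]mulrA -[leRHS]mulrA ler_wpM2l//.
  apply: (@le_trans _ _ (n%:R * n%:R * D * (h ^+ 2 * l1 (cplx v)))); last first.
    by rewrite ler_wpM2l ?mulr_ge0// ler_wpM2l ?sqr_ge0//; exact: l1_le_chain.
  rewrite !l1_cplx.
  apply: (@le_trans _ _ (\sum_(i < n) \sum_(j < n) D * h ^+ 2 * \sum_j `|v j 0|)).
    apply: ler_sum => i _; rewrite mxE; apply: (le_trans (ler_norm_sum _ _ _)).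
    apply: ler_sum => j _; rewrite normrM ler_pM//; first exact: HD.
    by rewrite [leRHS](bigD1 j)//= lerDl sumr_ge0.
  rewrite !sumr_const !card_ord; set S := \sum_j _.
  by rewrite le_eqVlt; apply/orP; left; apply/eqP; ring.
apply: (le_trans (lerD (HC h v h0 ann) NQ)).
rewrite -mulrDl ler_wpM2r ?chain_ge0//; apply: le_trans (expR_ge1Dx _).
by rewrite mulrDl; lra.
Qed.

Lemma semigroup_annihilated h v t : annihilated X t (cplx v) ->
  annihilated X t (cplx (semigroup B h *m v)).
Proof.
rewrite /cplx map_mxM; apply: annihilated_mul.
by rewrite -!map_mxM semigroup_comm.
Qed.

(** The interval is cut into [k + 1] steps whose second-order errors total [C tau^2 / (k + 1)] and
    disappear in the limit; hence the exact rate [mu], with constant 1. *)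
Lemma chain_semigroup tau v : 0 <= tau -> annihilated X (z0 :: s) (cplx v) ->
  N (semigroup B tau *m v) <= expR (- (tau * mu)) * N v.
Proof.
move=> t0 ann; have [C C0 HC] := chain_semigroup_small.
have iter (h : R) (k : nat) : 0 <= h <= 1 ->
    N (semigroup B (k%:R * h) *m v) <= expR (k%:R * (- (h * mu) + C * h ^+ 2)) * N v.
  move=> h01; elim: k => [|k ih].
    by rewrite !mul0r semigroup0 mul1mx expR0 mul1r.
  rewrite -natr1 mulrDl mul1r addrC semigroupD -mulmxA.
  apply: (le_trans (HC _ _ h01 (semigroup_annihilated _ ann))).
  rewrite mulrDl mul1r [X in _ <= expR X * _]addrC [X in _ <= X * _]expRD -[leRHS]mulrA.
  by rewrite ler_wpM2l// expR_ge0.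
have lim : expR (- (tau * mu) + C * tau ^+ 2 * k.+1%:R^-1) * N v @[k --> \oo] -->
           expR (- (tau * mu)) * N v.
  apply: (@cvgM R _ \oo); last exact: cvg_cst.
  apply: continuous_cvg; first exact: continuous_expR.
  rewrite -[X in _ --> X]addr0; apply: (@cvgD R _ _ \oo); first exact: cvg_cst.
  rewrite -[X in _ --> X](mulr0 (C * tau ^+ 2)); apply: (@cvgM R _ \oo); first exact: cvg_cst.
  exact: cvg_harmonic.
apply: (cvgr_to_ge lim); exists (Num.trunc tau) => // k /= kt.
have k0 : 0 < k.+1%:R :> R by rewrite ltr0n.
have h01 : 0 <= tau / k.+1%:R <= 1.
  rewrite divr_ge0//= ler_pdivrMr// mul1r; apply: (le_trans (ltW (truncnS_gt _))).
  by rewrite ler_nat.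
have := iter _ k.+1 h01; rewrite mulrC divfK ?gt_eqF// => H; apply: (le_trans H).
rewrite ler_wpM2r ?chain_ge0// ler_expR le_eqVlt; apply/orP; left; apply/eqP.
by field.
Qed.

End Decay.

Section Spectrum.
Context {R : realType} {n : nat}.
Variable W : 'M[R]_n.
Local Notation A := (1%:M - W).
Local Notation B := ((2^-1)%:M - W).

(* [w] stands for the spectral abscissa of [W], which the chain norms reach up to
   an arbitrarily small error without any diagonalisability. *)
Definition drift_norm (N : 'cV[R]_n -> R) (w C : R) :=
  [/\ 0 <= C, forall u v, N (u + v) <= N u + N v, forall (u : 'cV[R]_n) j, `|u j 0| <= N u,
      forall u, N u <= C * \sum_j `|u j 0| &
      forall h u, 0 <= h -> N (u + h *: (W *m u)) <= (1 + w * h + C * h ^+ 2) * N u].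

Lemma lambda_min_le z : z \in eigenvalues A -> lambda_min A <= complex.Re z.
Proof.
rewrite /lambda_min; move: (head _ _) => x0; elim: (eigenvalues A) => //= y s ih.
rewrite big_cons inE => /orP[/eqP ->|/ih]; first by rewrite ge_min lexx.
by rewrite ge_min => ->; rewrite orbT.
Qed.

Lemma cplxA_W : cplx (- W) = cplx A - (1 : R[i])%:M.
Proof. by rewrite /cplx map_mxB map_mxN map_mx1 addrAC subrr add0r. Qed.

Lemma cplxA_B : cplx B = cplx A - ((2^-1 : R)%:C)%C%:M.
Proof.
rewrite /cplx !map_mxB map_mx1 map_scalar_mx addrAC; congr (_ - _).
rewrite -raddfB/=; congr (_%:M); apply/eqP; rewrite eq_complex /=; apply/andP; split.
  by apply/eqP; lra.
by rewrite subr0.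
Qed.

(** [u + h W u] is the Euler step of [- W = A - 1], whose eigenvalues are those of [A] lowered by 1:
    real parts at least [mu] for [A] become an expansion rate [1 - mu]. *)
Lemma chain_drift_norm K mu delta z0 s : 0 < K -> 1 <= K * delta ->
  mu <= complex.Re z0 -> (forall z, z \in s -> mu + delta <= complex.Re z) ->
  (forall v, annihilated (cplx A) (z0 :: s) v) ->
  exists C, drift_norm (fun v => chain (cplx A) K (z0 :: s) (cplx v)) (1 - mu) C.
Proof.
move=> K0 Kd z0m sm ann.
have [C1 C10 H1] := chain_le_l1 (cplx A) K0 (z0 :: s).
have [||C2 C20 H2] := @chain_step R n (- W) K (mu - 1) delta (z0 - 1) [seq z - 1 | z <- s] K0 Kd.
- by case: (z0) z0m => a b /=; lra.
- by move=> _ /mapP[z zs ->]; have := sm z zs; case: z {zs} => a b /=; lra.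
exists (C1 + C2); split; first exact: addr_ge0.
- move=> u v; have -> : cplx (u + v) = cplx u + cplx v by rewrite /cplx map_mxD.
  exact: (chainD (cplx A) K0).
- move=> u j; apply: le_trans (l1_le_chain _ K0 _ _ _).
  by rewrite l1_cplx (bigD1 j)//= lerDl sumr_ge0.
- move=> u; rewrite -l1_cplx; apply: (le_trans (H1 _)).
  by rewrite ler_wpM2r ?l1_ge0// lerDl.
- move=> h u h0.
  have := H2 h u h0; rewrite cplxA_W -[_ :: _]/[seq z - 1 | z <- z0 :: s].
  rewrite annihilated_shift !chain_shift => /(_ (ann _)).
  rewrite mulNmx scalerN opprK => H; apply: (le_trans H).
  rewrite ler_wpM2r ?chain_ge0//.
  by rewrite mulrDl; have := mulr_ge0 C10 (sqr_ge0 h); lra.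
Qed.

(** The list is any one whose factors annihilate this particular [v], so a vector killed without the
    critical factor decays at the faster rate of the others. *)
Lemma chain_decay K mu delta z0 s : 0 < K -> 1 <= K * delta ->
  2^-1 + mu <= complex.Re z0 -> (forall z, z \in s -> 2^-1 + mu + delta <= complex.Re z) ->
  forall v, annihilated (cplx A) (z0 :: s) (cplx v) -> exists2 C, 0 <= C &
    forall tau i, 0 <= tau -> `|(semigroup B tau *m v) i 0| <= C * expR (- (tau * mu)).
Proof.
move=> K0 Kd z0m sm v ann.
exists (chain (cplx A) K (z0 :: s) (cplx v)); first exact: chain_ge0.
move=> tau i tau0.
pose hf : R[i] := ((2^-1 : R)%:C)%C.
have z0c : mu <= complex.Re (z0 - hf) by case: (z0) z0m => a b /=; lra.
have sc z : z \in [seq z - hf | z <- s] -> mu + delta <= complex.Re z.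
  by move=> /mapP[y ys ->]; have := sm y ys; case: y {ys} => a b /=; lra.
have sh : z0 - hf :: [seq z - hf | z <- s] = [seq z - hf | z <- z0 :: s] by [].
have annB : annihilated (cplx B) (z0 - hf :: [seq z - hf | z <- s]) (cplx v).
  by rewrite sh cplxA_B annihilated_shift.
have := chain_semigroup K0 Kd z0c sc tau0 annB.
rewrite sh [in X in X -> _]cplxA_B !chain_shift mulrC => H; apply: le_trans H.
apply: le_trans (l1_le_chain _ K0 _ _ _).
by rewrite l1_cplx (bigD1 i)//= lerDl sumr_ge0.
Qed.

Lemma subcritical_spectrum : 2^-1 < lambda_min A -> exists N w C gamma,
  [/\ drift_norm N w C, w < 2^-1, 0 < gamma &
      forall tau i j, 0 <= tau -> `|semigroup B tau i j| <= C * expR (- (tau * gamma))].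
Proof.
move=> half; have ann v := annihilated_eigenvalues A v.
have rho_le z : z \in eigenvalues A -> lambda_min A <= complex.Re z by exact: lambda_min_le.
(* The empty matrix has [lambda_min] 0 by convention, which [half] excludes. *)
have : eigenvalues A != [::].
  by apply: contraTneq half => e0; rewrite /lambda_min e0 /= big_nil; lra.
move: ann rho_le; set rh := lambda_min A in half *; case: (eigenvalues A) => // z0 s ann rho_le _.
(* A third of the gap: the head needs [1/2 + g] and the others [1/2 + 2 g], both at most [rh]. *)
pose g := (rh - 2^-1) / 3; have g0 : 0 < g by rewrite /g; lra.
have K0 : 0 < g^-1 by rewrite invr_gt0.
have Kd : 1 <= g^-1 * g by rewrite mulVf ?gt_eqF.
have z0m : 2^-1 + g <= complex.Re z0.
  by have := rho_le z0 (mem_head _ _); rewrite /g; lra.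
have sm z : z \in s -> 2^-1 + g + g <= complex.Re z.
  move=> zs; have := rho_le z; rewrite inE zs orbT => /(_ isT); rewrite /g; lra.
have [C NC] := chain_drift_norm K0 Kd z0m sm ann.
have E j := chain_decay K0 Kd z0m sm (ann (cplx (delta_mx j 0 : 'cV[R]_n))).
pose D j := sval (cid2 (E j)).
have D0 j : 0 <= D j by rewrite /D; case: cid2.
have DP j tau i : 0 <= tau -> `|semigroup B tau i j| <= D j * expR (- (tau * g)).
  by rewrite /D; case: cid2 => c c0 H t0; have := H tau i t0; rewrite -colE mxE.
have NC' : drift_norm (fun v => chain (cplx A) g^-1 (z0 :: s) (cplx v)) (1 - (2^-1 + g)) (C + \sum_j D j).
  have SD : 0 <= \sum_j D j by apply: sumr_ge0.
  case: NC => C0 H1 H2 H3 H4; split => //; first exact: addr_ge0.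
    by move=> u; apply: (le_trans (H3 u)); rewrite ler_wpM2r ?sumr_ge0// lerDl.
  move=> h u h0; apply: (le_trans (H4 h u h0)); rewrite ler_wpM2r ?chain_ge0//.
  by rewrite lerD2l ler_wpM2r ?sqr_ge0// lerDl.
exists (fun v => chain (cplx A) g^-1 (z0 :: s) (cplx v)), (1 - (2^-1 + g)), (C + \sum_j D j), g.
split=> //; first by lra.
move=> tau i j t0; apply: (le_trans (DP j tau i t0)); rewrite ler_wpM2r ?expR_ge0//.
case: NC => C0 _ _ _ _; rewrite (bigD1 j)//= addrCA lerDl addr_ge0// sumr_ge0//.
Qed.

(* The only critical eigenvalue of [A] is simple, hence real, hence [1/2], so that
   [B] is its factor in the chain: [B *m semigroup B tau] sees only the others. *)
Lemma critical_spectrum : lambda_min A = 2^-1 ->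
  count (fun z => complex.Re z == 2^-1) (eigenvalues A) = 1%N -> exists N C gamma,
  [/\ drift_norm N 2^-1 C, 0 < gamma,
      forall tau i j, 0 <= tau -> `|semigroup B tau i j| <= C &
      forall tau i j, 0 <= tau -> `|(B *m semigroup B tau) i j| <= C * expR (- (tau * gamma))].
Proof.
move=> half cnt.
have rho_le z : z \in eigenvalues A -> 2^-1 <= complex.Re z.
  by rewrite -half; exact: lambda_min_le.
have : has (fun z => complex.Re z == 2^-1) (eigenvalues A) by rewrite has_count cnt.
case/hasP => z0 z0A /eqP z0half.
pose s := rem z0 (eigenvalues A).
have perm : perm_eq (eigenvalues A) (z0 :: s) by exact: perm_to_rem.
have cnts : count (fun z => complex.Re z == 2^-1) s = 0%N.
  by move: cnt; rewrite (permP perm) /= z0half eqxx add1n => -[].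
have s_gt z : z \in s -> 2^-1 < complex.Re z.
  move=> zs; rewrite lt_neqAle; apply/andP; split.
    apply: contraPneq cnts => e; apply/eqP; rewrite -lt0n -has_count.
    by apply/hasP; exists z => //; rewrite -e eqxx.
  by apply: rho_le; rewrite (perm_mem perm) inE zs orbT.
have z0E : z0 = ((2^-1 : R)%:C)%C.
  have := eigenvalues_conj z0A; rewrite (perm_mem perm) inE => /orP[/eqP|/s_gt].
    case: (z0) z0half => a b /= -> /eqP; rewrite eq_complex /= eqxx /= => /eqP bb.
    by apply/eqP; rewrite eq_complex /= eqxx/=; apply/eqP; lra.
  by case: (z0) z0half => a b /= ->; rewrite ltxx.
have ann v : annihilated (cplx A) (z0 :: s) v.
  by apply: (annihilated_perm perm); exact: annihilated_eigenvalues.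
(* Two copies of [d] are reserved: one is the decay rate on the remaining eigenvalues, the other the
   margin [delta] of the chain. *)
have [d d0 sd] : exists2 d : R, 0 < d & forall z, z \in s -> 2^-1 + d + d <= complex.Re z.
  move: s_gt; elim: (s) => [|y t ih] H; first by exists 1.
  have [|d d0 dt] := ih; first by move=> z zt; apply: H; rewrite inE zt orbT.
  have := H y (mem_head _ _) => yh.
  exists (Num.min d ((complex.Re y - 2^-1) / 2)); first by rewrite lt_min d0; lra.
  move=> z; rewrite inE => /orP[/eqP ->|/dt zd].
    have : Num.min d ((complex.Re y - 2^-1) / 2) <= (complex.Re y - 2^-1) / 2 by rewrite ge_min lexx orbT.
    lra.
  have : Num.min d ((complex.Re y - 2^-1) / 2) <= d by rewrite ge_min lexx.
  lra.
have K0 : 0 < d^-1 by rewrite invr_gt0.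
have Kd : 1 <= d^-1 * d by rewrite mulVf ?gt_eqF.
have z0m : 2^-1 <= complex.Re z0 by rewrite z0half.
have sm z : z \in s -> 2^-1 + d <= complex.Re z by move=> /sd; lra.
have [C NC] := chain_drift_norm K0 Kd z0m sm ann.
have z0m' : 2^-1 + 0 <= complex.Re z0 by rewrite addr0.
have sm' z : z \in s -> 2^-1 + 0 + d <= complex.Re z by rewrite addr0; exact: sm.
have E j := chain_decay K0 Kd z0m' sm' (ann (cplx (delta_mx j 0 : 'cV[R]_n))).
have E' j : exists2 C, 0 <= C & forall tau i, 0 <= tau ->
    `|(semigroup B tau *m (B *m (delta_mx j 0 : 'cV[R]_n))) i 0| <= C * expR (- (tau * d)).
  (* Since [z0 = 1/2], the factor [A - z0] is [B], so [B e_j] is annihilated by the other factors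
     alone. If there are none, it is 0. *)
  have annB : annihilated (cplx A) s (cplx (B *m (delta_mx j 0 : 'cV[R]_n))).
    have /= := ann (cplx (delta_mx j 0 : 'cV[R]_n)).
    by rewrite z0E -cplxA_B {1}/cplx -map_mxM.
  move: annB sd; case: (s) => [|z1 t] annB sd'.
    exists 0 => // tau i _; rewrite mul0r.
    have -> : B *m (delta_mx j 0 : 'cV[R]_n) = 0.
      apply/matrixP => k l; rewrite ord1 [RHS]mxE.
      have := congr1 (fun M : 'cV[R[i]]_n => M k 0) annB.
      by rewrite !mxE => -[].
    by rewrite mulmx0 mxE normr0.
  apply: (chain_decay (mu := d) (delta := d) K0 Kd _ _ annB).
    by have := sd' z1 (mem_head _ _); lra.
  by move=> z zt; apply: sd'; rewrite inE zt orbT.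
pose D j := sval (cid2 (E j)).
have D0 j : 0 <= D j by rewrite /D; case: cid2.
have DP j tau i : 0 <= tau -> `|semigroup B tau i j| <= D j.
  rewrite /D; case: cid2 => c c0 H t0; have := H tau i t0.
  by rewrite -colE mxE mulr0 oppr0 expR0 mulr1.
pose D' j := sval (cid2 (E' j)).
have D'0 j : 0 <= D' j by rewrite /D'; case: cid2.
have D'P j tau i : 0 <= tau -> `|(B *m semigroup B tau) i j| <= D' j * expR (- (tau * d)).
  rewrite /D'; case: cid2 => c c0 H t0; have := H tau i t0.
  by rewrite mulmxA -semigroup_comm -colE mxE.
pose D1 := \sum_j D j; pose D2 := \sum_j D' j.
have D10 : 0 <= D1 by apply: sumr_ge0.
have D20 : 0 <= D2 by apply: sumr_ge0.
have DD j : D j <= D1 by rewrite /D1 (bigD1 j)//= lerDl sumr_ge0.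
have DD' j : D' j <= D2 by rewrite /D2 (bigD1 j)//= lerDl sumr_ge0.
have C0 : 0 <= C by case: NC.
exists (fun v => chain (cplx A) d^-1 (z0 :: s) (cplx v)), (C + D1 + D2), d; split => //.
- have w : 1 - 2^-1 = 2^-1 :> R by lra.
  have CC : C <= C + D1 + D2 by rewrite -addrA lerDl addr_ge0.
  case: NC => _ H1 H2 H3 H4; split => //; first by rewrite !addr_ge0.
    by move=> u; apply: (le_trans (H3 u)); rewrite ler_wpM2r ?sumr_ge0.
  move=> h u h0; apply: (le_trans (H4 h u h0)); rewrite w ler_wpM2r ?chain_ge0//.
  by rewrite lerD2l ler_wpM2r ?sqr_ge0.
- by move=> tau i j t0; apply: (le_trans (DP j tau i t0)); have := DD j; lra.
- move=> tau i j t0; apply: (le_trans (D'P j tau i t0)); rewrite ler_wpM2r ?expR_ge0//.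
  by have := DD' j; lra.
Qed.

End Spectrum.

(** * Recursive inequalities *)

Section RealSequences.
Context {R : realType}.
Implicit Types (f h eta : nat -> R) (t : nat).

Lemma leq_induct (Q : nat -> Prop) t0 : Q t0 -> (forall t, (t0 <= t)%N -> Q t -> Q t.+1) ->
  forall t, (t0 <= t)%N -> Q t.
Proof.
move=> Q0 QS t t0t; rewrite -(subnK t0t); elim: (t - t0)%N => [|k ih] //.
by rewrite addSn; apply: QS => //; exact: leq_addl.
Qed.

Lemma ln_step_ge t : (0 < t)%N -> t.+1%:R^-1 <= ln t.+1%:R - ln t%:R :> R.
Proof.
move=> t0; have tr : 1 <= t%:R :> R by rewrite ler1n.
have t2 : 0 < t.+1%:R :> R by rewrite ltr0n.
have E : t.+1%:R = t%:R + 1 :> R by rewrite -natr1.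
rewrite -ln_div ?posrE//; last by lra.
rewrite -ler_expR lnK ?posrE ?divr_gt0//; last by lra.
rewrite -lef_pV2 ?posrE ?expR_gt0 ?divr_gt0// -?expRN; last by lra.
apply: le_trans (expR_ge1Dx _); rewrite invf_div E le_eqVlt; apply/orP; left; apply/eqP.
by field; lra.
Qed.

Lemma ln_step t : (0 < t)%N ->
  (2 * t%:R)^-1 <= ln t.+1%:R - ln t%:R :> R /\ ln t.+1%:R - ln t%:R <= t%:R^-1 :> R.
Proof.
move=> t0; have tr : 1 <= t%:R :> R by rewrite ler1n.
have t2 : 0 < t.+1%:R :> R by rewrite ltr0n.
have E : t.+1%:R = t%:R + 1 :> R by rewrite -natr1.
split.
  apply: le_trans (ln_step_ge t0); rewrite lef_pV2 ?posrE ?mulr_gt0//; lra.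
rewrite -ln_div ?posrE//; last by lra.
rewrite -ler_expR lnK ?posrE ?divr_gt0//; last by lra.
apply: le_trans (expR_ge1Dx _); rewrite E mulrDl mulfV ?mul1r//; lra.
Qed.

Lemma cvg_ln_nat : (ln t%:R : R) @[t --> \oo] --> +oo%R.
Proof.
apply/cvgryPge => A; near=> t.
have H : expR A <= t%:R by near: t; exact: nbhs_infty_ger.
by rewrite -ler_expR lnK// posrE (lt_le_trans (expR_gt0 _) H).
Unshelve. all: by end_near. Qed.

Lemma cvg_inv_nat : (t%:R^-1 : R) @[t --> \oo] --> 0.
Proof.
apply/cvgrPdist_le => e e0; near=> t.
have H : e^-1 <= t%:R by near: t; exact: nbhs_infty_ger.
rewrite sub0r normrN ger0_norm ?invr_ge0//.
by rewrite -[e]invrK lef_pV2// posrE ?invr_gt0// (lt_le_trans _ H)// invr_gt0.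
Unshelve. all: by end_near. Qed.

Lemma cvg0_near f (e : R) : f t @[t --> \oo] --> 0 -> 0 < e -> \forall t \near \oo, `|f t| <= e.
Proof.
by move/cvgrPdist_le => H /H; apply: filterS => t; rewrite sub0r normrN.
Qed.

(** The excess of [f] over [e / 2] eventually contracts by [1 - delta/t] with no noise left, and the
    product of these factors is at most a multiple of [t^(-delta)]. *)
Lemma contraction_cvg0 f eta (delta : R) : 0 < delta -> (forall t, 0 <= f t) ->
  (\forall t \near \oo, f t.+1 <= (1 - delta / t%:R) * f t + eta t / t%:R) ->
  eta t @[t --> \oo] --> 0 -> f t @[t --> \oo] --> 0.
Proof.
move=> d0 f0 fS eta0; apply/cvgrPdist_le => e e0.
have h0 : 0 < e / 2 by rewrite divr_gt0.
have [t0 _ H] : \forall t \near \oo, [/\ (0 < t)%N, delta <= t%:R, eta t <= delta * (e / 2) &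
    f t.+1 <= (1 - delta / t%:R) * f t + eta t / t%:R].
  near=> t; split.
  - by near: t; exact: nbhs_infty_gt.
  - by near: t; exact: nbhs_infty_ger.
  - apply: (le_trans (ler_norm _)); near: t.
    exact: cvg0_near (mulr_gt0 d0 h0).
  - by near: t.
pose g t := Num.max (f t - e / 2) 0.
have g0 t : 0 <= g t by rewrite le_max lexx orbT.
have gS t : (t0 <= t)%N -> g t.+1 <= (1 - delta / t%:R) * g t.
  move=> tt; have [t1 dt et ft] := H t tt; have tr : 0 < t%:R :> R by rewrite ltr0n.
  have p0 : 0 <= 1 - delta / t%:R by rewrite subr_ge0 ler_pdivrMr// mul1r.
  rewrite [leLHS]/g ge_max; apply/andP; split; last exact: mulr_ge0.
  apply: (@le_trans _ _ ((1 - delta / t%:R) * (f t - e / 2))).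
    have : eta t / t%:R <= delta * (e / 2) / t%:R by rewrite ler_pM2r// invr_gt0.
    by rewrite mulrBr mulrBl; lra.
  by rewrite ler_wpM2l// le_max lexx.
have gle t : (t0 <= t)%N -> g t <= g t0 * expR (delta * ln t0%:R) * expR (- (delta * ln t%:R)).
  move: t; apply: leq_induct.
    by rewrite -mulrA -expRD subrr expR0 mulr1.
  move=> t tt ih; have [t1 dt _ _] := H t tt; have tr : 0 < t%:R :> R by rewrite ltr0n.
  have p0 : 0 <= 1 - delta / t%:R by rewrite subr_ge0 ler_pdivrMr// mul1r.
  apply: (le_trans (gS t tt)); apply: (le_trans (ler_wpM2l p0 ih)).
  rewrite mulrC -[leLHS]mulrA ler_wpM2l ?mulr_ge0 ?expR_ge0//.
  apply: (@le_trans _ _ (expR (- (delta * ln t%:R)) * expR (- (delta / t%:R)))).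
    by rewrite ler_wpM2l ?expR_ge0// expR_ge1Dx.
  rewrite -expRD ler_expR.
  have [_] := ln_step t1; rewrite -(ler_pM2l d0) mulrBr; lra.
have lim : g t0 * expR (delta * ln t0%:R) * expR (- (delta * ln t%:R)) @[t --> \oo] --> 0.
  rewrite -[X in _ --> X](mulr0 (g t0 * expR (delta * ln t0%:R))).
  apply: cvgM; first exact: cvg_cst.
  apply: (@cvg_comp _ _ _ (fun t => delta * ln t%:R : R) (fun x => expR (- x)) _ +oo%R); last exact: cvgr_expR.
  apply/cvgryPge => A; have /cvgryPge/(_ (A / delta)) := cvg_ln_nat.
  by apply: filterS => t; rewrite ler_pdivrMr// mulrC.
near=> t.
rewrite sub0r normrN ger0_norm//.
have t0t : (t0 <= t)%N by near: t; exact: nbhs_infty_ge.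
have gt : g t <= e / 2.
  apply: (le_trans (gle t t0t)); apply: (le_trans (ler_norm _)); near: t.
  exact: cvg0_near h0.
have : f t - e / 2 <= g t by rewrite le_max lexx.
lra.
Unshelve. all: by end_near. Qed.

(** [E / delta] is the level at which contraction and noise balance, so the larger of it and the
    current value is never exceeded again. *)
Lemma contraction_bounded f eta (delta E : R) : 0 < delta ->
  (\forall t \near \oo, f t.+1 <= (1 - delta / t%:R) * f t + eta t / t%:R) ->
  (forall t, eta t <= E) -> exists K, \forall t \near \oo, f t <= K.
Proof.
move=> d0 fS eE.
have [t0 _ H] : \forall t \near \oo, [/\ (0 < t)%N, delta <= t%:R &
    f t.+1 <= (1 - delta / t%:R) * f t + eta t / t%:R].
  near=> t; split; [by near: t; exact: nbhs_infty_gt|by near: t; exact: nbhs_infty_ger|by near: t].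
pose K := Num.max (f t0) (E / delta); exists K.
have fK t : (t0 <= t)%N -> f t <= K.
  move: t; apply: leq_induct; first by rewrite le_max lexx.
  move=> t tt ih; have [t1 dt ft] := H t tt; have tr : 0 < t%:R :> R by rewrite ltr0n.
  have p0 : 0 <= 1 - delta / t%:R by rewrite subr_ge0 ler_pdivrMr// mul1r.
  apply: (le_trans ft); have := ler_wpM2l p0 ih.
  have EK : E <= delta * K by rewrite mulrC -ler_pdivrMr// le_max lexx orbT.
  have : eta t / t%:R <= delta * K / t%:R.
    by rewrite ler_pM2r ?invr_gt0// (le_trans (eE t)).
  by rewrite [(1 - _) * K]mulrBl mul1r mulrAC; lra.
by near=> t; apply: fK; near: t; exact: nbhs_infty_ge.
Unshelve. all: by end_near. Qed.

(* [exp(2K/t)] absorbs the factors [1 + K/t^2]. *)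
Lemma critical_weight f eta (K : R) : 0 <= K -> (forall t, 0 <= f t) -> (forall t, 0 <= eta t) ->
  (\forall t \near \oo, f t.+1 <= (1 + K / t%:R ^+ 2) * f t + eta t / t%:R) ->
  exists h, (forall t, f t <= h t) /\ \forall t \near \oo,
    h t.+1 <= h t + 2 * expR (2 * K) * eta t * (ln t.+1%:R - ln t%:R).
Proof.
move=> K0 f0 e0 fS; exists (fun t => f t * expR (2 * K / t%:R)); split.
  move=> t; rewrite ler_peMr// -expR0 ler_expR divr_ge0// mulr_ge0//.
near=> t; have t1 : (0 < t)%N by near: t; exact: nbhs_infty_gt.
have tr : 1 <= t%:R :> R by rewrite ler1n.
have t2 : 0 < t.+1%:R :> R by rewrite ltr0n.
have E : t.+1%:R = t%:R + 1 :> R by rewrite -natr1.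
have fSt : f t.+1 <= (1 + K / t%:R ^+ 2) * f t + eta t / t%:R by near: t.
apply: (le_trans (ler_wpM2r (expR_ge0 _) fSt)); rewrite mulrDl lerD//.
  rewrite mulrAC mulrC ler_wpM2l//.
  apply: (@le_trans _ _ (expR (K / t%:R ^+ 2) * expR (2 * K / t.+1%:R))).
    by rewrite ler_wpM2r ?expR_ge0// expR_ge1Dx.
  rewrite -expRD ler_expR -subr_ge0.
  have -> : 2 * K / t%:R - (K / t%:R ^+ 2 + 2 * K / t.+1%:R) = K * (t%:R - 1) / (t%:R ^+ 2 * t.+1%:R).
    by rewrite E; field; lra.
  by rewrite divr_ge0// ?mulr_ge0//; lra.
(* Replacing [1/(2 t)] by the increment of [ln] lets the noise telescope later. *)
have [s1 _] := ln_step t1.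
have -> : eta t / t%:R * expR (2 * K / t.+1%:R) = 2 * expR (2 * K / t.+1%:R) * eta t * (2 * t%:R)^-1.
  by field; lra.
apply: ler_pM => //; rewrite ?mulr_ge0 ?expR_ge0 ?invr_ge0//.
rewrite ler_wpM2r// ler_wpM2l// ler_expR ler_pdivrMr// ler_peMr ?mulr_ge0// E; lra.
Unshelve. all: by end_near. Qed.

Lemma critical_bounded f (K : R) : 0 <= K -> (forall t, 0 <= f t) ->
  (\forall t \near \oo, f t.+1 <= (1 + K / t%:R ^+ 2) * f t) ->
  exists K', \forall t \near \oo, f t <= K'.
Proof.
move=> K0 f0 fS; have [|h [fh [t0 _ hS]]] := @critical_weight f (fun=> 0) K K0 f0 (fun=> lexx 0).
  by apply: filterS fS => t; rewrite mul0r addr0.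
exists (h t0).
have hle t : (t0 <= t)%N -> h t <= h t0.
  move: t; apply: leq_induct => // t tt ih; apply: le_trans ih.
  by have := hS t tt; rewrite mulr0 mul0r addr0.
near=> t; apply: (le_trans (fh t)); apply: hle.
by near: t; exact: nbhs_infty_ge.
Unshelve. all: by end_near. Qed.

Lemma critical_log_bounded f eta (K E : R) : 0 <= K -> (forall t, 0 <= f t) -> (forall t, 0 <= eta t) ->
  (\forall t \near \oo, f t.+1 <= (1 + K / t%:R ^+ 2) * f t + eta t / t%:R) ->
  (\forall t \near \oo, eta t <= E) ->
  exists K', \forall t \near \oo, f t <= K' + 2 * expR (2 * K) * E * ln t%:R.
Proof.
move=> K0 f0 e0 fS eE; have [h [fh hS]] := critical_weight K0 f0 e0 fS.
have [t0 _ H] : \forall t \near \oo, [/\ (0 < t)%N, eta t <= E &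
    h t.+1 <= h t + 2 * expR (2 * K) * eta t * (ln t.+1%:R - ln t%:R)].
  near=> t; split; near: t => //; exact: nbhs_infty_gt.
exists (h t0 - 2 * expR (2 * K) * E * ln t0%:R).
have hle t : (t0 <= t)%N -> h t <= h t0 - 2 * expR (2 * K) * E * ln t0%:R + 2 * expR (2 * K) * E * ln t%:R.
  move: t; apply: leq_induct; first by rewrite subrK.
  move=> t tt ih; have [t1 et ht] := H t tt; apply: (le_trans ht).
  have [s1 _] := ln_step t1.
  have s0 : 0 <= ln t.+1%:R - ln t%:R :> R by apply: le_trans s1; rewrite invr_ge0 mulr_ge0.
  have : 2 * expR (2 * K) * eta t * (ln t.+1%:R - ln t%:R) <= 2 * expR (2 * K) * E * (ln t.+1%:R - ln t%:R).
    by rewrite ler_wpM2r// ler_wpM2l// mulr_ge0// expR_ge0.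
  by rewrite [_ * E * (_ - _)]mulrBr; lra.
near=> t; apply: (le_trans (fh t)); apply: hle.
by near: t; exact: nbhs_infty_ge.
Unshelve. all: by end_near. Qed.

(** The slope of the logarithmic bound is proportional to [E], which can be taken arbitrarily small
    because [eta] tends to 0. *)
Lemma critical_log_cvg0 f eta (K : R) : 0 <= K -> (forall t, 0 <= f t) -> (forall t, 0 <= eta t) ->
  (\forall t \near \oo, f t.+1 <= (1 + K / t%:R ^+ 2) * f t + eta t / t%:R) ->
  eta t @[t --> \oo] --> 0 -> f t / ln t%:R @[t --> \oo] --> 0.
Proof.
move=> K0 f0 e0 fS eta0; apply/cvgrPdist_le => e epos.
pose E := e / 2 / (2 * expR (2 * K)).
have P0 : 0 < 2 * expR (2 * K) by rewrite mulr_gt0// expR_gt0.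
have E0 : 0 < E by rewrite !divr_gt0.
have [|K' HK'] := @critical_log_bounded f eta K E K0 f0 e0 fS.
  by have := cvg0_near eta0 E0; apply: filterS => t; apply: le_trans; exact: ler_norm.
near=> t.
have l1 : 1 <= ln t%:R :> R by near: t; exact: (cvgryPge _).1 cvg_ln_nat _.
have l2 : `|K'| / (e / 2) <= ln t%:R by near: t; exact: (cvgryPge _).1 cvg_ln_nat _.
have ft : f t <= K' + 2 * expR (2 * K) * E * ln t%:R by near: t.
have l0 : 0 < ln t%:R :> R by lra.
rewrite sub0r normrN ger0_norm ?divr_ge0 ?(ltW l0)// ler_pdivrMr//.
apply: (le_trans ft).
have -> : 2 * expR (2 * K) * E = e / 2 by rewrite /E mulrC divfK// gt_eqF.
have : `|K'| <= e / 2 * ln t%:R by rewrite mulrC -ler_pdivrMr// divr_gt0.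
by have := ler_norm K'; lra.
Unshelve. all: by end_near. Qed.

End RealSequences.

(** * Growth of the errors against the normalisation *)

Section Scales.
Context {R : realType}.
Implicit Types (t k : nat) (a eps : nat -> R).

Variables (w C : R).
Hypothesis w0 : 0 <= w.
Hypothesis C0 : 0 <= C.

(** Bounds the expansion of a test vector in one drift step: [w] is the spectral rate, and [C]
    collects the offsets [c_i] and the second-order terms. At [t = 0] the divisions give 0 and the
    factor is 1. *)
Definition growth t : R := 1 + w / t%:R + C / t%:R ^+ 2.

(** [k] is the degree of the error in the test vector, [x] its initial size and [eps] the part
    created at each step. *)
Fixpoint growth_rec k eps (x : R) t : R :=
  if t is t'.+1 then growth t' ^+ k * growth_rec k eps x t' + eps t' else x.

Lemma growth_ge1 t : 1 <= growth t.
Proof. by rewrite /growth -addrA lerDl addr_ge0// divr_ge0. Qed.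

Lemma growth_ge0 t : 0 <= growth t.
Proof. by apply: le_trans (growth_ge1 t). Qed.

Lemma growth_rec_ge0 k eps x t : (forall t, 0 <= eps t) -> 0 <= x -> 0 <= growth_rec k eps x t.
Proof.
by move=> e0 x0; elim: t => //= t ih; rewrite addr_ge0// mulr_ge0// exprn_ge0// growth_ge0.
Qed.

(* [a] dominates the three error terms of the recursion for the characteristic
   function and the recursion for the second moment. *)
Definition dominating_scale a :=
  [/\ \forall t \near \oo, 0 < a t,
      forall x, 0 <= x -> growth_rec 1 (fun=> 0) x t / a t @[t --> \oo] --> 0,
      forall x eps, 0 <= x -> (forall t, 0 <= eps t) -> eps t @[t --> \oo] --> 0 ->
        growth_rec 2 eps x t / a t ^+ 2 @[t --> \oo] --> 0,
      forall x K, 0 <= x -> 0 <= K -> growth_rec 3 (fun=> K) x t / a t ^+ 3 @[t --> \oo] --> 0 &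
      forall x K, 0 <= x -> 0 <= K -> exists K', \forall t \near \oo,
        growth_rec 2 (fun=> K) x t / a t ^+ 2 <= K'].

(** The step factor, per degree, of an error divided by [sqrt t]. It is [1 - (1/2 - w)/t] up to
    order [1/t^2], whence the critical value [1/2] of [w]. *)
Let nu t : R := growth t * (Num.sqrt t%:R / Num.sqrt t.+1%:R).

Let nu_ge0 t : 0 <= nu t.
Proof. by rewrite mulr_ge0 ?growth_ge0// divr_ge0 ?sqrtr_ge0. Qed.

(** From [2 x y <= x^2 + y^2], in the form [x/y <= (x^2 + y^2)/(2 y^2)]. *)
Let sqrt_ratio t : (0 < t)%N ->
  Num.sqrt t%:R / Num.sqrt t.+1%:R <= 1 - (2 * t%:R)^-1 + (2 * t%:R ^+ 2)^-1 :> R.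
Proof.
move=> t0; have tr : 1 <= t%:R :> R by rewrite ler1n.
have E : t.+1%:R = t%:R + 1 :> R by rewrite -natr1.
set x := Num.sqrt t%:R; set y := Num.sqrt t.+1%:R.
have x0 : 0 <= x by exact: sqrtr_ge0.
have y0 : 0 < y by rewrite sqrtr_gt0 ltr0n.
have x2 : x ^+ 2 = t%:R by rewrite sqr_sqrtr.
have y2 : y ^+ 2 = t%:R + 1 by rewrite sqr_sqrtr.
apply: (@le_trans _ _ (1 - (2 * (t%:R + 1))^-1)).
  rewrite ler_pdivrMr//.
  have -> : 1 - (2 * (t%:R + 1))^-1 = (x ^+ 2 + y ^+ 2) / (2 * y ^+ 2) :> R.
    by rewrite x2 y2; field; lra.
  have -> : (x ^+ 2 + y ^+ 2) / (2 * y ^+ 2) * y = (x ^+ 2 + y ^+ 2) / (2 * y) by field; lra.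
  rewrite ler_pdivlMr ?mulr_gt0//; have := sqr_ge0 (x - y); rewrite sqrrB; lra.
rewrite -subr_ge0.
have -> : 1 - (2 * t%:R)^-1 + (2 * t%:R ^+ 2)^-1 - (1 - (2 * (t%:R + 1))^-1) =
  (2 * t%:R ^+ 2 * (t%:R + 1))^-1 :> R by field; lra.
by rewrite invr_ge0 !mulr_ge0 ?sqr_ge0//; lra.
Qed.

Let nu_le t : w <= 2^-1 -> (0 < t)%N -> nu t <= 1 - (2^-1 - w) / t%:R + (1 + C) / t%:R ^+ 2.
Proof.
move=> w1 t0; have tr : 1 <= t%:R :> R by rewrite ler1n.
apply: (le_trans (ler_wpM2l (growth_ge0 t) (sqrt_ratio t0))).
rewrite -subr_ge0 /growth.
set x := t%:R^-1 : R.
have xE : t%:R = x^-1 :> R by rewrite invrK.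
have x0 : 0 < x by rewrite invr_gt0; lra.
have x1 : x <= 1 by rewrite invf_le1; lra.
have -> : 1 - (2^-1 - w) / t%:R + (1 + C) / t%:R ^+ 2 -
  (1 + w / t%:R + C / t%:R ^+ 2) * (1 - (2 * t%:R)^-1 + (2 * t%:R ^+ 2)^-1) =
  x ^+ 2 * (2^-1 + w / 2 * (1 - x) + C / 2 * x * (1 - x)).
  by rewrite xE; field; lra.
rewrite mulr_ge0 ?sqr_ge0// !addr_ge0 ?mulr_ge0//; lra.
Qed.

Let scaled k eps x t : growth_rec k eps x t.+1 / Num.sqrt t.+1%:R ^+ k =
  nu t ^+ k * (growth_rec k eps x t / Num.sqrt t%:R ^+ k) + eps t / Num.sqrt t.+1%:R ^+ k
  \/ t = 0%N.
Proof.
have [->|t0] := posnP t; [by right|left].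
rewrite /= /nu !exprMn exprVn mulrDl; congr (_ + _).
have s0 : Num.sqrt t%:R ^+ k != 0 :> R by rewrite expf_neq0// gt_eqF// sqrtr_gt0 ltr0n.
have s1 : Num.sqrt t.+1%:R ^+ k != 0 :> R by rewrite expf_neq0// gt_eqF// sqrtr_gt0 ltr0n.
by field; rewrite s0 s1.
Qed.

Let f k eps x t : R := growth_rec k eps x t / Num.sqrt t%:R ^+ k.

Let f_ge0 k eps x t : (forall t, 0 <= eps t) -> 0 <= x -> 0 <= f k eps x t.
Proof. by move=> e0 x0; rewrite divr_ge0 ?exprn_ge0 ?sqrtr_ge0 ?growth_rec_ge0. Qed.

Let eta k (K : R) t : R := K / Num.sqrt t%:R ^+ k.

(** Of the [k + 2] square roots, two supply the factor [1/t] of the recursive inequalities and the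
    other [k] remain as decay. *)
Let noise_term_le k (y : R) t : 0 <= y -> (0 < t)%N ->
  y / Num.sqrt t.+1%:R ^+ k.+2 <= y / Num.sqrt t%:R ^+ k / t%:R.
Proof.
move=> y0 t0; have tr : 0 < t%:R :> R by rewrite ltr0n.
have s0 : 0 < Num.sqrt t%:R ^+ k :> R by rewrite exprn_gt0// sqrtr_gt0.
have s1 : 0 < Num.sqrt t.+1%:R ^+ k.+2 :> R by apply: exprn_gt0; rewrite sqrtr_gt0 ltr0n.
rewrite -mulrA -invfM ler_wpM2l// lef_pV2; [|exact: s1|exact: mulr_gt0].
have -> : Num.sqrt t%:R ^+ k * t%:R = Num.sqrt t%:R ^+ k.+2 :> R.
  by rewrite -addn2 exprD sqr_sqrtr ?ltW.
by rewrite lerXn2r ?nnegrE ?sqrtr_ge0// ler_sqrt// ler_nat.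
Qed.

(** Half of the gap [1/2 - w] absorbs the [1/t^2] terms of [nu]; as [nu <= 1] eventually, higher
    powers only help. *)
Let subcritical_step k eps x : w < 2^-1 -> (forall t, 0 <= eps t) -> 0 <= x -> (0 < k)%N ->
  \forall t \near \oo, f k eps x t.+1 <=
    (1 - (2^-1 - w) / 2 / t%:R) * f k eps x t + eps t / Num.sqrt t.+1%:R ^+ k.
Proof.
move=> wh e0 x0 k0; near=> t.
have t0 : (0 < t)%N by near: t; exact: nbhs_infty_gt.
have tr : 1 <= t%:R :> R by rewrite ler1n.
have tl : (1 + C) / ((2^-1 - w) / 2) <= t%:R by near: t; exact: nbhs_infty_ger.
have [|t00] := scaled k eps x t; last by rewrite t00 in t0.
rewrite -!/(f k eps x _) => ->; rewrite lerD2r ler_wpM2r ?f_ge0//.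
have nut : nu t <= 1 - (2^-1 - w) / 2 / t%:R.
  apply: (le_trans (nu_le (ltW wh) t0)).
  have d0 : 0 < (2^-1 - w) / 2 by lra.
  move: tl; rewrite ler_pdivrMr// => tl.
  have : (1 + C) / t%:R ^+ 2 <= (2^-1 - w) / 2 / t%:R.
    rewrite ler_pdivrMr ?exprn_gt0//; last by lra.
    by rewrite expr2 mulrA divfK ?[_ * t%:R]mulrC// gt_eqF//; lra.
  by lra.
apply: (le_trans _ nut); rewrite -[leRHS]expr1 ler_wiXn2l//.
apply: (le_trans nut); rewrite gerBl divr_ge0//; lra.
Unshelve. all: by end_near. Qed.

Lemma cvg_inv_sqrt : (Num.sqrt t%:R : R)^-1 @[t --> \oo] --> 0.
Proof.
apply/cvgrPdist_le => e e0; near=> t.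
have H : e^-1 ^+ 2 <= t%:R by near: t; exact: nbhs_infty_ger.
have t0 : 0 < t%:R :> R by apply: lt_le_trans H; rewrite exprn_gt0// invr_gt0.
rewrite sub0r normrN ger0_norm ?invr_ge0 ?sqrtr_ge0// invf_ple ?posrE ?sqrtr_gt0//.
by rewrite -[leLHS]ger0_norm ?invr_ge0 ?(ltW e0)// -sqrtr_sqr ler_sqrt.
Unshelve. all: by end_near. Qed.

Let eta3_cvg K : eta 1 K t @[t --> \oo] --> 0.
Proof.
rewrite -[X in _ --> X](mulr0 K); apply: cvgM; first exact: cvg_cst.
exact: cvg_inv_sqrt.
Qed.

Lemma subcritical_scale : w < 2^-1 -> dominating_scale (fun t => Num.sqrt t%:R).
Proof.
move=> wh; have d0 : 0 < (2^-1 - w) / 2 by lra.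
split.
- by near=> t; rewrite sqrtr_gt0 ltr0n; near: t; exact: nbhs_infty_gt.
- move=> x x0; apply: (@contraction_cvg0 R (f 1 (fun=> 0) x) (fun=> 0) _ d0).
  + by move=> t; exact: f_ge0.
  + apply: filterS (subcritical_step wh (fun=> lexx 0) x0 (ltn0Sn 0)) => t.
    by rewrite !mul0r.
  + exact: cvg_cst.
- move=> x eps x0 e0 ec; apply: (@contraction_cvg0 R (f 2 eps x) eps _ d0) => //.
    by move=> t; exact: f_ge0.
  near=> t; have t0 : (0 < t)%N by near: t; exact: nbhs_infty_gt.
  have H : f 2 eps x t.+1 <= (1 - (2^-1 - w) / 2 / t%:R) * f 2 eps x t + eps t / Num.sqrt t.+1%:R ^+ 2.
    by near: t; exact: subcritical_step.
  apply: (le_trans H); rewrite lerD2l; apply: le_trans (noise_term_le 0 (e0 t) t0) _.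
  by rewrite expr0 divr1.
- move=> x K x0 K0; apply: (@contraction_cvg0 R (f 3 (fun=> K) x) (eta 1 K) _ d0) => //.
    by move=> t; exact: f_ge0.
  near=> t; have t0 : (0 < t)%N by near: t; exact: nbhs_infty_gt.
  have H : f 3 (fun=> K) x t.+1 <= (1 - (2^-1 - w) / 2 / t%:R) * f 3 (fun=> K) x t + K / Num.sqrt t.+1%:R ^+ 3.
    by near: t; exact: subcritical_step.
  by apply: (le_trans H); rewrite lerD2l; exact: (noise_term_le 1).
- move=> x K x0 K0; apply: (@contraction_bounded R (f 2 (fun=> K) x) (fun=> K) _ K d0) => //.
  near=> t; have t0 : (0 < t)%N by near: t; exact: nbhs_infty_gt.
  have H : f 2 (fun=> K) x t.+1 <= (1 - (2^-1 - w) / 2 / t%:R) * f 2 (fun=> K) x t + K / Num.sqrt t.+1%:R ^+ 2.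
    by near: t; exact: subcritical_step.
  apply: (le_trans H); rewrite lerD2l; apply: le_trans (noise_term_le 0 K0 t0) _.
  by rewrite expr0 divr1.
Unshelve. all: by end_near. Qed.

(** [(1 + y)^3 = 1 + y (3 + 3 y + y^2)] with [y = (1 + C)/t^2 <= 1 + C]; one constant for all
    degrees up to 3. *)
Let X : R := (1 + C) * (3 + 3 * (1 + C) + (1 + C) ^+ 2).

Let critical_step k eps x : w = 2^-1 -> (forall t, 0 <= eps t) -> 0 <= x -> (k <= 3)%N ->
  \forall t \near \oo, f k eps x t.+1 <=
    (1 + X / t%:R ^+ 2) * f k eps x t + eps t / Num.sqrt t.+1%:R ^+ k.
Proof.
move=> wh e0 x0 k3; near=> t.
have t0 : (0 < t)%N by near: t; exact: nbhs_infty_gt.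
have tr : 1 <= t%:R :> R by rewrite ler1n.
have [|t00] := scaled k eps x t; last by rewrite t00 in t0.
rewrite -!/(f k eps x _) => ->; rewrite lerD2r ler_wpM2r ?f_ge0//.
have w12 : w <= 2^-1 by rewrite wh.
have := nu_le w12 t0; rewrite wh subrr mul0r subr0.
set y := (1 + C) / t%:R ^+ 2 => nut.
have t2 : 1 <= t%:R ^+ 2 :> R by rewrite expr_ge1.
have c1 : 0 <= 1 + C by rewrite addr_ge0.
have y0 : 0 <= y by apply: divr_ge0 => //; exact: sqr_ge0.
have yC : y <= 1 + C by rewrite ler_pdivrMr ?ler_peMr//; lra.
apply: (@le_trans _ _ ((1 + y) ^+ k)); first by rewrite lerXn2r ?nnegrE ?nu_ge0//; lra.
apply: (@le_trans _ _ ((1 + y) ^+ 3)); first by rewrite ler_weXn2l//; lra.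
have -> : X / t%:R ^+ 2 = y * (3 + 3 * (1 + C) + (1 + C) ^+ 2) by rewrite /X /y mulrAC.
have : y * (3 + 3 * y + y ^+ 2) <= y * (3 + 3 * (1 + C) + (1 + C) ^+ 2).
  rewrite ler_wpM2l//; have : y ^+ 2 <= (1 + C) ^+ 2 by rewrite lerXn2r ?nnegrE//; lra.
  by lra.
have -> : (1 + y) ^+ 3 = 1 + y * (3 + 3 * y + y ^+ 2) by ring.
by lra.
Unshelve. all: by end_near. Qed.

(** Divided by the powers of [sqrt t] alone, the error of degree 1 is merely bounded and those of
    degrees 2 and 3 are [o(ln t)]. The extra [(ln t)^(k/2)] in the scale sends all three to 0. *)
Lemma critical_scale : w = 2^-1 -> dominating_scale (fun t => Num.sqrt (t%:R * ln t%:R)).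
Proof.
move=> wh.
have c1 : 0 <= 1 + C by rewrite addr_ge0.
have X0 : 0 <= X by rewrite mulr_ge0// !addr_ge0 ?mulr_ge0// exprn_ge0.
have lnbig (A : R) : \forall t \near \oo, A <= ln t%:R by have /cvgryPge := @cvg_ln_nat R; apply.
have sq t : Num.sqrt (t%:R * ln t%:R) = Num.sqrt t%:R * Num.sqrt (ln t%:R) :> R by rewrite sqrtrM.
have sq2 t : 1 <= ln t%:R :> R -> Num.sqrt (ln t%:R) ^+ 2 = ln t%:R :> R.
  by move=> l1; rewrite sqr_sqrtr//; lra.
split.
- near=> t; rewrite sqrtr_gt0 mulr_gt0//.
    by rewrite ltr0n; near: t; exact: nbhs_infty_gt.
  by apply: (@lt_le_trans _ _ 1) => //; near: t; exact: lnbig.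
- move=> x x0.
  have [|K HK] := @critical_bounded R (f 1 (fun=> 0) x) X X0 (fun t => f_ge0 1 t (fun=> lexx 0) x0).
    apply: filterS (critical_step wh (fun=> lexx 0) x0 (isT : (1 <= 3)%N)) => t.
    by rewrite mul0r addr0.
  apply/cvgrPdist_le => e e0; near=> t.
  have ft : f 1 (fun=> 0) x t <= K by near: t.
  have l1 : 1 <= ln t%:R :> R by near: t; exact: lnbig.
  have l2 : (`|K| / e) ^+ 2 <= ln t%:R by near: t; exact: lnbig.
  rewrite sub0r normrN sq invfM mulrA -[Num.sqrt t%:R]expr1 -/(f 1 (fun=> 0) x t).
  rewrite ger0_norm ?divr_ge0 ?sqrtr_ge0 ?growth_rec_ge0//.
  have s0 : 0 < Num.sqrt (ln t%:R) :> R by rewrite sqrtr_gt0; lra.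
  rewrite ler_pdivrMr//; apply: (le_trans ft); apply: (le_trans (ler_norm _)).
  rewrite mulrC -ler_pdivrMr// -[leLHS]ger0_norm ?divr_ge0 ?(ltW e0)//.
  by rewrite -sqrtr_sqr ler_sqrt//; lra.
- move=> x eps x0 e0 ec.
  have := @critical_log_cvg0 R (f 2 eps x) eps X X0 (fun t => f_ge0 2 t e0 x0) e0.
  have H : \forall t \near \oo, f 2 eps x t.+1 <= (1 + X / t%:R ^+ 2) * f 2 eps x t + eps t / t%:R.
    near=> t; have t0 : (0 < t)%N by near: t; exact: nbhs_infty_gt.
    have H : f 2 eps x t.+1 <= (1 + X / t%:R ^+ 2) * f 2 eps x t + eps t / Num.sqrt t.+1%:R ^+ 2.
      by near: t; exact: critical_step.
    apply: (le_trans H); rewrite lerD2l; apply: le_trans (noise_term_le 0 (e0 t) t0) _.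
    by rewrite expr0 divr1.
  move=> /(_ H ec); apply: cvg_trans; apply: near_eq_cvg; near=> t.
  have l1 : 1 <= ln t%:R :> R by near: t; exact: lnbig.
  by rewrite sq exprMn sq2// invfM mulrA.
- move=> x K x0 K0.
  have := @critical_log_cvg0 R (f 3 (fun=> K) x) (eta 1 K) X X0 (fun t => f_ge0 3 t (fun=> K0) x0).
  have e0 t : 0 <= eta 1 K t by rewrite divr_ge0 ?exprn_ge0 ?sqrtr_ge0.
  have H : \forall t \near \oo, f 3 (fun=> K) x t.+1 <= (1 + X / t%:R ^+ 2) * f 3 (fun=> K) x t + eta 1 K t / t%:R.
    near=> t; have t0 : (0 < t)%N by near: t; exact: nbhs_infty_gt.
    have H : f 3 (fun=> K) x t.+1 <= (1 + X / t%:R ^+ 2) * f 3 (fun=> K) x t + K / Num.sqrt t.+1%:R ^+ 3.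
      by near: t; exact: critical_step.
    by apply: (le_trans H); rewrite lerD2l; exact: (noise_term_le 1).
  move=> /(_ e0 H (eta3_cvg K)); apply: squeeze_cvgr (cvg_cst 0); near=> t.
  have l1 : 1 <= ln t%:R :> R by near: t; exact: lnbig.
  have s1 : 1 <= Num.sqrt (ln t%:R) :> R by rewrite -[leLHS]sqrtr1 ler_wsqrtr.
  apply/andP; split; first by rewrite divr_ge0 ?exprn_ge0 ?sqrtr_ge0 ?growth_rec_ge0.
  rewrite sq exprMn invfM mulrA ler_wpM2l ?f_ge0// lef_pV2 ?posrE ?exprn_gt0//; try lra.
  by rewrite exprS sq2// ler_peMl//; lra.
- move=> x K x0 K0.
  have := @critical_log_bounded R (f 2 (fun=> K) x) (fun=> K) X K X0 (fun t => f_ge0 2 t (fun=> K0) x0) (fun=> K0).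
  have H : \forall t \near \oo, f 2 (fun=> K) x t.+1 <= (1 + X / t%:R ^+ 2) * f 2 (fun=> K) x t + K / t%:R.
    near=> t; have t0 : (0 < t)%N by near: t; exact: nbhs_infty_gt.
    have H : f 2 (fun=> K) x t.+1 <= (1 + X / t%:R ^+ 2) * f 2 (fun=> K) x t + K / Num.sqrt t.+1%:R ^+ 2.
      by near: t; exact: critical_step.
    apply: (le_trans H); rewrite lerD2l; apply: le_trans (noise_term_le 0 K0 t0) _.
    by rewrite expr0 divr1.
  move=> /(_ H (nearW _ (fun=> lexx K)))[K' HK'].
  exists (`|K'| + 2 * expR (2 * X) * K); near=> t.
  have l1 : 1 <= ln t%:R :> R by near: t; exact: lnbig.
  have ft : f 2 (fun=> K) x t <= K' + 2 * expR (2 * X) * K * ln t%:R by near: t.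
  rewrite sq exprMn sq2// invfM mulrA ler_pdivrMr; last by lra.
  apply: (le_trans ft); have := ler_norm K'.
  have := ler_peMr (normr_ge0 K') l1; lra.
Unshelve. all: by end_near. Qed.

End Scales.

(** * The limiting covariance *)

Section RealCalculus.
Context {R : realType}.
Local Notation mu := (@lebesgue_measure R).
Implicit Types (f F : R -> R) (x : R).

Lemma is_derive_continuous F f : (forall x, is_derive x (1 : R) F (f x)) -> continuous F.
Proof.
move=> dF x; apply/differentiable_continuous/derivable1_diffP.
by have [] := dF x.
Qed.

Lemma mean_value F f (x y : R) : (forall x, is_derive x (1 : R) F (f x)) -> x <= y ->
  exists2 c, x <= c <= y & F y - F x = f c * (y - x).
Proof.
move=> dF xy; have cF : {within `[x, y], continuous F}.
  by apply: continuous_subspaceT; exact: is_derive_continuous dF.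
have [c] := MVT_segment xy (fun z _ => dF z) cF.
by rewrite in_itv /= => cxy e; exists c.
Qed.

Lemma continuous_integrable f (x y : R) : continuous f -> mu.-integrable `[x, y] (EFin \o f).
Proof.
move=> cf; apply: continuous_compact_integrable; first exact: segment_compact.
exact: continuous_subspaceT.
Qed.

Lemma antiderivative f : continuous f ->
  exists2 F, F 0 = 0 & forall x, is_derive x (1 : R) F (f x).
Proof.
move=> cf.
(* Independent of the base point [y] as long as [y] is to the left of [x] and 0. The base
   [- |x| - 1] moves with [x], so that one formula covers the whole line, negative arguments
   included. *)
pose G (y x : R) : R := (\int[mu]_(t in [set` `[y, x]]) f t - \int[mu]_(t in [set` `[y, 0%R]]) f t)%R.
have GE (y z x : R) : y <= z -> z <= x -> z <= 0 -> G y x = G z x.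
  move=> yz zx z0.
  have split (u : R) : z <= u ->
      (\int[mu]_(t in [set` `[y, u]]) f t =
       \int[mu]_(t in [set` `[y, z]]) f t + \int[mu]_(t in [set` `[z, u]]) f t)%R.
    move=> zu; have := @Rintegral_itvB R f (BLeft y) (BRight u) z (@continuous_integrable f y u cf).
    rewrite !bnd_simp => /(_ yz zu) /eqP.
    rewrite subr_eq addrC => /eqP ->; congr (_ + _)%R.
    rewrite Rintegral_itv_obnd_cbnd//.
    apply: integrableS (@continuous_integrable f z u cf) => //.
    exact: subset_itv_oc_cc.
  by rewrite /G (split x zx) (split 0 z0); ring.
exists (fun x => G (- `|x| - 1) x).
  by rewrite /G subrr.
move=> x.
pose y : R := - `|x| - 2.
have xabs : - `|x| <= x by rewrite lerNl -normrN ler_norm.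
have yx : y < x by rewrite /y; have := normr_ge0 x; lra.
pose I (z : R) : R := (\int[mu]_(t in [set` `[y, z]]) f t)%R.
have [dG eG] : derivable I x 1 /\ I^`()%classic x = f x.
  apply: (@continuous_FTC1_closed R f y x (x + 1)) => //; first by rewrite ltrDl.
    exact: continuous_integrable.
  exact: cf.
have dY : is_derive x (1 : R) (G y) (f x).
  have d1 : is_derive x (1 : R) I (f x).
    by apply: DeriveDef => //; rewrite -derive1E.
  have d2 := is_derive_cst (\int[mu]_(t in [set` `[y, 0%R]]) f t)%R x (1 : R).
  by have := is_deriveB d1 d2; rewrite subr0.
have nearE : {near x, G y =1 (fun z => G (- `|z| - 1) z)}.
  near=> z.
  have zx : `|x - z| < 1 by near: z; apply: (@nbhsx_ballx R R x 1 ltr01).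
  have zn : `|z| < `|x| + 1.
    by have := ler_normB x (x - z); rewrite opprB addrC subrK; lra.
  have zabs : - `|z| <= z by rewrite lerNl -normrN ler_norm.
  by have := normr_ge0 z; rewrite /y => z0; apply: GE; lra.
exact: (near_eq_is_derive nearE dY).
Unshelve. all: by end_near. Qed.

Lemma ftc_Rintegral F f (x : R) : (forall x, is_derive x (1 : R) F (f x)) -> continuous f ->
  0 < x -> (\int[mu]_(t in [set` `[0%R, x]]) f t)%R = F x - F 0.
Proof.
move=> dF cf x0; rewrite /Rintegral (@continuous_FTC2 R f F 0 x)//.
- exact: continuous_subspaceT.
- split.
  + by move=> z _; have [] := dF z.
  + by apply: cvg_at_right_filter; exact: (is_derive_continuous dF).
  + by apply: cvg_at_left_filter; exact: (is_derive_continuous dF).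
- by move=> z _; rewrite derive1E; have [_ ->] := dF z.
Qed.

Lemma is_deriveMl (c : R) F (df x : R) : is_derive x (1 : R) F df ->
  is_derive x (1 : R) (fun u => c * F u) (c * df).
Proof. by move=> d; apply: is_derive_eq; rewrite /GRing.scale/= ?mulr0 ?addr0. Qed.

Lemma is_derive_expRN (g x : R) : 0 < g ->
  is_derive x (1 : R) (fun u => - expR (- (u * g)) / g) (expR (- (x * g))).
Proof.
move=> g0; apply: is_derive_eq.
by rewrite /GRing.scale/= !mulr0 mulr1 !add0r; field; rewrite gt_eqF.
Qed.

Lemma expRN_cvg (C g : R) : 0 < g -> C * (- expR (- (x * g)) / g) @[x --> +oo%R] --> (0 : R).
Proof.
move=> g0; have -> : 0 = C * (- 0 / g) :> R by rewrite oppr0 mul0r mulr0.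
apply: cvgM; first exact: cvg_cst.
apply: cvgM; last exact: cvg_cst.
apply: cvgN; apply: (@cvg_comp _ _ _ (fun x : R => x * g) (fun x => expR (- x)) _ +oo%R); last exact: cvgr_expR.
under eq_fun do rewrite mulrC.
exact: (gt0_cvgMry g0 (@cvg_id _ (+oo%R : set_system R))).
Qed.

(** With [e] the primitive of the exponential that vanishes at infinity, [F + C e] is nondecreasing
    on the half-line and stays below the initial value of [F - C e]. *)
Lemma decay_cvg F f (C g : R) : (forall x, is_derive x (1 : R) F (f x)) -> 0 < g ->
  (forall x, 0 <= x -> `|f x| <= C * expR (- (x * g))) ->
  exists l : R, F x @[x --> +oo%R] --> l.
Proof.
move=> dF g0 fC.
have C0 : 0 <= C by have := fC 0 (lexx 0); rewrite mul0r oppr0 expR0 mulr1; apply: le_trans.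
pose e := fun u : R => - expR (- (u * g)) / g.
have de (s x : R) : is_derive x (1 : R) (fun u => F u + s * e u) (f x + s * expR (- (x * g))).
  exact: (is_deriveD (dF x) (is_deriveMl s (is_derive_expRN x g0))).
have up (x y : R) : 0 <= x -> x <= y -> F x + C * e x <= F y + C * e y.
  move=> x0 xy; have [c /andP[xc cy]] := mean_value (de C) xy.
  move=> E; rewrite -subr_ge0 E mulr_ge0 ?subr_ge0//.
  by have := fC c (le_trans x0 xc); rewrite ler_norml => /andP[]; lra.
have dn (x : R) : 0 <= x -> F x - C * e x <= F 0 - C * e 0.
  move=> x0; have [c /andP[xc cy]] := mean_value (de (- C)) x0.
  rewrite !mulNr => E; rewrite -subr_ge0 -opprB E oppr_ge0 mulr_le0_ge0 ?subr_ge0//.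
  by have := fC c xc; rewrite ler_norml => /andP[]; lra.
have ele0 x : e x <= 0 by rewrite /e mulNr oppr_le0 divr_ge0 ?expR_ge0 ?ltW.
(* Freezing the argument at 0 extends the monotone function to the whole line. *)
pose H x := F (Num.max x 0) + C * e (Num.max x 0).
have max0 x : 0 <= Num.max x 0 by rewrite le_max lexx orbT.
have ndH : {homo H : x y / x <= y}.
  move=> x y xy; apply: up => //; rewrite ge_max !le_max xy lexx ?orbT//.
have ubH : has_ubound (range H).
  exists (F 0 - C * e 0) => _ [x _ <-].
  apply: le_trans (dn _ (max0 x)); rewrite /H lerD2l.
  by have := mulr_ge0_le0 C0 (ele0 (Num.max x 0)); lra.
have cH := nondecreasing_cvgr ndH ubH.
exists (sup (range H)).
have ce : C * e x @[x --> +oo%R] --> (0 : R) by exact: expRN_cvg.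
have cHe : H x - C * e x @[x --> +oo%R] --> sup (range H).
  by rewrite -[X in _ --> X]subr0; exact: cvgB.
apply: cvg_trans cHe; apply: near_eq_cvg.
near=> x; have x0 : 0 <= x by near: x; exact: nbhs_pinfty_ge.
by rewrite /H /= (max_l x0) addrK.
Unshelve. all: by end_near. Qed.

(** The improper fundamental theorem is applied to nonnegative functions, namely the exponential
    bound and its sum with [f]; the two integrals are then subtracted. *)
Lemma decay_integrable F f (C g : R) : continuous f -> (forall x, is_derive x (1 : R) F (f x)) ->
  F 0 = 0 -> 0 < g -> (forall x, 0 <= x -> `|f x| <= C * expR (- (x * g))) ->
  mu.-integrable `[0, +oo[ (EFin \o f) /\
  F x @[x --> +oo%R] --> (\int[mu]_(t in [set` `[0%R, +oo[]) f t)%R.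
Proof.
move=> cf dF F0 g0 fC.
have C0 : 0 <= C by have := fC 0 (lexx 0); rewrite mul0r oppr0 expR0 mulr1; apply: le_trans.
pose E (x : R) := C * expR (- (x * g)).
pose e (x : R) := - expR (- (x * g)) / g.
have de (x : R) : is_derive x (1 : R) (fun u => C * e u) (E x).
  exact: (is_deriveMl C (is_derive_expRN x g0)).
have dh (x : R) : is_derive x (1 : R) (fun u => F u + C * e u) (f x + E x).
  exact: (is_deriveD (dF x) (de x)).
have cE : continuous E.
  move=> x; rewrite /continuous_at /E; apply: cvgM; first exact: cvg_cst.
  apply: continuous_cvg; first exact: continuous_expR.
  by apply: cvgN; apply: cvgM; [exact: cvg_id|exact: cvg_cst].
have ce : C * e x @[x --> +oo%R] --> (0 : R) by exact: expRN_cvg.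
have [l Fl] := decay_cvg dF g0 fC.
have ftc (k K : R -> R) (lim : R) : (forall x, is_derive x (1 : R) K (k x)) -> continuous k ->
    (forall x, 0 <= x -> 0 <= k x) -> K x @[x --> +oo%R] --> lim ->
    (\int[mu]_(x in `[0%R, +oo[) (k x)%:E = lim%:E - (K 0)%:E)%E.
  move=> dK ck k0 Kl; apply: ge0_continuous_FTC2y => //.
  - exact: continuous_subspaceT.
  - by apply: cvg_at_right_filter; exact: (is_derive_continuous dK).
  - by move=> x _; rewrite derive1E; have [_ ->] := dK x.
have E0 x : 0 <= E x by rewrite mulr_ge0 ?expR_ge0.
have intE := ftc _ _ _ de cE (fun x _ => E0 x) ce.
have mE (k : R -> R) : continuous k -> measurable_fun (`[0%R, +oo[ : set R) (EFin \o k).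
  by move=> ck; apply/measurable_EFinP; apply: measurable_funTS; exact: continuous_measurable_fun.
have iE : mu.-integrable `[0, +oo[ (EFin \o E).
  apply/integrableP; split; first exact: mE.
  under eq_integral do rewrite /= ger0_norm//.
  by rewrite intE -EFinB ltry.
have iF : mu.-integrable `[0, +oo[ (EFin \o f).
  apply: (@le_integrable _ _ _ mu _ _ _ (EFin \o E)) => //; first exact: mE.
  move=> x /=; rewrite in_itv/= andbT => x0.
  by rewrite lee_fin (ger0_norm (E0 x)) fC.
split => //.
have inth : (\int[mu]_(x in `[0%R, +oo[) (f x + E x)%:E = (l + 0)%:E - (F 0 + C * e 0)%:E)%E.
  apply: (ftc _ (fun u => F u + C * e u)) => //.
  - by move=> x; apply: continuousD; [exact: cf|exact: cE].
  - by move=> x x0; have := fC x x0; rewrite ler_norml /E => /andP[]; lra.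
  - exact: cvgD.
suff -> : (\int[mu]_(t in [set` `[0%R, +oo[]) f t)%R = l by [].
move: inth; under eq_integral do rewrite EFinD.
rewrite (@integralD _ _ _ mu _ (measurable_itv _) _ _ iF iE) intE.
have := integrable_fin_num _ iF => /(_ (measurable_itv _)) fI.
have -> : (\int[mu]_(t in [set` `[0%R, +oo[]) f t)%R =
  fine (\int[mu]_(x in `[0%R, +oo[) (EFin \o f) x)%E by [].
move: fI; set J := integral _ _ _; case: J => [r| |]// _ /= [].
by rewrite F0; lra.
Qed.

(** Mean value theorem for [F u - l u] beyond a point [y] after which [f] is within [eps / 2] of
    [l]; what happens before [y] contributes a constant divided by [x]. *)
Lemma cesaro_cvg F f (l : R) : (forall x, is_derive x (1 : R) F (f x)) ->
  f x @[x --> +oo%R] --> l -> x^-1 * F x @[x --> +oo%R] --> l.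
Proof.
move=> dF fl; apply/cvgrPdist_le => eps eps0.
have h0 : 0 < eps / 2 by rewrite divr_gt0.
move/cvgrPdist_le : fl => /(_ _ h0)[M [_ HM]].
pose y := Num.max (M + 1) 1; have y1 : 1 <= y by rewrite le_max lexx orbT.
have My : M < y by rewrite lt_max ltrDl ltr01.
pose K := `|F y - l * y|.
near=> x.
have xy : y <= x by near: x; apply: nbhs_pinfty_ge; exact: num_real.
have xK : K / (eps / 2) <= x by near: x; apply: nbhs_pinfty_ge; exact: num_real.
have x0 : 0 < x by apply: lt_le_trans xy; lra.
have d (z : R) : is_derive z (1 : R) (fun u => F u - l * u) (f z - l).
  have dFz := dF z; apply: is_derive_eq.
  by rewrite /GRing.scale/= mulr1.
have [c /andP[yc cx] E] := mean_value d xy.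
have fc : `|f c - l| <= eps / 2 by rewrite distrC; apply: HM; apply: lt_le_trans yc.
have -> : l - x^-1 * F x = - (x^-1 * (F x - l * x)) by field; rewrite gt_eqF.
rewrite normrN normrM normfV (gtr0_norm x0) mulrC ler_pdivrMr//.
have -> : F x - l * x = (f c - l) * (x - y) + (F y - l * y) by rewrite -E; ring.
apply: (le_trans (ler_normD _ _)); rewrite normrM -/K.
rewrite (ger0_norm (_ : 0 <= x - y)) ?subr_ge0//.
have : `|f c - l| * (x - y) <= eps / 2 * x.
  by apply: ler_pM => //; lra.
have : K <= eps / 2 * x by rewrite mulrC -ler_pdivrMr.
by lra.
Unshelve. all: by end_near. Qed.

End RealCalculus.

Section MatrixCalculus.
Context {R : realType}.

Definition is_mxderive {m n} (x : R) (F : R -> 'M[R]_(m, n)) (dF : 'M[R]_(m, n)) :=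
  forall i j, is_derive x (1 : R) (fun u => F u i j) (dF i j).

Lemma is_mxderive_cst m n x (A : 'M[R]_(m, n)) : is_mxderive x (fun=> A) 0.
Proof. by move=> i j; rewrite mxE; exact: is_derive_cst. Qed.

Lemma is_mxderiveD m n x (F G : R -> 'M[R]_(m, n)) dF dG :
  is_mxderive x F dF -> is_mxderive x G dG -> is_mxderive x (fun u => F u + G u) (dF + dG).
Proof.
move=> HF HG i j; rewrite mxE (_ : (fun u => _) = fun u => F u i j + G u i j).
  exact: (is_deriveD (HF i j) (HG i j)).
by apply/funext => u; rewrite mxE.
Qed.

Lemma is_mxderive_mul m n p x (F : R -> 'M[R]_(m, n)) (G : R -> 'M[R]_(n, p)) dF dG :
  is_mxderive x F dF -> is_mxderive x G dG ->
  is_mxderive x (fun u => F u *m G u) (dF *m G x + F x *m dG).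
Proof.
move=> HF HG i j; rewrite (_ : (fun u => _) = fun u => \sum_l F u i l * G u l j); last first.
  by apply/funext => u; rewrite mxE.
have d l : is_derive x (1 : R) (fun u => F u i l * G u l j) (dF i l * G x l j + F x i l * dG l j).
  have H1 := HF i l; have H2 := HG l j.
  by apply: is_derive_eq; rewrite /GRing.scale/=; ring.
by have := is_derive_bigsum (index_enum _) d; rewrite !mxE -big_split.
Qed.

Lemma is_mxderive_tr m n x (F : R -> 'M[R]_(m, n)) dF :
  is_mxderive x F dF -> is_mxderive x (fun u => (F u)^T) dF^T.
Proof.
move=> HF i j; rewrite mxE (_ : (fun u => _) = fun u => F u j i); first exact: HF.
by apply/funext => u; rewrite mxE.
Qed.

Lemma is_mxderive_eq m n x (F : R -> 'M[R]_(m, n)) dF dF' :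
  is_mxderive x F dF -> dF = dF' -> is_mxderive x F dF'.
Proof. by move=> ? <-. Qed.

End MatrixCalculus.

Section BilinearForms.
Context {R : realType} {n : nat}.
Implicit Types (S : 'M[R]_n) (u v : 'cV[R]_n).

Definition norm1 u : R := \sum_j `|u j 0|.

Definition bilin S u v : R := (u^T *m S *m v) 0 0.

Lemma norm1_ge0 u : 0 <= norm1 u. Proof. exact: sumr_ge0. Qed.

Lemma norm1D u v : norm1 (u + v) <= norm1 u + norm1 v.
Proof.
by rewrite /norm1 -big_split; apply: ler_sum => j _; rewrite mxE ler_normD.
Qed.

Lemma norm1Z (a : R) u : norm1 (a *: u) = `|a| * norm1 u.
Proof. by rewrite /norm1 mulr_sumr; apply: eq_bigr => j _; rewrite mxE normrM. Qed.

Lemma norm1_mul (W : 'M[R]_n) u : norm1 (W *m u) <= (\sum_i \sum_j `|W i j|) * norm1 u.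
Proof.
rewrite mulr_suml; apply: ler_sum => i _; rewrite mxE mulr_suml.
apply: (le_trans (ler_norm_sum _ _ _)); apply: ler_sum => j _.
by rewrite normrM ler_wpM2l// /norm1 (bigD1 j)//= lerDl sumr_ge0.
Qed.

Lemma norm1_diag (d : 'I_n -> R) (c : R) u : (forall j, `|d j| <= c) ->
  norm1 (\col_j (d j * u j 0)) <= c * norm1 u.
Proof.
move=> dc; rewrite /norm1 mulr_sumr; apply: ler_sum => j _.
by rewrite mxE normrM ler_wpM2r.
Qed.

Lemma bilin_le S u v (c : R) : (forall i j, `|S i j| <= c) ->
  `|bilin S u v| <= c * norm1 u * norm1 v.
Proof.
move=> Sc; rewrite /bilin mxE; apply: (le_trans (ler_norm_sum _ _ _)).
rewrite mulr_sumr; apply: ler_sum => j _; rewrite normrM ler_wpM2r// mxE.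
apply: (le_trans (ler_norm_sum _ _ _)); rewrite mulr_sumr; apply: ler_sum => i _.
by rewrite mxE normrM mulrC ler_wpM2r.
Qed.

Lemma quad_le S u (c : R) : (forall i j, `|S i j| <= c) -> `|quad S u| <= c * norm1 u ^+ 2.
Proof. by move=> Sc; rewrite expr2 mulrA; exact: bilin_le. Qed.

Lemma quad_add S u v : quad S (u + v) = quad S u + bilin S u v + bilin S v u + quad S v.
Proof.
rewrite /quad /bilin trmxD !mulmxDl !mulmxDr !entryD; ring.
Qed.

Lemma bilinDr S u v w : bilin S u (v + w) = bilin S u v + bilin S u w.
Proof. by rewrite /bilin mulmxDr entryD. Qed.

Lemma bilinDl S u v w : bilin S (v + w) u = bilin S v u + bilin S w u.
Proof. by rewrite /bilin trmxD !mulmxDl entryD. Qed.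

Lemma bilinZr S (a : R) u v : bilin S u (a *: v) = a * bilin S u v.
Proof. by rewrite /bilin -scalemxAr entryZ. Qed.

Lemma bilinZl S (a : R) u v : bilin S (a *: v) u = a * bilin S v u.
Proof. by rewrite /bilin trmxZ -!scalemxAl entryZ. Qed.

Lemma quadZ (a : R) S u : quad (a *: S) u = a * quad S u.
Proof. by rewrite /quad -scalemxAr -scalemxAl entryZ. Qed.

Definition mx_bound S : R := \sum_i \sum_j `|S i j|.

Lemma mx_boundP S i j : `|S i j| <= mx_bound S.
Proof.
rewrite /mx_bound (bigD1 i)//= (bigD1 j)//= -addrA lerDl addr_ge0// ?sumr_ge0// => k _.
by rewrite sumr_ge0.
Qed.

Lemma mx_bound_ge0 S : 0 <= mx_bound S.
Proof. by apply: sumr_ge0 => i _; apply: sumr_ge0. Qed.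

Lemma mulmx_entry_le S S' (a a' : R) : (forall i j, `|S i j| <= a) -> (forall i j, `|S' i j| <= a') ->
  forall i j, `|(S *m S') i j| <= n%:R * (a * a').
Proof.
move=> Sa Sa' i j; rewrite mxE; apply: (le_trans (ler_norm_sum _ _ _)).
apply: (@le_trans _ _ (\sum_(l < n) a * a')).
  by apply: ler_sum => l _; rewrite normrM ler_pM.
by rewrite sumr_const card_ord mulr_natl.
Qed.

End BilinearForms.

(** * The accumulated covariance and its Lyapunov equation *)

Section LyapunovEquation.
Context {R : realType} {n : nat}.
Variables (W G : 'M[R]_n).
Local Notation B := ((2^-1)%:M - W).
Local Notation E := (semigroup B).

Definition covariance_density (u : R) : 'M[R]_n := (E u)^T *m G *m E u.
Local Notation S := covariance_density.

Lemma density_derive x : is_mxderive x S (- (B^T *m S x + S x *m B)).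
Proof.
have dE : is_mxderive x E (- (B *m E x)).
  by move=> i j; rewrite mxE; exact: is_derive_semigroup.
apply: is_mxderive_eq.
  apply: (is_mxderive_mul _ dE); apply: is_mxderive_mul (is_mxderive_cst _ _).
  exact: (is_mxderive_tr dE).
have cE : B *m E x = E x *m B by exact: semigroup_comm.
rewrite mulmx0 addr0 /S raddfN/= cE trmx_mul !mulNmx mulmxN -opprD.
by rewrite !mulmxA.
Qed.

Lemma continuous_density i j : continuous (fun u => S u i j).
Proof. exact: is_derive_continuous (fun x => density_derive x i j). Qed.

(** A primitive on the whole line stands for the integral, so that [Y] is differentiable by
    construction; the covariance integrals are identified with it when the two regimes are
    concluded. *)
Lemma density_primitive : exists2 Y : R -> 'M[R]_n, Y 0 = 0 & forall x, is_mxderive x Y (S x).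
Proof.
pose y i j := cid2 (antiderivative (@continuous_density i j)).
exists (fun u => \matrix_(i, j) sval (y i j) u).
  by apply/matrixP => i j; rewrite !mxE; case: (y i j).
move=> x i j; rewrite (_ : (fun u => _) = sval (y i j)); first by case: (y i j).
by apply/funext => u; rewrite mxE.
Qed.

Variable Y : R -> 'M[R]_n.
Hypothesis Y0 : Y 0 = 0.
Hypothesis dY : forall x, is_mxderive x Y (S x).

Lemma density0 : S 0 = G.
Proof. by rewrite /S semigroup0 trmx1 mul1mx mulmx1. Qed.

(** The right side has derivative zero, because [Y' = S] makes its last two terms cancel
    [S' = - (B^T S + S B)], and it equals [G] at 0. *)
Lemma lyapunov_equation x : G = S x + B^T *m Y x + Y x *m B.
Proof.
pose F (u : R) := S u + B^T *m Y u + Y u *m B.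
have dF u : is_mxderive u F 0.
  apply: is_mxderive_eq.
    apply: is_mxderiveD; first apply: is_mxderiveD.
    - exact: density_derive.
    - exact: is_mxderive_mul (is_mxderive_cst _ _) (dY u).
    - exact: is_mxderive_mul (dY u) (is_mxderive_cst _ _).
  by rewrite mul0mx mulmx0 add0r addr0 -addrA addNr.
apply/matrixP => i j; rewrite -[RHS]/(F x i j).
have d0 u : is_derive u (1 : R) (fun u => F u i j) 0 by have := dF u i j; rewrite mxE.
by rewrite (is_derive_0_is_cst _ 0 d0) /F Y0 mulmx0 mul0mx !addr0 density0.
Qed.

(** By the mean value theorem the form of [Y L] at [u] is [L] times that of [S c], which is the form
    of [G] at [E c *m u]. *)
Lemma primitive_psd L u : 0 <= L -> (forall v, 0 <= quad G v) -> 0 <= quad (Y L) u.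
Proof.
move=> L0 psdG.
have dq x : is_derive x (1 : R) (fun y => quad (Y y) u) (quad (S x) u).
  have H : is_mxderive x (fun y => u^T *m Y y *m u) (u^T *m S x *m u).
    apply: is_mxderive_eq.
      apply: is_mxderive_mul (is_mxderive_cst _ _).
      exact: is_mxderive_mul (is_mxderive_cst _ _) (dY x).
    by rewrite mul0mx add0r mulmx0 addr0.
  exact: H.
have [c _] := mean_value dq L0.
rewrite {2}/quad Y0 mulmx0 mul0mx mxE !subr0 => ->; apply: mulr_ge0 => //.
have -> : quad (S c) u = quad G (E c *m u) by rewrite /quad /S trmx_mul !mulmxA.
exact: psdG.
Qed.

Lemma primitive_sym L : G^T = G -> (Y L)^T = Y L.
Proof.
move=> symG; apply/matrixP => i j; rewrite mxE.
have d0 x : is_derive x (1 : R) (fun y => Y y j i - Y y i j) 0.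
  apply: is_derive_eq; first exact: (is_deriveB (dY x j i) (dY x i j)).
  have : (S x)^T = S x by rewrite /S !trmx_mul trmxK symG mulmxA.
  by move/matrixP => /(_ i j); rewrite mxE => ->; rewrite subrr.
apply/eqP; rewrite -subr_eq0; apply/eqP.
by rewrite (is_derive_0_is_cst L 0 d0) Y0 !mxE subrr.
Qed.

Variable C : R.
Hypothesis EC : forall tau i j, 0 <= tau -> `|E tau i j| <= C.

Lemma density_bounded : exists2 D, 0 <= D & forall x i j, 0 <= x ->
  `|S x i j| <= D /\ `|(B^T *m S x + S x *m B) i j| <= D.
Proof.
pose g := mx_bound G; pose bb := mx_bound B.
pose D1 := n%:R * (n%:R * (`|C| * g) * `|C|).
have D10 : 0 <= D1 by rewrite !mulr_ge0// mx_bound_ge0.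
have ES x i j : 0 <= x -> `|S x i j| <= D1.
  move=> x0; have EC' k l : `|E x k l| <= `|C| by apply: le_trans (ler_norm _); exact: EC.
  apply: mulmx_entry_le => // k l; apply: mulmx_entry_le; last exact: mx_boundP.
  by move=> p r; rewrite mxE.
exists (D1 + n%:R * (bb * D1) + n%:R * (D1 * bb)).
  by rewrite !addr_ge0// ?mulr_ge0// mx_bound_ge0.
have nn : 0 <= n%:R * (bb * D1) by rewrite !mulr_ge0// mx_bound_ge0.
move=> x i j x0; split.
  by apply: (le_trans (ES x i j x0)); rewrite [D1 * bb]mulrC; lra.
rewrite mxE; apply: (le_trans (ler_normD _ _)); rewrite -addrA.
apply: ler_wpDl => //; apply: lerD; apply: mulmx_entry_le => //= k l; try exact: ES.
  by rewrite mxE; exact: mx_boundP.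
exact: mx_boundP.
Qed.

Lemma primitive_bounded : exists2 D, 0 <= D & forall x i j, 0 <= x -> `|Y x i j| <= D * x.
Proof.
have [D D0 HD] := density_bounded; exists D => // x i j x0.
have [c /andP[c0 _] e] := mean_value (fun x => dY x i j) x0.
move: e; rewrite Y0 mxE !subr0 => ->.
by rewrite normrM (ger0_norm x0) ler_wpM2r//; have [] := HD c i j c0.
Qed.

Lemma primitive_increment : exists2 D, 0 <= D & forall x h i j, 0 <= x -> 0 <= h ->
  `|(Y (x + h) - Y x - h *: S x) i j| <= D * h ^+ 2.
Proof.
have [D D0 HD] := density_bounded; exists D => // x h i j x0 h0.
have SL y : x <= y -> `|S y i j - S x i j| <= D * (y - x).
  move=> xy; have [c /andP[xc _] ->] := mean_value (fun x => density_derive x i j) xy.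
  rewrite normrM (ger0_norm (_ : 0 <= y - x)) ?subr_ge0// ler_wpM2r ?subr_ge0//.
  by rewrite mxE normrN; have [] := HD c i j (le_trans x0 xc).
have dg y : is_derive y (1 : R) (fun y => Y y i j + (- S x i j) * y) (S y i j - S x i j).
  have d1 := is_deriveMl (- S x i j) (is_derive_id y (1 : R)).
  by rewrite mulr1 in d1; exact: (is_deriveD (dY y i j) d1).
have xh : x <= x + h by rewrite lerDl.
have [c /andP[xc ch] e] := mean_value dg xh.
have -> : (Y (x + h) - Y x - h *: S x) i j = (S c i j - S x i j) * h.
  have hE : x + h - x = h by ring.
  by rewrite hE in e; rewrite -e !mxE; ring.
rewrite normrM (ger0_norm h0) expr2 mulrA ler_wpM2r//.
by apply: (le_trans (SL c xc)); rewrite ler_wpM2l//; lra.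
Qed.

End LyapunovEquation.

Section DriftStep.
Context {R : realType} {n : nat}.
Variables (W G : 'M[R]_n) (c : 'I_n -> R).
Hypothesis c0 : forall i, 0 <= c i.
Implicit Types (u : 'cV[R]_n) (t : nat).

(** One step seen from the test vectors: [x (I + D_t W)] paired with [u] is [x] paired with
    [(I + D_t W) u]. *)
Definition drift_step t u : 'cV[R]_n := u + \col_i ((W *m u) i 0 / (t%:R + c i)).

Lemma drift_step_expansion : exists2 D, 0 <= D & forall t u, (0 < t)%N ->
  exists2 dl, drift_step t u = u + (t%:R^-1 *: (W *m u) + dl) &
    norm1 dl <= D / t%:R ^+ 2 * norm1 u.
Proof.
pose cm := \sum_i c i; pose om := \sum_i \sum_j `|W i j|.
have cm0 : 0 <= cm by exact: sumr_ge0.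
have om0 : 0 <= om by apply: sumr_ge0 => i _; exact: sumr_ge0.
exists (cm * om); first exact: mulr_ge0.
move=> t u t0; have tr : 1 <= t%:R :> R by rewrite ler1n.
pose d i : R := (t%:R + c i)^-1 - t%:R^-1.
exists (\col_i (d i * (W *m u) i 0)).
  congr (u + _); apply/matrixP => i j; rewrite ord1 !mxE /d; ring.
have dle i : `|d i| <= cm / t%:R ^+ 2.
  have tc : 0 < t%:R + c i by have := c0 i; lra.
  have -> : d i = - (c i / (t%:R * (t%:R + c i))) by rewrite /d; field; lra.
  rewrite normrN ger0_norm; last by rewrite divr_ge0 ?mulr_ge0//; lra.
  apply: ler_pM => //; first by rewrite invr_ge0 mulr_ge0//; lra.
    by rewrite /cm (bigD1 i)//= lerDl sumr_ge0.
  rewrite lef_pV2 ?posrE ?mulr_gt0 ?exprn_gt0//; try lra.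
  by rewrite expr2 ler_wpM2l//; have := c0 i; lra.
apply: (le_trans (norm1_diag _ dle)).
have -> : cm * om / t%:R ^+ 2 * norm1 u = cm / t%:R ^+ 2 * (om * norm1 u) by ring.
by rewrite ler_wpM2l ?divr_ge0 ?sqr_ge0// norm1_mul.
Qed.

Section PrimitiveStep.
Local Notation B := ((2^-1)%:M - W).
Variable Y : R -> 'M[R]_n.
Hypothesis Y0 : Y 0 = 0.
Hypothesis dY : forall x, is_mxderive x Y (covariance_density W G x).
Variable C : R.
Hypothesis EC : forall tau i j, 0 <= tau -> `|semigroup B tau i j| <= C.

Lemma ln_nat_ge0 t : 0 <= ln t%:R :> R.
Proof. by case: t => [|t]; [rewrite ln0|rewrite ln_ge0// ler1n]. Qed.

(** The leading terms cancel by the Lyapunov equation at [ln t], since [h = ln (t+1) - ln t] lies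
    between [1/(t+1)] and [1/t]. The logarithm in the bound comes from [Y (ln t)], which grows at
    most linearly in its argument. *)
Lemma quad_primitive_step : exists2 K, 0 <= K & forall t u, (0 < t)%N ->
  `|quad G u + t%:R * quad (Y (ln t%:R)) (drift_step t u) - t.+1%:R * quad (Y (ln t.+1%:R)) u|
  <= K * ((1 + ln t%:R) / t%:R) * norm1 u ^+ 2.
Proof.
have [D1 D10 H1] := primitive_increment dY EC.
have [D2 D20 H2] := primitive_bounded Y0 dY EC.
have [D3 D30 H3] := density_bounded G EC.
have [D D0 HD] := drift_step_expansion.
pose om := \sum_i \sum_j `|W i j|.
have om0 : 0 <= om by apply: sumr_ge0 => i _; exact: sumr_ge0.
exists (D3 + 2 * D1 + D2 * (2 * D + (om + D) ^+ 2)).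
  have sq := sqr_ge0 (om + D).
  have : 0 <= D2 * (2 * D + (om + D) ^+ 2) by apply: mulr_ge0 => //; lra.
  by lra.
move=> t u t0; have tr : 1 <= t%:R :> R by rewrite ler1n.
have tp : 0 < t%:R :> R by lra.
have [dl stepE dlN] := HD t u t0.
set l := ln t%:R; have l0 : 0 <= l by exact: ln_nat_ge0.
pose h := ln t.+1%:R - l; have lh : ln t.+1%:R = l + h by rewrite /h addrC subrK.
have h1 : t.+1%:R^-1 <= h by exact: ln_step_ge.
have [_ h2] := @ln_step R _ t0; rewrite -/l -/h in h2.
have t1 : t.+1%:R = t%:R + 1 :> R by rewrite -natr1.
have h0 : 0 <= h by apply: le_trans h1; rewrite invr_ge0.
set w := W *m u in stepE *.
pose Q := Y (l + h) - Y l - h *: covariance_density W G l.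
have QN : `|quad Q u| <= D1 * h ^+ 2 * norm1 u ^+ 2 by apply: quad_le => i j; exact: H1.
have SN : `|quad (covariance_density W G l) u| <= D3 * norm1 u ^+ 2.
  by apply: quad_le => i j; have [] := H3 l i j l0.
have Yb i j : `|Y l i j| <= D2 * l by exact: H2.
have YhE : quad (Y (l + h)) u = quad (Y l) u + h * quad (covariance_density W G l) u + quad Q u.
  have -> : Y (l + h) = Y l + h *: covariance_density W G l + Q by apply/matrixP => i j; rewrite !mxE; ring.
  by rewrite !quadD quadZ.
have GE : quad G u = quad (covariance_density W G l) u + quad (Y l) u
    - bilin (Y l) w u - bilin (Y l) u w.
  rewrite {1}(lyapunov_equation Y0 dY l) !quadD.
  have -> : quad (B^T *m Y l) u = bilin (Y l) (B *m u) u by rewrite /quad /bilin trmx_mul !mulmxA.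
  have -> : quad (Y l *m B) u = bilin (Y l) u (B *m u) by rewrite /quad /bilin !mulmxA.
  have -> : B *m u = 2^-1 *: u + (-1) *: w by rewrite mulmxBl mul_scalar_mx scaleN1r.
  rewrite bilinDl bilinDr !bilinZl !bilinZr -/(quad _ u).
  have -> : bilin (Y l) u u = quad (Y l) u by [].
  by field.
pose v := t%:R^-1 *: w + dl.
have vN : norm1 v <= (om + D) / t%:R * norm1 u.
  apply: (le_trans (norm1D _ _)); rewrite norm1Z ger0_norm ?invr_ge0 ?(ltW tp)//.
  rewrite mulrDl mulrDl; apply: lerD.
    by rewrite [om / _]mulrC -mulrA ler_wpM2l ?invr_ge0 ?(ltW tp)//; exact: norm1_mul.
  apply: (le_trans dlN); rewrite ler_wpM2r ?norm1_ge0// ler_wpM2l//.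
  by rewrite lef_pV2 ?posrE ?exprn_gt0// expr2 ler_peMr//; lra.
have N0 := norm1_ge0 u; set N := norm1 u in N0 QN SN dlN vN *.
rewrite lh stepE -/v quad_add bilinDl bilinDr bilinZl bilinZr YhE GE t1.
have b1 : `|bilin (Y l) u dl| <= D2 * l * N * (D / t%:R ^+ 2 * N).
  by apply: (le_trans (bilin_le _ _ Yb)); rewrite ler_wpM2l// !mulr_ge0.
have b2 : `|bilin (Y l) dl u| <= D2 * l * (D / t%:R ^+ 2 * N) * N.
  by apply: (le_trans (bilin_le _ _ Yb)); rewrite ler_wpM2r// ler_wpM2l// mulr_ge0.
have b3 : `|quad (Y l) v| <= D2 * l * ((om + D) / t%:R * N) ^+ 2.
  apply: (le_trans (quad_le _ Yb)); rewrite ler_wpM2l ?mulr_ge0//.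
  by rewrite lerXn2r ?nnegrE ?norm1_ge0// (le_trans (norm1_ge0 v) vN).
have e1 : `|1 - (t%:R + 1) * h| <= t%:R^-1.
  have a1 : (t%:R + 1) * h <= 1 + t%:R^-1.
    apply: (le_trans (ler_wpM2l (_ : 0 <= t%:R + 1) h2)); first by lra.
    by rewrite mulrDl mulfV ?mul1r// gt_eqF.
  have a2 : 1 <= (t%:R + 1) * h.
    by move: h1; rewrite t1 -ler_pdivrMl ?mulr1//; lra.
  by rewrite ler_norml; apply/andP; split; lra.
have e2 : (t%:R + 1) * h ^+ 2 <= 2 / t%:R.
  have : h ^+ 2 <= t%:R^-1 ^+ 2 by rewrite lerXn2r ?nnegrE ?invr_ge0// ltW.
  move=> hh; apply: (@le_trans _ _ ((2 * t%:R) * t%:R^-1 ^+ 2)).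
    by apply: ler_pM => //; rewrite ?sqr_ge0//; lra.
  by rewrite le_eqVlt; apply/orP; left; apply/eqP; field; lra.
set S := quad (covariance_density W G l) u in SN *.
set y := quad (Y l) u; set a1 := bilin (Y l) u w; set a2 := bilin (Y l) w u.
set a3 := bilin (Y l) u dl in b1 *; set a4 := bilin (Y l) dl u in b2 *.
set z := quad (Y l) v in b3 *; set r := quad Q u in QN *.
(* Three residues remain: the rounding [1 - (t+1) h], the second-order part of the drift step, and
   the Taylor remainder of [Y]. *)
have -> : S + y - a2 - a1 + t%:R * (y + (t%:R^-1 * a1 + a3) + (t%:R^-1 * a2 + a4) + z)
   - (t%:R + 1) * (y + h * S + r) =
   (1 - (t%:R + 1) * h) * S + (t%:R * (a3 + a4 + z) - (t%:R + 1) * r) by field; lra.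
apply: (le_trans (ler_normD _ _)).
have B1 : `|(1 - (t%:R + 1) * h) * S| <= t%:R^-1 * (D3 * N ^+ 2) by rewrite normrM ler_pM.
have B2 : `|(t%:R + 1) * r| <= 2 / t%:R * (D1 * N ^+ 2).
  rewrite normrM ger0_norm; last by lra.
  apply: (@le_trans _ _ ((t%:R + 1) * (D1 * h ^+ 2 * N ^+ 2))).
    by rewrite ler_wpM2l//; lra.
  have -> : (t%:R + 1) * (D1 * h ^+ 2 * N ^+ 2) = (t%:R + 1) * h ^+ 2 * (D1 * N ^+ 2) by ring.
  by rewrite ler_wpM2r// mulr_ge0// sqr_ge0.
have B3 : `|t%:R * (a3 + a4 + z)| <= D2 * (2 * D + (om + D) ^+ 2) * (l / t%:R) * N ^+ 2.
  rewrite normrM ger0_norm ?(ltW tp)//.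
  apply: (@le_trans _ _ (t%:R * (D2 * l * N * (D / t%:R ^+ 2 * N) + D2 * l * (D / t%:R ^+ 2 * N) * N
    + D2 * l * ((om + D) / t%:R * N) ^+ 2))).
    rewrite ler_wpM2l ?(ltW tp)//; apply: (le_trans (ler_normD _ _)); apply: lerD => //.
    by apply: (le_trans (ler_normD _ _)); apply: lerD.
  by rewrite le_eqVlt; apply/orP; left; apply/eqP; field; lra.
have B4 := ler_normB (t%:R * (a3 + a4 + z)) ((t%:R + 1) * r).
apply: (@le_trans _ _ ((D3 + 2 * D1) * t%:R^-1 * N ^+ 2 + D2 * (2 * D + (om + D) ^+ 2) * (l / t%:R) * N ^+ 2)).
  by lra.
have ti : 0 <= t%:R^-1 :> R by rewrite invr_ge0 ltW.
have N2 := sqr_ge0 N.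
have m1 : 0 <= (D3 + 2 * D1) * (l / t%:R) * N ^+ 2.
  by rewrite !mulr_ge0 ?divr_ge0 ?addr_ge0 ?mulr_ge0.
have m2 : 0 <= D2 * (2 * D + (om + D) ^+ 2) * t%:R^-1 * N ^+ 2.
  have sq := sqr_ge0 (om + D).
  by rewrite !mulr_ge0// addr_ge0// mulr_ge0.
rewrite (mulrDl 1 l) mul1r; lra.
Qed.

End PrimitiveStep.
End DriftStep.

(** * Solving the recursions for moments and characteristic functions *)

Section CharacteristicRecursion.
Context {R : realType} {n : nat}.
Variables (W G : 'M[R]_n) (c : 'I_n -> R).
Hypothesis c0 : forall i, 0 <= c i.
Implicit Types (u : 'cV[R]_n) (t : nat).

Variables (N : 'cV[R]_n -> R) (w D : R).
Hypothesis driftN : drift_norm W N w D.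

(** In dimension 0 the coordinate bound says nothing, and subadditivity at [u = u + u] takes its
    place. *)
Lemma drift_norm_ge0 u : 0 <= N u.
Proof.
case: driftN => _ ND Nj _ _.
have [j _|n0] := pickP (predT : pred 'I_n); first by apply: le_trans (Nj u j).
have e : u = u + u by apply/matrixP => i; have := n0 i.
by have := ND u u; rewrite -e; lra.
Qed.

Lemma norm1_le_drift u : norm1 u <= n%:R * N u.
Proof.
case: driftN => _ _ Nj _ _; rewrite mulr_natl -[n in X in _ <= X]card_ord -sumr_const.
by apply: ler_sum => j _.
Qed.

Lemma drift_norm_step : exists2 C, 0 <= C & forall t u, (0 < t)%N ->
  N (drift_step W c t u) <= growth w C t * N u.
Proof.
have [E E0 HE] := drift_step_expansion W c0.
case: (driftN) => D0 ND _ NC NW.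
exists (D + D * (E * n%:R)); first by rewrite addr_ge0 ?mulr_ge0.
move=> t u t0; have [dl -> dlN] := HE t u t0.
have tp : 0 < t%:R :> R by rewrite ltr0n.
rewrite addrA; apply: (le_trans (ND _ _)).
have ti : 0 <= t%:R^-1 :> R by rewrite invr_ge0 ltW.
have H1 := NW _ u ti.
have H2 : N dl <= D * (E / t%:R ^+ 2 * (n%:R * N u)).
  apply: (le_trans (NC dl)); rewrite ler_wpM2l//; apply: (le_trans dlN).
  by rewrite ler_wpM2l ?norm1_le_drift// divr_ge0 ?sqr_ge0.
apply: (le_trans (lerD H1 H2)); rewrite /growth le_eqVlt; apply/orP; left; apply/eqP.
by field; rewrite gt_eqF.
Qed.

Variable C : R.
Hypothesis w0 : 0 <= w.
Hypothesis C0 : 0 <= C.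
Hypothesis NC : forall t u, (0 < t)%N -> N (drift_step W c t u) <= growth w C t * N u.

(** The induction runs over all [u] at once, since a step replaces [u] by its drifted image; the
    factors [n] convert [norm1] into [N]. *)
Lemma second_moment_bound (V : nat -> 'cV[R]_n -> R) (x K : R) : 0 <= K -> 0 <= x ->
  (forall u, V 1%N u <= x * norm1 u ^+ 2) ->
  (forall t u, (0 < t)%N -> V t.+1 u <= V t (drift_step W c t u) + K * norm1 u ^+ 2) ->
  forall t u, (0 < t)%N ->
    V t u <= growth_rec w C 2 (fun=> K * n%:R ^+ 2) (x * n%:R ^+ 2) t * N u ^+ 2.
Proof.
move=> K0 x0 V1 VS; have nn : 0 <= n%:R :> R by [].
have sqN u : norm1 u ^+ 2 <= n%:R ^+ 2 * N u ^+ 2.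
  by rewrite -exprMn lerXn2r ?nnegrE ?norm1_ge0 ?mulr_ge0 ?drift_norm_ge0 ?norm1_le_drift.
set f := growth_rec _ _ _ _ _.
have f0 t : 0 <= f t by apply: growth_rec_ge0 => // [_|]; rewrite mulr_ge0 ?sqr_ge0.
case=> // t u _; elim: t u => [|t ih] u.
  apply: (le_trans (V1 u)); apply: (@le_trans _ _ (x * n%:R ^+ 2 * N u ^+ 2)).
    by rewrite -mulrA ler_wpM2l.
  rewrite ler_wpM2r ?sqr_ge0// /f /=.
  apply: (@le_trans _ _ (growth w C 0 ^+ 2 * (x * n%:R ^+ 2))).
    rewrite ler_peMl ?mulr_ge0 ?sqr_ge0//.
    by rewrite exprn_ege1// growth_ge1.
  by rewrite lerDl mulr_ge0 ?sqr_ge0.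
apply: (le_trans (VS _ u (ltn0Sn t))).
have H : V t.+1 (drift_step W c t.+1 u) <= f t.+1 * (growth w C t.+1 * N u) ^+ 2.
  apply: (le_trans (ih _)); rewrite ler_wpM2l// lerXn2r ?nnegrE ?drift_norm_ge0//.
    by rewrite mulr_ge0 ?growth_ge0 ?drift_norm_ge0.
  exact: NC.
apply: (le_trans (lerD H (ler_wpM2l K0 (sqN u)))).
have fS : f t.+2 = growth w C t.+1 ^+ 2 * f t.+1 + K * n%:R ^+ 2 by [].
by rewrite fS le_eqVlt; apply/orP; left; apply/eqP; ring.
Qed.

Local Notation B := ((2^-1)%:M - W).
Variable Y : R -> 'M[R]_n.
Hypothesis Y0 : Y 0 = 0.
Hypothesis dY : forall x, is_mxderive x Y (covariance_density W G x).
Variable CE : R.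
Hypothesis EC : forall tau i j, 0 <= tau -> `|semigroup B tau i j| <= CE.
Hypothesis G_psd : forall u, 0 <= quad G u.

Lemma expRN_lip (x y : R) : 0 <= x -> 0 <= y -> `|expR (- x) - expR (- y)| <= `|x - y|.
Proof.
wlog xy : x y / x <= y.
  move=> H x0 y0; have [xy|/ltW yx] := leP x y; first exact: H.
  by rewrite distrC [leRHS]distrC; exact: H.
move=> x0 y0; rewrite distrC [`|x - y|]distrC [leRHS]ger0_norm ?subr_ge0//.
rewrite distrC ger0_norm ?subr_ge0 ?ler_expR ?lerN2//.
have -> : expR (- y) = expR (- x) * expR (- (y - x)) by rewrite -expRD; congr expR; ring.
have -> : expR (- x) - expR (- x) * expR (- (y - x)) = expR (- x) * (1 - expR (- (y - x))) by ring.
have e1 : expR (- x) <= 1 by rewrite -expR0 ler_expR oppr_le0.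
have e2 : 1 - expR (- (y - x)) <= y - x by have := expR_ge1Dx (- (y - x)); lra.
have e3 : 0 <= 1 - expR (- (y - x)) by rewrite subr_ge0 -expR0 ler_expR oppr_le0 subr_ge0.
by apply: le_trans e2; rewrite ler_piMl.
Qed.

Lemma cvg_log_ratio : (1 + ln t%:R) / t%:R @[t --> \oo] --> (0 : R).
Proof.
apply: (@squeeze_cvgr _ _ _ _ (fun=> 0) (fun t => 3 * (Num.sqrt t%:R)^-1)); last 2 first.
- exact: cvg_cst.
- rewrite -[X in _ --> X](mulr0 3); apply: cvgM; [exact: cvg_cst|exact: cvg_inv_sqrt].
near=> t; have t0 : (0 < t)%N by near: t; exact: nbhs_infty_gt.
have tr : 1 <= t%:R :> R by rewrite ler1n.
have l0 := @ln_nat_ge0 R t.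
apply/andP; split; first by rewrite divr_ge0//; lra.
set s := Num.sqrt t%:R; have s1 : 1 <= s by rewrite /s -[leLHS]sqrtr1 ler_wsqrtr.
have s2 : t%:R = s * s :> R by rewrite -expr2 sqr_sqrtr.
have ls : ln s < s by apply: ln_sublinear; lra.
rewrite s2 lnM ?posrE; try lra.
rewrite ler_pdivrMr ?mulr_gt0; try lra.
have -> : 3 / s * (s * s) = 3 * s by field; lra.
by lra.
Unshelve. all: by end_near. Qed.

(** The characteristic function, with phase, of the centred normal law of covariance [t Y (ln t)],
    the candidate for the law at time [t]. At [t = 1] it is [cos th]. *)
Let g t u th : R := expR (- (t%:R * quad (Y (ln t%:R)) u / 2)) * cos th.

(** Degree 1 carries the mismatch at time 1, degree 2 the errors [e] and that of
    [quad_primitive_step], degree 3 the Taylor remainder. As the Gaussian factor is at most 1, old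
    errors grow by the drift alone. *)
Lemma characteristic_bound (phi : nat -> 'cV[R]_n -> R -> R) (r K : R) (e : nat -> R) :
  0 <= r -> 0 <= K -> (forall t, 0 <= e t) -> e t @[t --> \oo] --> 0 ->
  (forall u th, `|phi 1%N u th - cos th| <= r * norm1 u) ->
  (forall t u th, (0 < t)%N -> `|phi t.+1 u th - expR (- (quad G u / 2)) * phi t (drift_step W c t u) th|
     <= e t * norm1 u ^+ 2 + K * norm1 u ^+ 3) ->
  exists (eps : nat -> R) (r' K' : R), [/\ 0 <= r', 0 <= K', forall t, 0 <= eps t, eps t @[t --> \oo] --> 0 &
    forall t u th, (0 < t)%N -> `|phi t u th - g t u th| <=
      growth_rec w C 1 (fun=> 0) r' t * N u + growth_rec w C 2 eps 0 t * N u ^+ 2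
      + growth_rec w C 3 (fun=> K') 0 t * N u ^+ 3].
Proof.
move=> r0 K0 e0 ec phi1 phiS; have nn : 0 <= n%:R :> R by [].
have [K1 K10 HK1] := quad_primitive_step c0 Y0 dY EC.
pose eps t := (e t + K1 / 2 * ((1 + ln t%:R) / t%:R)) * n%:R ^+ 2.
have lt0 t : 0 <= (1 + ln t%:R) / t%:R :> R by rewrite divr_ge0// addr_ge0 ?ln_nat_ge0.
have eps0 t : 0 <= eps t by apply: mulr_ge0 (sqr_ge0 _); apply: addr_ge0 => //; apply: mulr_ge0 => //; exact: divr_ge0.
exists eps, (r * n%:R), (K * n%:R ^+ 3); split => //; try by rewrite mulr_ge0 ?exprn_ge0.
  rewrite -[X in _ --> X](mul0r (n%:R ^+ 2)); apply: cvgM; last exact: cvg_cst.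
  rewrite -[X in _ --> X](addr0 0); apply: cvgD => //.
  rewrite -[X in _ --> X](mulr0 (K1 / 2)); apply: cvgM; first exact: cvg_cst.
  exact: cvg_log_ratio.
have N0 := drift_norm_ge0; have Nn := norm1_le_drift.
have pw k u : norm1 u ^+ k <= n%:R ^+ k * N u ^+ k.
  by rewrite -exprMn lerXn2r ?nnegrE ?norm1_ge0 ?mulr_ge0.
set f1 := growth_rec _ _ 1 _ _; set f2 := growth_rec _ _ 2 _ _; set f3 := growth_rec _ _ 3 _ _.
have f10 t : 0 <= f1 t by apply: growth_rec_ge0 => //; rewrite mulr_ge0.
have f20 t : 0 <= f2 t by apply: growth_rec_ge0.
have f30 t : 0 <= f3 t by apply: growth_rec_ge0 => // _; rewrite mulr_ge0 ?exprn_ge0.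
case=> // t u th _; elim: t u th => [|t ih] u th.
  rewrite /g ln1 Y0 /quad mulmx0 mul0mx mxE mulr0 mul0r oppr0 expR0 mul1r.
  apply: (le_trans (phi1 u th)); apply: (@le_trans _ _ (r * n%:R * N u)).
    by rewrite -mulrA ler_wpM2l.
  apply: (@le_trans _ _ (f1 1%N * N u)).
    rewrite ler_wpM2r// /f1 /= addr0 expr1 ler_peMl ?mulr_ge0// growth_ge1//.
  by rewrite -addrA lerDl addr_ge0 ?mulr_ge0 ?exprn_ge0.
pose v := drift_step W c t.+1 u; pose q := expR (- (quad G u / 2)).
have q0 : 0 <= q by exact: expR_ge0.
have q1 : q <= 1 by rewrite /q -[leRHS]expR0 ler_expR oppr_le0 divr_ge0.
have -> : phi t.+2 u th - g t.+2 u th = (phi t.+2 u th - q * phi t.+1 v th) +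
   q * (phi t.+1 v th - g t.+1 v th) + (q * g t.+1 v th - g t.+2 u th) by ring.
have A1 := phiS _ u th (ltn0Sn t).
have Nv : N v <= growth w C t.+1 * N u by exact: NC.
have A2 : `|q * (phi t.+1 v th - g t.+1 v th)| <= f1 t.+1 * (growth w C t.+1 * N u)
    + f2 t.+1 * (growth w C t.+1 * N u) ^+ 2 + f3 t.+1 * (growth w C t.+1 * N u) ^+ 3.
  rewrite normrM (ger0_norm q0); apply: (@le_trans _ _ `|phi t.+1 v th - g t.+1 v th|).
    by rewrite ler_piMl.
  have gN0 : 0 <= growth w C t.+1 * N u by rewrite mulr_ge0 ?growth_ge0.
  apply: (le_trans (ih v th)); rewrite !lerD// ler_wpM2l// lerXn2r ?nnegrE//.
have A3 : `|q * g t.+1 v th - g t.+2 u th| <= K1 / 2 * ((1 + ln t.+1%:R) / t.+1%:R) * norm1 u ^+ 2.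
  rewrite /q /g mulrA -expRD -mulrBl normrM.
  apply: (@le_trans _ _ `|expR (- (quad G u / 2) - t.+1%:R * quad (Y (ln t.+1%:R)) v / 2) -
       expR (- (t.+2%:R * quad (Y (ln t.+2%:R)) u / 2))|).
    by rewrite ler_piMr// ler_norml cos_geN1 cos_le1.
  have psdY s x : 0 <= t.+1%:R * quad (Y (ln s.+1%:R)) x.
    by rewrite mulr_ge0// (primitive_psd Y0 dY)// ln_nat_ge0.
  have psdY2 : 0 <= t.+2%:R * quad (Y (ln t.+2%:R)) u.
    by rewrite mulr_ge0// (primitive_psd Y0 dY)// ln_nat_ge0.
  rewrite -opprD; apply: (le_trans (expRN_lip _ _)).
  - by rewrite addr_ge0 ?divr_ge0.
  - by rewrite divr_ge0.
  have -> : quad G u / 2 + t.+1%:R * quad (Y (ln t.+1%:R)) v / 2 - t.+2%:R * quad (Y (ln t.+2%:R)) u / 2 =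
    2^-1 * (quad G u + t.+1%:R * quad (Y (ln t.+1%:R)) v - t.+2%:R * quad (Y (ln t.+2%:R)) u).
    by field.
  rewrite normrM (ger0_norm (_ : 0 <= 2^-1))//.
  have H2 : 0 <= 2^-1 :> R by [].
  apply: (le_trans (ler_wpM2l H2 (HK1 _ u (ltn0Sn t)))).
  by rewrite le_eqVlt; apply/orP; left; apply/eqP; ring.
apply: (le_trans (ler_normD _ _)).
apply: (le_trans (lerD (le_trans (ler_normD _ _) (lerD A1 A2)) A3)).
have E0 : 0 <= e t.+1 + K1 / 2 * ((1 + ln t.+1%:R) / t.+1%:R).
  by apply: addr_ge0 => //; apply: mulr_ge0 => //; exact: divr_ge0.
have P2 := ler_wpM2l E0 (pw 2 u).
have P3 := ler_wpM2l K0 (pw 3 u).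
have fS1 : f1 t.+2 = growth w C t.+1 ^+ 1 * f1 t.+1 + 0 by [].
have fS2 : f2 t.+2 = growth w C t.+1 ^+ 2 * f2 t.+1 + eps t.+1 by [].
have fS3 : f3 t.+2 = growth w C t.+1 ^+ 3 * f3 t.+1 + K * n%:R ^+ 3 by [].
rewrite fS1 fS2 fS3; move: P2 P3; rewrite /eps.
set z := (1 + ln _) / _; lra.
Qed.

(** A test vector of norm at most [k / a t] turns the error of degree [j] into
    [growth_rec / a t ^ j], which [dominating_scale] sends to 0. *)
Lemma characteristic_limit (phi : nat -> 'cV[R]_n -> R -> R) (r K : R) (e a : nat -> R) :
  0 <= r -> 0 <= K -> (forall t, 0 <= e t) -> e t @[t --> \oo] --> 0 ->
  (forall u th, `|phi 1%N u th - cos th| <= r * norm1 u) ->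
  (forall t u th, (0 < t)%N -> `|phi t.+1 u th - expR (- (quad G u / 2)) * phi t (drift_step W c t u) th|
     <= e t * norm1 u ^+ 2 + K * norm1 u ^+ 3) ->
  dominating_scale w C a ->
  forall (u_ : nat -> 'cV[R]_n) (k v th : R),
    (\forall t \near \oo, N (u_ t) <= k / a t) ->
    t%:R * quad (Y (ln t%:R)) (u_ t) @[t --> \oo] --> v ->
    phi t (u_ t) th @[t --> \oo] --> expR (- (v / 2)) * cos th.
Proof.
move=> r0 K0 e0 ec phi1 phiS [a0 s1 s2 s3 _] u_ k v th ua qv.
have [eps [r' [K' [r'0 K'0 eps0 epsc H]]]] := characteristic_bound r0 K0 e0 ec phi1 phiS.
have gc : g t (u_ t) th @[t --> \oo] --> expR (- (v / 2)) * cos th.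
  apply: cvgM; last exact: cvg_cst.
  apply: continuous_cvg; first exact: continuous_expR.
  by apply: cvgN; apply: cvgM => //; exact: cvg_cst.
pose h t := k * (growth_rec w C 1 (fun=> 0) r' t / a t)
  + k ^+ 2 * (growth_rec w C 2 eps 0 t / a t ^+ 2) + k ^+ 3 * (growth_rec w C 3 (fun=> K') 0 t / a t ^+ 3).
have hc : h t @[t --> \oo] --> 0.
  have -> : 0 = k * 0 + k ^+ 2 * 0 + k ^+ 3 * 0 :> R by ring.
  apply: cvgD; [apply: cvgD|]; (apply: cvgM; first exact: cvg_cst).
  - exact: s1.
  - exact: s2.
  - exact: s3.
have dc : g t (u_ t) th - phi t (u_ t) th @[t --> \oo] --> 0.
  apply/cvgrPdist_le => x x0; near=> t.
  have t0 : (0 < t)%N by near: t; exact: nbhs_infty_gt.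
  have at0 : 0 < a t by near: t.
  have uat : N (u_ t) <= k / a t by near: t.
  have ht : `|h t| <= x by near: t; exact: cvg0_near.
  rewrite sub0r normrN distrC; apply: le_trans ht; apply: le_trans (ler_norm _).
  apply: (le_trans (H t (u_ t) th t0)).
  have N0 := drift_norm_ge0 (u_ t).
  have k0 : 0 <= k / a t by apply: le_trans uat.
  have E2 : N (u_ t) ^+ 2 <= (k / a t) ^+ 2 by rewrite lerXn2r ?nnegrE.
  have E3 : N (u_ t) ^+ 3 <= (k / a t) ^+ 3 by rewrite lerXn2r ?nnegrE.
  have g1 := ler_wpM2l (growth_rec_ge0 w0 C0 1 t (fun=> lexx 0) r'0) uat.
  have g2 := ler_wpM2l (growth_rec_ge0 w0 C0 2 t eps0 (lexx 0)) E2.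
  have g3 := ler_wpM2l (growth_rec_ge0 w0 C0 3 t (fun=> K'0) (lexx 0)) E3.
  apply: (le_trans (lerD (lerD g1 g2) g3)); rewrite /h le_eqVlt; apply/orP; left; apply/eqP.
  by field; rewrite gt_eqF.
have -> : (fun t => phi t (u_ t) th) = (fun t => g t (u_ t) th - (g t (u_ t) th - phi t (u_ t) th)).
  by apply/funext => t; ring.
by rewrite -[X in _ --> X]subr0; exact: cvgB.
Unshelve. all: by end_near. Qed.

End CharacteristicRecursion.

(** * The urn process *)

Section BernoulliStep.
Context {R : realType}.

Lemma sin_cos_lip (x h : R) : 0 <= h -> `|cos (x + h) - cos x| <= h /\ `|sin (x + h) - sin x| <= h.
Proof.
move=> h0; have xh : x <= x + h by rewrite lerDl.
have [c _ ec] := mean_value (@is_derive_cos R) xh.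
have [c' _ es] := mean_value (@is_derive_sin R) xh.
have e : x + h - x = h by ring.
rewrite ec es e !normrM !(ger0_norm h0) normrN; split; rewrite ler_piMl//.
  by rewrite ler_norml sin_geN1 sin_le1.
by rewrite ler_norml cos_geN1 cos_le1.
Qed.

Lemma is_derive_shift (f f' : R -> R) (a : R) : (forall x : R, is_derive x (1 : R) f (f' x)) ->
  forall x : R, is_derive x (1 : R) (fun y => f (a + y)) (f' (a + x)).
Proof.
move=> df x; have := df (a + x) => d; apply: is_derive_eq.
by rewrite add0r mulr1.
Qed.

(** The constant 1 instead of [1/6] comes from nested mean value bounds; negative [x] is handled by
    reflecting both [a] and [x]. *)
Lemma cos_taylor3 (a x : R) :
  `|cos (a + x) - (cos a - x * sin a - x ^+ 2 / 2 * cos a)| <= `|x| ^+ 3.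
Proof.
wlog x0 : a x / 0 <= x.
  move=> H; have [x0|/ltW x0] := leP 0 x; first exact: H.
  have := H (- a) (- x); rewrite oppr_ge0 -opprD cosN sinN normrN sqrrN => /(_ x0).
  by rewrite mulrNN cosN.
rewrite (ger0_norm x0).
have dc : forall y : R, is_derive y (1 : R) (fun y => cos (a + y)) (- sin (a + y)).
  exact: is_derive_shift (@is_derive_cos R).
have ds : forall y : R, is_derive y (1 : R) (fun y => sin (a + y)) (cos (a + y)).
  exact: is_derive_shift (@is_derive_sin R).
pose h1 (y : R) := - sin (a + y) + sin a + y * cos a.
pose h (y : R) := cos (a + y) - cos a + y * sin a + y ^+ 2 / 2 * cos a.
have d1 (y : R) : is_derive y (1 : R) h1 (- cos (a + y) + cos a).
  have := ds y => dsy; apply: is_derive_eq.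
  by rewrite /GRing.scale/= ?mulr0 ?mulr1 ?addr0 ?add0r.
have d (y : R) : is_derive y (1 : R) h (h1 y).
  have := dc y => dcy; apply: is_derive_eq.
  by rewrite /h1 /GRing.scale/= ?mulr0 ?mulr1 ?addr0 ?add0r; field.
have h1b y : 0 <= y -> `|h1 y| <= y ^+ 2.
  move=> y0; have [c /andP[c0 cy] e] := mean_value d1 y0.
  have -> : h1 y = h1 y - h1 0 by rewrite /h1 addr0 mul0r; ring.
  rewrite e subr0 normrM (ger0_norm y0) expr2 ler_wpM2r//.
  have [H _] := sin_cos_lip a c0; rewrite addrC distrC; exact: le_trans H cy.
have [c /andP[c0 cx] e] := mean_value d x0.
have -> : cos (a + x) - (cos a - x * sin a - x ^+ 2 / 2 * cos a) = h x - h 0.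
  by rewrite /h addr0 mul0r expr0n/= mul0r mul0r; ring.
rewrite e subr0 normrM (ger0_norm x0) exprSr ler_wpM2r//.
by apply: (le_trans (h1b c c0)); rewrite lerXn2r ?nnegrE.
Qed.

(** The quadratic bound serves small test vectors and the linear one large ones; together they give
    a cubic bound for all. *)
Lemma expRN_taylor2 (y : R) : 0 <= y -> `|expR (- y) - (1 - y)| <= y ^+ 2 /\ `|expR (- y) - (1 - y)| <= y.
Proof.
move=> y0; have e1 := expR_ge1Dx (- y); have e2 := expR_ge1Dx y.
rewrite ger0_norm; last by lra.
have e3 : expR (- y) <= 1 by rewrite -[leRHS]expR0 ler_expR oppr_le0.
split; last by lra.
have : expR (- y) <= (1 + y)^-1 by rewrite expRN lef_pV2 ?posrE ?expR_gt0//; lra.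
have : (1 + y)^-1 <= 1 - y + y ^+ 2.
  rewrite -[leLHS]mul1r ler_pdivrMr; last by lra.
  have := exprn_ge0 3 y0; rewrite (_ : (1 - y + y ^+ 2) * (1 + y) = 1 + y ^+ 3); last by ring.
  by lra.
by lra.
Qed.

Variables (I : finType) (p k : I -> R).
Hypothesis p01 : forall i, 0 <= p i <= 1.

Definition bernoulli_weight i (e : bool) : R := if e then p i else 1 - p i.
Local Notation w := bernoulli_weight.
Local Notation mean := (prod_mean w).

Definition noise (x : {ffun I -> bool}) : R := \sum_i ((x i)%:R - p i) * k i.

Lemma bernoulli_weight_ge0 i e : 0 <= w i e.
Proof. by have /andP[p0 p1] := p01 i; case: e => //=; rewrite subr_ge0. Qed.

Lemma bernoulli_weight_sum1 i : w i true + w i false = 1.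
Proof. by rewrite /w addrC subrK. Qed.

Let g i (e : bool) : R := (e%:R - p i) * k i.

Let g0 i : w i true * g i true + w i false * g i false = 0.
Proof. by rewrite /w /g /=; ring. Qed.

Lemma noise_mean : mean noise = 0.
Proof. exact: (prod_mean_centered bernoulli_weight_sum1 g0). Qed.

Lemma noise_variance : mean (fun x => noise x ^+ 2) = \sum_i p i * (1 - p i) * k i ^+ 2.
Proof.
rewrite (prod_mean_variance bernoulli_weight_sum1 g0); apply: eq_bigr => i _.
by rewrite /w /g /=; ring.
Qed.

Lemma noise_le x : `|noise x| <= \sum_i `|k i|.
Proof.
apply: (le_trans (ler_norm_sum _ _ _)); apply: ler_sum => i _.
rewrite normrM ler_piMl//; have /andP[p0 p1] := p01 i.
by case: (x i); rewrite ler_norml /=; apply/andP; split; lra.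
Qed.

Lemma noise_square a : mean (fun x => (a + noise x) ^+ 2) =
  a ^+ 2 + \sum_i p i * (1 - p i) * k i ^+ 2.
Proof.
rewrite -noise_variance (_ : (fun x => _) = fun x => a ^+ 2 + ((2 * a) * noise x + noise x ^+ 2)).
  by rewrite !prod_meanD prod_mean_cst ?prod_meanZ ?noise_mean ?mulr0 ?add0r//; exact: bernoulli_weight_sum1.
by apply/funext => x; ring.
Qed.

(** The sine term of the expansion has mean zero and the quadratic term yields the variance, which
    leaves the cube of the uniform bound on the noise. *)
Lemma noise_cos a (K : R) : \sum_i `|k i| <= K ->
  `|mean (fun x => cos (a + noise x)) - (1 - (\sum_i p i * (1 - p i) * k i ^+ 2) / 2) * cos a| <= K ^+ 3.
Proof.
move=> kK; rewrite -noise_variance.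
have sum1 := bernoulli_weight_sum1.
have E : mean (fun x => cos a + ((- sin a) * noise x + (- (cos a / 2)) * noise x ^+ 2)) =
    (1 - mean (fun x => noise x ^+ 2) / 2) * cos a.
  rewrite !prod_meanD prod_mean_cst// !prod_meanZ noise_mean; by field.
rewrite -E -mulN1r -prod_meanZ -prod_meanD.
apply: (le_trans (prod_mean_norm bernoulli_weight_ge0 _)).
rewrite -(prod_mean_cst sum1 (K ^+ 3)); apply: prod_mean_le => [|x]; first exact: bernoulli_weight_ge0.
have -> : cos (a + noise x) + - 1 * (cos a + (- sin a * noise x + - (cos a / 2) * noise x ^+ 2)) =
  cos (a + noise x) - (cos a - noise x * sin a - noise x ^+ 2 / 2 * cos a) by field.
apply: (le_trans (cos_taylor3 _ _)); rewrite lerXn2r ?nnegrE//; last exact: le_trans (noise_le x) kK.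
by apply: le_trans kK; exact: sumr_ge0.
Qed.

End BernoulliStep.

Section UrnMeasurability.
Context {R : realType} {nF nS : nat} (U : urn_network R nF nS).
Context {d : measure_display} {T : measurableType d}.
Variable P : probability T R.
Local Notation V := 'I_(nF + nS).
Variable chi : nat -> V -> T -> bool.
Hypothesis draws : urn_draws U chi P.
Local Notation white := (@white R nF nS U d T chi).
Local Notation total := (@Defs.total R nF nS U d T chi).
Local Notation Z := (@Z R nF nS U d T chi).
Local Notation draw_prob := (@draw_prob R nF nS U d T chi).
Local Notation history := (@history R nF nS U d T chi).

(** A draw from [j] adds [m_j] balls to each successor whatever its colour. Hence proportions are
    counts over constants, and counts take finitely many values at each time. *)
Lemma totalE t i w : total t i w = ((W0 U i + B0 U i) + t * mbar U i)%N.
Proof.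
rewrite /Defs.total; elim: t => [|t ih] /=; first by rewrite mul0n addn0.
rewrite addnACA ih -addnA mulSn [(mbar U i + _)%N]addnC; congr (_ + (_ + _))%N.
rewrite -big_split; apply: eq_bigr => j _ /=.
have /subnKC ha := alpha_le U j; have /subnKC hb := beta_le U j.
by case: (chi t.+1 j w) => /=; rewrite !(muln0, muln1, addn0, add0n)// addnC.
Qed.

Lemma total_gt0 t i w : (0 < total t i w)%N.
Proof. by rewrite totalE addn_gt0 T0_gt0. Qed.

Lemma white_le_total t i w : (white t i w <= total t i w)%N.
Proof. exact: leq_addr. Qed.

Lemma Z_ge0 t i w : 0 <= Z t i w.
Proof. by rewrite divr_ge0. Qed.

Lemma Z_le1 t i w : Z t i w <= 1.
Proof. by rewrite ler_pdivrMr ?ltr0n ?total_gt0// mul1r ler_nat white_le_total. Qed.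

Lemma draw_prob01 t i w : 0 <= draw_prob t i w <= 1.
Proof.
have := Z_ge0 t i w; have := Z_le1 t i w; have /andP[] := q_01 U i.
by rewrite /draw_prob; set z := Z _ _ _; move: (q U i) => x; nra.
Qed.

Lemma measurable_indicator t i : measurable_fun setT (fun w => (chi t.+1 i w)%:R : R).
Proof.
rewrite (_ : (fun w => _) = fun w => if chi t.+1 i w then 1 else 0 : R).
  apply: measurable_fun_ifT; [exact: draws.1|exact: measurable_cst|exact: measurable_cst].
by apply/funext => w; case: (chi _ _ _).
Qed.

Lemma measurable_white t i : measurable_fun setT (fun w => (white t i w)%:R : R).
Proof.
elim: t i => [|t ih] i; first exact: measurable_cst.
rewrite (_ : (fun w => _) = fun w => (white t i w)%:R +
    \sum_(j | edge U j i) ((m U j - beta U j)%:R +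
       ((alpha U j)%:R - (m U j - beta U j)%:R) * (chi t.+1 j w)%:R) : R).
  apply: measurable_funD => //; under eq_fun do rewrite big_mkcond.
  apply: measurable_sum => j; case: (edge U j i); last exact: measurable_cst.
  apply: measurable_funD; first exact: measurable_cst.
  by apply: measurable_funM; [exact: measurable_cst|exact: measurable_indicator].
apply/funext => w /=; rewrite natrD natr_sum; congr (_ + _); apply: eq_bigr => j _.
by rewrite natrD !natrM; case: (chi _ _ _) => /=; ring.
Qed.

Lemma measurable_Z t i : measurable_fun setT (Z t i).
Proof.
rewrite (_ : Z t i = fun w => (white t i w)%:R * (W0 U i + B0 U i + t * mbar U i)%:R^-1).
  by apply: measurable_funM; [exact: measurable_white|exact: measurable_cst].
by apply/funext => w; rewrite -(totalE t i w).
Qed.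

Lemma mbounded_Z t i : mbounded (Z t i).
Proof.
by split; [exact: measurable_Z|exists 1 => w; rewrite ger0_norm ?Z_ge0 ?Z_le1].
Qed.

Lemma mbounded_draw_prob t i : mbounded (draw_prob t i).
Proof.
apply: mboundedD; first by apply: mboundedZ; exact: mbounded_Z.
by apply: mboundedZ; apply: mboundedB; [exact: mbounded_cst|exact: mbounded_Z].
Qed.

Definition draw_weight t w i (e : bool) : R := if e then draw_prob t i w else 1 - draw_prob t i w.

Lemma mbounded_draw_weight t i e : mbounded (fun w => draw_weight t w i e).
Proof.
case: e; first exact: mbounded_draw_prob.
by apply: mboundedB; [exact: mbounded_cst|exact: mbounded_draw_prob].
Qed.

Lemma mbounded_prod (I : Type) (s : seq I) (F : I -> T -> R) :
  (forall i, mbounded (F i)) -> mbounded (fun x => \prod_(i <- s) F i x).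
Proof.
move=> bF; elim: s => [|i s ih].
  rewrite (_ : (fun _ => _) = fun=> 1); first exact: mbounded_cst.
  by apply/funext => x; rewrite big_nil.
rewrite (_ : (fun _ => _) = fun x => F i x * \prod_(j <- s) F j x).
  exact: mboundedM.
by apply/funext => x; rewrite big_cons.
Qed.

Lemma mbounded_indic A : measurable A -> mbounded (\1_A : T -> R).
Proof.
move=> mA; split; first exact: measurable_indic.
by exists 1 => w; rewrite indicE; case: (_ \in _) => /=; rewrite ?normr0 ?normr1.
Qed.

Lemma Ex_indic A : measurable A -> Ex P (\1_A) = fine (P A).
Proof. by move=> mA; rewrite /Ex /Rintegral integral_indic// setIT. Qed.

Lemma sigma_algebra_finI (G : set (set T)) (I : eqType) (s : seq I) (F : I -> set T) :
  (forall i, <<s G >> (F i)) -> <<s G >> [set w | forall i, i \in s -> F i w].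
Proof.
have /(sigma_algebraP (fun X _ => @subsetT _ X))[GT _ _ GI] := smallest_sigma_algebra setT G.
move=> GF; elim: s => [|i s ih].
  by rewrite (_ : [set _ | _] = setT)//; apply/seteqP; split.
rewrite (_ : [set _ | _] = F i `&` [set w | forall i, i \in s -> F i w]); first exact: GI.
apply/seteqP; split => [w Fw|w [Fi Fw] j] /=.
  by split=> [|j js]; apply: Fw; rewrite inE ?eqxx// js orbT.
by rewrite inE => /orP[/eqP ->|/Fw].
Qed.

Definition state_event t (s : V -> nat) : set T := [set w | forall i, white t i w = s i].

(** Totals being deterministic, the observed proportions determine the counts, which places events
    on counts in the sigma-algebra generated by proportions. *)
Lemma state_event_history t s : history t (state_event t s).
Proof.
rewrite (_ : state_event t s = [set w | forall i, i \in enum V ->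
    (Z t i @^-1` [set (s i)%:R / (W0 U i + B0 U i + t * mbar U i)%:R]) w]); last first.
  apply/seteqP; split => [w sw i _|w H i] /=; first by rewrite /Z sw totalE.
  have := H i; rewrite mem_enum => /(_ isT) /=; rewrite /Z totalE.
  move=> /(divIf _) e; apply/eqP; rewrite -(eqr_nat R); apply/eqP/e.
  by rewrite pnatr_eq0 -lt0n addn_gt0 T0_gt0.
apply: sigma_algebra_finI => i; apply: sub_sigma_algebra.
exists t, i; split => //=; exists [set (s i)%:R / (W0 U i + B0 U i + t * mbar U i)%:R] => //.
by rewrite setTI.
Qed.

Lemma measurable_state_event t s : measurable (state_event t s).
Proof.
rewrite (_ : state_event t s = \bigcap_(i in [set: V]) ((fun w => (white t i w)%:R : R) @^-1` [set (s i)%:R])).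
  apply: fin_bigcap_measurable => // i _.
  by rewrite -[X in measurable X]setTI; exact: measurable_white.
apply/seteqP; split => [w sw i _|w H i] /=; first by rewrite sw.
by have /eqP := H i I; rewrite eqr_nat => /eqP.
Qed.

Lemma measurable_draw_event t (x : V -> bool) :
  measurable [set w | forall i, i \in [set: V]%SET -> chi t.+1 i w = x i].
Proof.
rewrite (_ : [set _ | _] = \bigcap_(i in [set: V]) (chi t.+1 i @^-1` [set x i])).
  apply: fin_bigcap_measurable => // i _.
  by rewrite -[X in measurable X]setTI; apply: draws.1.
apply/seteqP; split => [w sw i _|w H i] /=; first exact: sw.
by move=> _; exact: H.
Qed.

(** Both sides are expanded over the finitely many states of the counts and outcomes of the draws;
    the conditional law is then read on an event fixing all counts, for the full family of draws. *)
Lemma Ex_draws t (h : (V -> nat) -> {ffun V -> bool} -> R) :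
  Ex P (fun w => h (white t ^~ w) [ffun i => chi t.+1 i w]) =
  Ex P (fun w => prod_mean (draw_weight t w) (h (white t ^~ w))).
Proof.
(* A common bound on all counts at time [t], which makes the state space a finite type. *)
pose K := (\sum_i (W0 U i + B0 U i + t * mbar U i))%N.
have whiteK i w : (white t i w < K.+1)%N.
  rewrite ltnS; apply: (leq_trans (white_le_total t i w)).
  by rewrite totalE /K (bigD1 i)//= leq_addr.
pose S := {ffun V -> 'I_K.+1}; pose st (s : S) : V -> nat := fun i => s i.
pose E (x : {ffun V -> bool}) := [set w | forall i, i \in [set: V]%SET -> chi t.+1 i w = x i].
pose cur w : S := [ffun i => Ordinal (whiteK i w)].
have curE w : st (cur w) = white t ^~ w by apply/funext => i; rewrite /st ffunE.
have pick_state (F : (V -> nat) -> R) w : F (white t ^~ w) = \sum_(s : S) \1_(state_event t (st s)) w * F (st s).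
  rewrite (bigD1 (cur w))//= big1 ?addr0 => [|s sw].
    by rewrite indicE mem_set ?mul1r curE.
  rewrite indicE memNset ?mul0r// => H; move/eqP: sw; apply; apply/ffunP => i.
  by apply/val_inj; rewrite /= ffunE /= H.
have pick_draw (F : {ffun V -> bool} -> R) w : F [ffun i => chi t.+1 i w] = \sum_x \1_(E x) w * F x.
  rewrite (bigD1 [ffun i => chi t.+1 i w])//= big1 ?addr0 => [|x xw].
    by rewrite indicE mem_set ?mul1r// => i _; rewrite ffunE.
  rewrite indicE memNset ?mul0r// => H; move/eqP: xw; apply; apply/ffunP => i.
  by rewrite ffunE H.
have mE x : measurable (E x) by exact: measurable_draw_event.
have mS s : measurable (state_event t (st s)) by exact: measurable_state_event.
transitivity (\sum_(s : S) \sum_x h (st s) x * Ex P (\1_(state_event t (st s) `&` E x))).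
  under [X in Ex P X]funext => w do rewrite (pick_draw (h (white t ^~ w))).
  under [X in Ex P X]funext => w do rewrite (pick_state (fun s => \sum_x \1_(E x) w * h s x)).
  have bi s x : mbounded (\1_(state_event t (st s) `&` E x) : T -> R).
    by apply: mbounded_indic; exact: measurableI.
  have bd s x : mbounded (fun w => h (st s) x * \1_(state_event t (st s) `&` E x) w).
    by apply: mboundedZ; exact: bi.
  under eq_bigr => s _ do under eq_bigr => x _ do rewrite -(ExZ P _ (bi s x)).
  under eq_bigr => s _ do rewrite -Ex_sum//.
  rewrite -Ex_sum; last by move=> s; exact: mbounded_sum.
  congr Ex; apply/funext => w; apply: eq_bigr => s _; rewrite mulr_sumr; apply: eq_bigr => x _.
  by rewrite indicI /= mulrA mulrC.
symmetry.
transitivity (\sum_(s : S) \sum_x h (st s) x * Ex P (fun w => \1_(state_event t (st s)) w * \prod_i draw_weight t w i (x i))).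
  under [X in Ex P X]funext => w do rewrite (pick_state (fun s => prod_mean (draw_weight t w) (h s))).
  have bp (s : S) (x : {ffun V -> bool}) : mbounded (fun w => \1_(state_event t (st s)) w * \prod_i draw_weight t w i (x i)).
    apply: mboundedM; first exact: mbounded_indic.
    by apply: mbounded_prod => i; exact: mbounded_draw_weight.
  under eq_bigr => s _ do under eq_bigr => x _ do rewrite -ExZ//.
  have bz s x := mboundedZ (h (st s) x) (bp s x).
  under eq_bigr => s _ do rewrite -Ex_sum//.
  rewrite -Ex_sum; last by move=> s; exact: mbounded_sum.
  congr Ex; apply/funext => w; apply: eq_bigr => s _; rewrite /prod_mean mulr_sumr; apply: eq_bigr => x _.
  by ring.
apply: eq_bigr => s _; apply: eq_bigr => x _; congr (_ * _).
have [_ cp] := draws.2 t [set: V]%SET x.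
rewrite Ex_indic; last exact: measurableI.
rewrite (cp _ (@state_event_history t (st s))) /Ex /Rintegral; congr fine.
rewrite [RHS]integral_mkcond; apply: eq_integral => w _; rewrite patchE indicE.
case: (w \in _); last by rewrite mul0r.
by rewrite mul1r; congr (_%:E); apply: eq_big => // i; rewrite inE.
Qed.

End UrnMeasurability.

(** A singular matrix has the eigenvalue 0, which caps [lambda_min]. *)
Lemma unitmx_lambda_min (R : realType) n (A : 'M[R]_n) : 0 < lambda_min A -> A \in unitmx.
Proof.
move=> pos; rewrite unitmxE unitfE; apply: contraTneq pos => detA; rewrite -leNgt.
have root0 : (0 : R[i]) \in eigenvalues A.
  rewrite /eigenvalues; case: closed_field_poly_normal => s /= sE.
  suff : root (char_poly (map_mx (real_complex R) A)) 0.
    by rewrite sE (monicP (char_poly_monic _)) scale1r root_prod_XsubC.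
  by apply/rootP; rewrite horner_coef0 char_poly_det det_map_mx detA rmorph0 mulr0.
rewrite /lambda_min; move: (head _ _) => x0; move: root0.
elim: (eigenvalues A) => //= z s ih; rewrite inE big_cons ge_min => /orP[/eqP <-|/ih ->].
  by rewrite lexx.
by rewrite orbT.
Qed.

(** * Linear dynamics of the deviation from equilibrium *)

Section UrnDynamics.
Context {R : realType} {nF nS : nat} (U : urn_network R nF nS).
Context {d : measure_display} {T : measurableType d}.
Variable P : probability T R.
Local Notation V := 'I_(nF + nS).
Variable chi : nat -> V -> T -> bool.
Hypothesis draws : urn_draws U chi P.
Local Notation white := (@white R nF nS U d T chi).
Local Notation total := (@Defs.total R nF nS U d T chi).
Local Notation Z := (@Z R nF nS U d T chi).
Local Notation draw_prob := (@draw_prob R nF nS U d T chi).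
Local Notation flex i := (lshift nS i).

Lemma edge_stubborn j (i : 'I_nS) : edge U j (rshift nF i) = false.
Proof.
apply/negP => e; have [_ H] := flexibleP U (rshift nF i).
by have := H (ex_intro _ j e); rewrite /= ltnNge leq_addr.
Qed.

Lemma mbar_flex_gt0 (i : 'I_nF) : (0 < mbar U (flex i))%N.
Proof.
have [H _] := flexibleP U (flex i); have [j e] := H (ltn_ord i).
by rewrite /mbar (bigD1 j)//= addn_gt0 m_gt0.
Qed.

Lemma AtildeE j l : Atilde U j l =
  (m U j)%:R * (edge U j l)%:R * (if (l < nF)%N then (mbar U l)%:R^-1 else 0).
Proof. by rewrite /Atilde /Mmx /Mbar_inv mul_mx_diag mul_diag_mx !mxE. Qed.

Lemma WmxE j l : Wmx U j l = (2 * q U j - 1) * ((a U j + b U j - 1) * Atilde U j l).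
Proof. by rewrite /Wmx /Imx /Bmx -mulmxA mul_diag_mx mul_diag_mx !mxE. Qed.

Definition offset (i : 'I_nF) : R := (W0 U (flex i) + B0 U (flex i))%:R / (mbar U (flex i))%:R.

Lemma offset_ge0 i : 0 <= offset i.
Proof. by rewrite divr_ge0. Qed.

(** Entry [i] is the gain in the scaled white count of [i] when the draw at [j] is white rather than
    black. *)
Definition effect j : 'rV[R]_nF := \row_i ((a U j + b U j - 1) * Atilde U j (flex i)).

Definition limit_prob j : R := q U j * Zstar U 0 j + (1 - q U j) * (1 - Zstar U 0 j).

Definition deviation t w : 'rV[R]_nF :=
  \row_i ((t%:R + offset i) * (ZF U chi t w 0 i - ZstarF U 0 i)).

Lemma Zstar_flex i : Zstar U 0 (flex i) = ZstarF U 0 i.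
Proof. by rewrite /Zstar row_mxEl. Qed.

Lemma white_stubborn t (i : 'I_nS) w : white t (rshift nF i) w = W0 U (rshift nF i).
Proof.
by elim: t => //= t ->; rewrite big_pred0 ?addn0// => j; rewrite edge_stubborn.
Qed.

Lemma mbar_stubborn (i : 'I_nS) : mbar U (rshift nF i) = 0%N.
Proof. by rewrite /mbar big_pred0// => j; rewrite edge_stubborn. Qed.

Lemma Z_stubborn t (i : 'I_nS) w : Z t (rshift nF i) w = Zstar U 0 (rshift nF i).
Proof.
rewrite /Zstar row_mxEr !mxE /Defs.Z white_stubborn.
by rewrite totalE mbar_stubborn muln0 addn0.
Qed.

Lemma effectE j i : effect j 0 i = (a U j + b U j - 1) * Atilde U j (flex i).
Proof. by rewrite mxE. Qed.

Lemma WF_effect l i : WF U l i = (2 * q U (flex l) - 1) * effect (flex l) 0 i.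
Proof. by rewrite effectE -WmxE mxE mxE. Qed.

(** Undoing the inverse and merging the flexible and stubborn blocks of [Zstar] exhibits the limit
    as a balance: the right side is the mean increment of the scaled white count under the limiting
    draw probabilities. *)
Lemma Zstar_equilibrium i : (1%:M - WF U) \in unitmx ->
  ZstarF U 0 i = \sum_j (Atilde U j (flex i) * (1 - b U j) + effect j 0 i * limit_prob j).
Proof.
move=> unitA; pose y := rsubmx (Z0 U) *m dlsubmx (Wmx U) + lsubmx (a_row U *m Atilde U)
     - lsubmx (q_row U *m Bmx U *m Atilde U).
have fix_eq : ZstarF U = ZstarF U *m WF U + y.
  have : ZstarF U *m (1%:M - WF U) = y by rewrite /ZstarF mulmxKV.
  by rewrite mulmxBr mulmx1 => /eqP; rewrite subr_eq addrC => /eqP.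
rewrite {1}fix_eq !mxE.
rewrite !addrA.
have -> : \sum_j ZstarF U 0 j * WF U j i + \sum_j rsubmx (Z0 U) 0 j * dlsubmx (Wmx U) j i =
    \sum_j Zstar U 0 j * Wmx U j (flex i).
  rewrite big_split_ord /=; congr (_ + _); apply: eq_bigr => j _.
    by rewrite Zstar_flex !mxE.
  by rewrite /Zstar row_mxEr !mxE.
rewrite -big_split -sumrB; apply: eq_bigr => j _ /=.
by rewrite WmxE effectE /limit_prob /Bmx mul_mx_diag !mxE; ring.
Qed.

Lemma quad_sum (I : Type) (s : seq I) (c : I -> R) (v : I -> 'rV[R]_nF) u :
  quad (\sum_(j <- s) c j *: ((v j)^T *m v j)) u = \sum_(j <- s) c j * lin (v j) u ^+ 2.
Proof.
elim: s => [|j s ih]; first by rewrite !big_nil /quad mulmx0 mul0mx mxE.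
by rewrite !big_cons quadD quadZ quad_rank1 ih.
Qed.

(** With [p = limit_prob j], [p (1 - p) = 1/4 - (p - 1/2)^2] and
    [p - 1/2 = (2 q_j - 1)(Zstar_j - 1/2)]. So [Gamma] is the covariance of one noise step at the
    limit, from which symmetry and positivity are read off. *)
Lemma Gamma_effect :
  Gamma U = \sum_j (limit_prob j * (1 - limit_prob j)) *: ((effect j)^T *m effect j).
Proof.
apply/matrixP => i l; rewrite summxE.
have -> : Gamma U i l = - (\sum_j Wmx U j (flex i) * ((Zstar U 0 j - 2^-1) ^+ 2 * Wmx U j (flex l)))
   + 4^-1 * (\sum_j Atilde U j (flex i) * ((a U j + b U j - 1) ^+ 2 * Atilde U j (flex l))).
  rewrite /Gamma /Theta /Bmx expr2 -!mulmxA mul_diag_mx !mxE.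
  congr (- _ + _ * _); apply: eq_bigr => j _; rewrite ?mul_diag_mx !mxE ?expr2 //.
  by rewrite !mulrA.
rewrite mulr_sumr -sumrN -big_split; apply: eq_bigr => j _ /=.
have -> : ((limit_prob j * (1 - limit_prob j)) *: ((effect j)^T *m effect j)) i l =
    limit_prob j * (1 - limit_prob j) * (effect j 0 i * effect j 0 l) by rewrite mxE mxE big_ord1 mxE.
by rewrite !effectE !WmxE /limit_prob; field.
Qed.

(** The total of urn [i] is [mbar_i (t + offset i)], so this scaling clears the denominator
    exactly. *)
Lemma white_scaled t i w : (t%:R + offset i) * Z t (flex i) w =
  (white t (flex i) w)%:R / (mbar U (flex i))%:R.
Proof.
have m0 : (mbar U (flex i))%:R != 0 :> R by rewrite pnatr_eq0 -lt0n mbar_flex_gt0.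
have t0 : (W0 U (flex i) + B0 U (flex i) + t * mbar U (flex i))%:R != 0 :> R.
  by rewrite pnatr_eq0 -lt0n addn_gt0 T0_gt0.
rewrite /Defs.Z totalE /offset; move: t0 m0; rewrite natrD natrM.
move: (_ + _)%:R (mbar _ _)%:R (white _ _ _)%:R => x y z t0 m0.
by field; rewrite m0.
Qed.

Lemma white_increment t i w :
  (white t.+1 (flex i) w)%:R / (mbar U (flex i))%:R - (white t (flex i) w)%:R / (mbar U (flex i))%:R =
  \sum_j (Atilde U j (flex i) * (1 - b U j) + effect j 0 i * (chi t.+1 j w)%:R).
Proof.
have m0 : (mbar U (flex i))%:R != 0 :> R by rewrite pnatr_eq0 -lt0n mbar_flex_gt0.
rewrite /= natrD mulrDl addrC addKr natr_sum mulr_suml big_mkcond.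
apply: eq_bigr => j _; rewrite effectE AtildeE /= ltn_ord /a /b.
have mj0 : (m U j)%:R != 0 :> R by rewrite pnatr_eq0 -lt0n m_gt0.
case: (edge U j (flex i)); last by rewrite mulr0 !mul0r mulr0 mul0r addr0.
rewrite natrD !natrM natrB ?beta_le//.
by case: (chi t.+1 j w) => /=; field; rewrite m0 mj0.
Qed.

Lemma draw_prob_dev t j w : draw_prob t j w - limit_prob j = (2 * q U j - 1) * (Z t j w - Zstar U 0 j).
Proof. by rewrite /Defs.draw_prob /limit_prob; ring. Qed.

Hypothesis unitA : (1%:M - WF U) \in unitmx.

Lemma deviation_step t w i : deviation t.+1 w 0 i =
  deviation t w 0 i + \sum_l deviation t w 0 l / (t%:R + offset l) * WF U l i
  + \sum_j ((chi t.+1 j w)%:R - draw_prob t j w) * effect j 0 i.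
Proof.
have devE t' : deviation t' w 0 i =
    (white t' (flex i) w)%:R / (mbar U (flex i))%:R - (t'%:R + offset i) * ZstarF U 0 i.
  by rewrite -white_scaled !mxE mulrBr.
have -> : deviation t.+1 w 0 i = deviation t w 0 i +
    (((white t.+1 (flex i) w)%:R / (mbar U (flex i))%:R - (white t (flex i) w)%:R / (mbar U (flex i))%:R)
      - ZstarF U 0 i).
  by rewrite !devE -natr1; ring.
rewrite -[RHS]addrA; congr (_ + _); rewrite (white_increment t i w) Zstar_equilibrium// -sumrB.
have -> : \sum_l deviation t w 0 l / (t%:R + offset l) * WF U l i =
    \sum_j (draw_prob t j w - limit_prob j) * effect j 0 i.
  (* Stubborn nodes sit at their limit from the start and contribute nothing to the drift, which
     leaves the block [WF]. *)
  rewrite big_split_ord /= [X in _ = _ + X]big1 ?addr0; last first.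
    by move=> l _; rewrite draw_prob_dev Z_stubborn subrr mulr0 mul0r.
  apply: eq_bigr => l _; rewrite draw_prob_dev WF_effect mxE mxE -Zstar_flex.
  have o0 : 0 < offset l by rewrite divr_gt0// ltr0n ?T0_gt0 ?mbar_flex_gt0.
  have t0 : 0 <= t%:R :> R by [].
  by field; lra.
rewrite -big_split; apply: eq_bigr => j _ /=; ring.
Qed.

Lemma deviation_lin t w u : lin (deviation t.+1 w) u =
  lin (deviation t w) (drift_step (WF U) offset t u)
  + \sum_j ((chi t.+1 j w)%:R - draw_prob t j w) * lin (effect j) u.
Proof.
rewrite linE; under eq_bigr do rewrite deviation_step !mulrDl.
rewrite !big_split /=; congr (_ + _).
  rewrite /drift_step linD -linE; congr (_ + _); rewrite linE.
  under [RHS]eq_bigr => l _ do rewrite [X in _ * X]mxE [X in _ * (X / _)]mxE mulr_suml mulr_sumr.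
  rewrite exchange_big /=; apply: eq_bigr => i _; rewrite mulr_suml; apply: eq_bigr => l _.
  by ring.
under eq_bigr do rewrite mulr_suml.
rewrite exchange_big; apply: eq_bigr => j _; rewrite linE mulr_sumr; apply: eq_bigr => i _.
by rewrite mulrA.
Qed.

End UrnDynamics.

(** * One-step estimates for moments and characteristic functions *)

Section UrnRecursion.
Context {R : realType} {nF nS : nat} (U : urn_network R nF nS).
Context {d : measure_display} {T : measurableType d}.
Variable P : probability T R.
Local Notation V := 'I_(nF + nS).
Variable chi : nat -> V -> T -> bool.
Hypothesis draws : urn_draws U chi P.
Local Notation white := (@white R nF nS U d T chi).
Local Notation Z := (@Z R nF nS U d T chi).
Local Notation draw_prob := (@draw_prob R nF nS U d T chi).
Local Notation dev := (@deviation R nF nS U d T chi).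
Local Notation flex i := (lshift nS i).

(** A quantity that sees the sample point only through the counts factors through them: [h]
    evaluates it at any chosen sample point with the given counts. *)
Lemma Ex_draws_adapted t (H : T -> {ffun V -> bool} -> R) :
  (forall w w', white t ^~ w = white t ^~ w' -> H w = H w') ->
  Ex P (fun w => H w [ffun i => chi t.+1 i w]) =
  Ex P (fun w => prod_mean (draw_weight U chi t w) (H w)).
Proof.
move=> adapted.
pose h (s : V -> nat) : {ffun V -> bool} -> R :=
  if pselect (exists w, white t ^~ w = s) is left e then H (sval (cid e)) else fun=> 0.
have hE w : h (white t ^~ w) = H w.
  rewrite /h; case: pselect => [e|[]]; last by exists w.
  by apply: adapted; case: cid.
have := Ex_draws draws t h.
under [X in Ex P X = _ -> _]funext do rewrite hE.
by under [X in _ = Ex P X -> _]funext do rewrite hE.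
Qed.

Lemma Z_adapted t w w' : white t ^~ w = white t ^~ w' -> Z t ^~ w = Z t ^~ w'.
Proof.
move=> e; apply/funext => i; rewrite /Defs.Z !totalE.
by have -> : white t i w = white t i w' by exact: (congr1 (fun f => f i) e).
Qed.

Lemma draw_prob_adapted t w w' : white t ^~ w = white t ^~ w' -> draw_prob t ^~ w = draw_prob t ^~ w'.
Proof.
move=> /Z_adapted e; apply/funext => i; rewrite /Defs.draw_prob.
by have -> : Z t i w = Z t i w' by exact: (congr1 (fun f => f i) e).
Qed.

Lemma deviation_adapted t w w' : white t ^~ w = white t ^~ w' -> dev t w = dev t w'.
Proof.
move=> /Z_adapted e; apply/matrixP => i j; rewrite !mxE.
by have -> : Z t (flex j) w = Z t (flex j) w' by exact: (congr1 (fun f => f (flex j)) e).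
Qed.

Lemma mbounded_deviation t u : mbounded (fun w => lin (dev t w) u).
Proof.
under [X in mbounded X]funext do rewrite linE.
apply: mbounded_sum => i.
rewrite (_ : (fun w => _) = fun w => (t%:R + offset U i) * u i 0 * (Z t (flex i) w - ZstarF U 0 i)).
  by apply: mboundedZ; apply: mboundedB; [exact: (mbounded_Z draws)|exact: mbounded_cst].
by apply/funext => w; rewrite !mxE; ring.
Qed.

Lemma mbounded_cos t u th : mbounded (fun w => cos (lin (dev t w) u + th)).
Proof.
split.
  apply: (measurableT_comp (f := cos)).
    by apply: continuous_measurable_fun; exact: continuous_cos.
  by apply: measurable_funD; [exact: (mbounded_deviation t u).1|exact: measurable_cst].
by exists 1 => w; rewrite ler_norml cos_geN1 cos_le1.
Qed.

Definition charfun t u th : R := Ex P (fun w => cos (lin (dev t w) u + th)).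

Definition second_moment t u : R := Ex P (fun w => lin (dev t w) u ^+ 2).

Let kappa : R := \sum_j \sum_i `|effect U j 0 i|.

Let kappa_ge0 : 0 <= kappa.
Proof. by apply: sumr_ge0 => j _; exact: sumr_ge0. Qed.

Lemma lin_le n (x : 'rV[R]_n) u (b : R) : (forall i, `|x 0 i| <= b) -> `|lin x u| <= b * norm1 u.
Proof.
move=> xb; rewrite linE mulr_sumr; apply: (le_trans (ler_norm_sum _ _ _)).
by apply: ler_sum => i _; rewrite normrM ler_wpM2r.
Qed.

Let effect_le u : \sum_j `|lin (effect U j) u| <= kappa * norm1 u.
Proof.
rewrite /kappa mulr_suml; apply: ler_sum => j _; apply: lin_le => i.
by rewrite (bigD1 i)//= lerDl sumr_ge0.
Qed.

Lemma sum_sqr_le (I : finType) (c f : I -> R) (K : R) : (forall i, 0 <= c i) ->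
  \sum_i `|f i| <= K -> \sum_i c i * f i ^+ 2 <= (\sum_i c i) * K ^+ 2.
Proof.
move=> c0 fK; rewrite mulr_suml; apply: ler_sum => i _; rewrite ler_wpM2l//.
rewrite -[f i ^+ 2]real_normK ?num_real// lerXn2r ?nnegrE//.
  by apply: le_trans fK; exact: sumr_ge0.
by apply: le_trans fK; rewrite (bigD1 i)//= lerDl sumr_ge0.
Qed.

Hypothesis unitA : (1%:M - WF U) \in unitmx.
Hypothesis cvgZ : {ae P, forall w, ZF U chi t w @[t --> \oo] --> ZstarF U}.

Lemma draw_prob_cvg j w : ZF U chi t w @[t --> \oo] --> ZstarF U ->
  draw_prob t j w - limit_prob U j @[t --> \oo] --> 0.
Proof.
move=> Zw.
have -> : (fun t => draw_prob t j w - limit_prob U j) = fun t => (2 * q U j - 1) * (Z t j w - Zstar U 0 j).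
  by apply/funext => t; rewrite draw_prob_dev.
rewrite -[X in _ --> X](mulr0 (2 * q U j - 1)); apply: cvgM; first exact: cvg_cst.
have [i ->|i ->] := split_ordP j; last first.
  have -> : (fun t => Z t (rshift nF i) w - Zstar U 0 (rshift nF i)) = fun=> 0.
    by apply/funext => t; rewrite Z_stubborn subrr.
  exact: cvg_cst.
rewrite -[X in _ --> X](subrr (ZstarF U 0 i)) Zstar_flex; apply: cvgB; last exact: cvg_cst.
have -> : (fun t => Z t (flex i) w) = (fun x : 'rV[R]_nF => x 0 i) \o (fun t => ZF U chi t w).
  by apply/funext => t; rewrite /= mxE.
exact: cvg_comp Zw (@coord_continuous R 1 nF 0 i (ZstarF U)).
Qed.

(** The formula for [ZstarF] gives no bound by itself; the value is a limit of genuine probabilities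
    along one convergent trajectory, which exists because a set of full measure is not empty. *)
Lemma limit_prob01 j : 0 <= limit_prob U j <= 1.
Proof.
have [w Zw] : exists w, ZF U chi t w @[t --> \oo] --> ZstarF U.
  apply: contrapT => noZ; have : P.-negligible setT.
    by apply: negligibleS cvgZ => w _ Zw; apply: noZ; exists w.
  move/(@negligibleP _ _ _ P _ measurableT); rewrite [X in X = _ -> _](probability_setT P) => /eqP.
  by rewrite onee_eq0.
have c : draw_prob t j w @[t --> \oo] --> limit_prob U j.
  rewrite -[X in _ --> X]add0r.
  have -> : (fun t => draw_prob t j w) = fun t => draw_prob t j w - limit_prob U j + limit_prob U j.
    by apply/funext => t; rewrite subrK.
  by apply: cvgD (@draw_prob_cvg j w Zw) _; exact: cvg_cst.
have H t := draw_prob01 U chi t j w.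
apply/andP; split.
  by apply: (cvgr_to_ge c); apply: nearW => t; have /andP[] := H t.
by apply: (cvgr_to_le c); apply: nearW => t; have /andP[] := H t.
Qed.

Let step_noise t w u th : lin (dev t.+1 w) u + th =
  (lin (dev t w) (drift_step (WF U) (offset U) t u) + th)
  + noise (draw_prob t ^~ w) (fun j => lin (effect U j) u) [ffun i => chi t.+1 i w].
Proof.
rewrite (deviation_lin _ unitA) addrAC; congr (_ + _); apply: eq_bigr => j _.
by rewrite ffunE.
Qed.

Let p01 t w : forall i, 0 <= draw_prob t i w <= 1.
Proof. by move=> i; exact: (draw_prob01 U chi). Qed.

(** Centring removes the cross term with the past, and each [p (1 - p)] is at most 1. *)
Lemma second_moment_step t u : second_moment t.+1 u <=
  second_moment t (drift_step (WF U) (offset U) t u) + #|V|%:R * kappa ^+ 2 * norm1 u ^+ 2.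
Proof.
set v := drift_step _ _ _ _.
pose H w (x : {ffun V -> bool}) := (lin (dev t w) v + noise (draw_prob t ^~ w) (fun j => lin (effect U j) u) x) ^+ 2.
have -> : second_moment t.+1 u = Ex P (fun w => H w [ffun i => chi t.+1 i w]).
  by congr Ex; apply/funext => w; have := step_noise t w u 0; rewrite !addr0 => ->.
rewrite Ex_draws_adapted; last first.
  by move=> w w' e; rewrite /H (deviation_adapted e) (draw_prob_adapted e).
have sqb u' : mbounded (fun w => lin (dev t w) u' ^+ 2).
  by apply: (@mboundedM _ _ _ (fun w => lin (dev t w) u') (fun w => lin (dev t w) u')); exact: mbounded_deviation.
rewrite -[X in _ + X](Ex_cst P) -ExD//; last exact: mbounded_cst.
have E w : prod_mean (draw_weight U chi t w) (H w) =
  lin (dev t w) v ^+ 2 + \sum_j draw_prob t j w * (1 - draw_prob t j w) * lin (effect U j) u ^+ 2.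
  exact: noise_square.
under [X in Ex P X <= _]funext do rewrite E.
apply: Ex_le.
- apply: mboundedD => //; apply: mbounded_sum => j.
  have bp := mbounded_draw_prob draws t j.
  apply: mboundedM; last exact: mbounded_cst.
  by apply: mboundedM => //; apply: mboundedB => //; exact: mbounded_cst.
- by apply: mboundedD => //; exact: mbounded_cst.
- move=> w; rewrite lerD2l -mulrA -exprMn.
  apply: (le_trans (sum_sqr_le _ (effect_le u))).
    by move=> j; have /andP[a1 a2] := p01 t w j; rewrite mulr_ge0// subr_ge0.
  rewrite ler_wpM2r ?sqr_ge0// -sum1_card natr_sum; apply: ler_sum => j _.
  by have /andP[a1 a2] := p01 t w j; nra.
Qed.

Definition prob_error t : R := Ex P (fun w => \sum_j `|draw_prob t j w - limit_prob U j|).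

Let mbounded_error t : mbounded (fun w => \sum_j `|draw_prob t j w - limit_prob U j|).
Proof.
apply: mbounded_sum => j; apply: mbounded_norm; apply: mboundedB; last exact: mbounded_cst.
exact: (mbounded_draw_prob draws).
Qed.

Lemma quad_Gamma u : quad (Gamma U) u =
  \sum_j limit_prob U j * (1 - limit_prob U j) * lin (effect U j) u ^+ 2.
Proof. by rewrite Gamma_effect quad_sum. Qed.

Lemma quad_Gamma_ge0 u : 0 <= quad (Gamma U) u.
Proof.
rewrite quad_Gamma; apply: sumr_ge0 => j _; have /andP[a1 a2] := limit_prob01 j.
by apply: mulr_ge0 (sqr_ge0 _); apply: mulr_ge0; rewrite ?subr_ge0.
Qed.

(** Given the past, the mean cosine is [(1 - s2/2) cos A] up to a cubic term. Replacing [s2] by its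
    limit [Q] costs [prob_error], as [p (1 - p)] is 1-Lipschitz on [[0, 1]]; then [1 - Q/2] becomes
    the exponential. *)
Lemma charfun_step : exists2 K, 0 <= K & forall t u th,
  `|charfun t.+1 u th - expR (- (quad (Gamma U) u / 2)) * charfun t (drift_step (WF U) (offset U) t u) th|
  <= kappa ^+ 2 * prob_error t * norm1 u ^+ 2 + K * norm1 u ^+ 3.
Proof.
pose M := #|V|%:R * kappa ^+ 2; have M0 : 0 <= M by rewrite mulr_ge0 ?sqr_ge0.
exists (kappa ^+ 3 + M + M ^+ 2); first by rewrite !addr_ge0 ?exprn_ge0.
move=> t u th; set v := drift_step _ _ _ _; set Q := quad (Gamma U) u; set n1 := norm1 u.
have n0 : 0 <= n1 by exact: norm1_ge0.
pose k j := lin (effect U j) u.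
pose H w (x : {ffun V -> bool}) := cos (lin (dev t w) v + th + noise (draw_prob t ^~ w) k x).
have -> : charfun t.+1 u th = Ex P (fun w => H w [ffun i => chi t.+1 i w]).
  by congr Ex; apply/funext => w; rewrite step_noise.
rewrite Ex_draws_adapted; last first.
  by move=> w w' e; rewrite /H (deviation_adapted e) (draw_prob_adapted e).
rewrite /charfun -ExZ; last exact: mbounded_cos.
have Q0 : 0 <= Q by exact: quad_Gamma_ge0.
have QM : Q <= M * n1 ^+ 2.
  rewrite /Q quad_Gamma /M -mulrA -exprMn; apply: (le_trans (sum_sqr_le _ (effect_le u))).
    by move=> j; have /andP[a1 a2] := limit_prob01 j; rewrite mulr_ge0// subr_ge0.
  rewrite ler_wpM2r ?sqr_ge0// -sum1_card natr_sum; apply: ler_sum => j _.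
  by have /andP[a1 a2] := limit_prob01 j; nra.
(* Up to norm 1 the quadratic bound has degree 4, beyond it the linear bound has degree 2; degree 3
   dominates both. *)
have expQ : `|expR (- (Q / 2)) - (1 - Q / 2)| <= (M + M ^+ 2) * n1 ^+ 3.
  have y0 : 0 <= Q / 2 by rewrite divr_ge0.
  have [e2 e1] := expRN_taylor2 y0.
  have yM : Q / 2 <= M * n1 ^+ 2 by lra.
  have [n11|n11] := leP n1 1.
    apply: (le_trans e2); apply: (@le_trans _ _ ((M * n1 ^+ 2) ^+ 2)).
      by rewrite lerXn2r ?nnegrE// (le_trans y0).
    have -> : (M * n1 ^+ 2) ^+ 2 = M ^+ 2 * n1 ^+ 3 * n1 by ring.
    apply: (@le_trans _ _ (M ^+ 2 * n1 ^+ 3)).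
      by rewrite ler_piMr// mulr_ge0 ?exprn_ge0.
    by rewrite mulrDl lerDr mulr_ge0 ?exprn_ge0.
  apply: (le_trans e1); apply: (le_trans yM); apply: (@le_trans _ _ (M * n1 ^+ 3)).
    by rewrite ler_wpM2l// [leRHS]exprS ler_peMl ?sqr_ge0// ltW.
  by rewrite mulrDl lerDl mulr_ge0 ?exprn_ge0.
have -> : kappa ^+ 2 * prob_error t * n1 ^+ 2 + (kappa ^+ 3 + M + M ^+ 2) * n1 ^+ 3 =
  Ex P (fun w => kappa ^+ 2 * n1 ^+ 2 * (\sum_j `|draw_prob t j w - limit_prob U j|)
    + (kappa ^+ 3 + M + M ^+ 2) * n1 ^+ 3).
  rewrite ExD; [|exact: mboundedZ|exact: mbounded_cst].
  by rewrite ExZ// Ex_cst -/(prob_error t); ring.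
apply: Ex_dist_le.
- split.
    rewrite /prod_mean; apply: measurable_sum => x; apply: measurable_funM.
      by apply: (mbounded_prod _ _).1 => i; exact: (mbounded_draw_weight draws).
    apply: (measurableT_comp (f := cos)).
      by apply: continuous_measurable_fun; exact: continuous_cos.
    apply: measurable_funD.
      by apply: measurable_funD; [exact: (mbounded_deviation t v).1|exact: measurable_cst].
    apply: measurable_sum => j; apply: measurable_funM; last exact: measurable_cst.
    by apply: measurable_funB; [exact: measurable_cst|exact: (mbounded_draw_prob draws t j).1].
  exists 1 => w; have W0 := bernoulli_weight_ge0 (p01 t w).
  apply: (le_trans (prod_mean_norm W0 _)).
  rewrite -[leRHS](prod_mean_cst (bernoulli_weight_sum1 (draw_prob t ^~ w)) 1).
  by apply: prod_mean_le => // x; rewrite ler_norml cos_geN1 cos_le1.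
- by apply: mboundedZ; exact: mbounded_cos.
- by apply: mboundedD; [exact: mboundedZ|exact: mbounded_cst].
move=> w; set A := lin (dev t w) v + th; set s2 := \sum_j draw_prob t j w * (1 - draw_prob t j w) * k j ^+ 2.
set D := \sum_j `|_|.
have B1 : `|prod_mean (draw_weight U chi t w) (H w) - (1 - s2 / 2) * cos A| <= (kappa * n1) ^+ 3.
  by have := noise_cos (p01 t w) A (effect_le u).
have B2 : `|s2 - Q| <= D * (kappa * n1) ^+ 2.
  rewrite /s2 /Q quad_Gamma -sumrB; apply: (le_trans (ler_norm_sum _ _ _)).
  apply: (@le_trans _ _ (\sum_j `|draw_prob t j w - limit_prob U j| * k j ^+ 2)); last first.
    exact: sum_sqr_le (effect_le u).
  apply: ler_sum => j _; rewrite -mulrBl normrM [`|k j ^+ 2|]ger0_norm ?sqr_ge0//.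
  rewrite ler_wpM2r ?sqr_ge0//.
  have /andP[a1 a2] := p01 t w j; have /andP[b1 b2] := limit_prob01 j.
  set x := draw_prob t j w in a1 a2 *; set y := limit_prob U j in b1 b2 *.
  have -> : x * (1 - x) - y * (1 - y) = (x - y) * (1 - x - y) by ring.
  by rewrite normrM ler_piMr// ler_norml; apply/andP; split; lra.
have cA : `|cos A| <= 1 by rewrite ler_norml cos_geN1 cos_le1.
have -> : prod_mean (draw_weight U chi t w) (H w) - expR (- (Q / 2)) * cos A =
  (prod_mean (draw_weight U chi t w) (H w) - (1 - s2 / 2) * cos A)
  - (expR (- (Q / 2)) - (1 - Q / 2) + (s2 - Q) / 2) * cos A by field.
apply: (le_trans (ler_normB _ _)).
have B3 : `|(expR (- (Q / 2)) - (1 - Q / 2) + (s2 - Q) / 2) * cos A| <= (M + M ^+ 2) * n1 ^+ 3 + D * (kappa * n1) ^+ 2 / 2.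
  rewrite normrM; apply: (@le_trans _ _ `|expR (- (Q / 2)) - (1 - Q / 2) + (s2 - Q) / 2|).
    by rewrite ler_piMr.
  apply: (le_trans (ler_normD _ _)); apply: lerD => //.
  by rewrite normrM [`|2^-1|]ger0_norm// ler_wpM2r.
have D0 : 0 <= D * (kappa * n1) ^+ 2 by rewrite mulr_ge0 ?sqr_ge0//; exact: sumr_ge0.
apply: (le_trans (lerD B1 B3)); move: D0; rewrite !exprMn; lra.
Qed.

Lemma prob_error_ge0 t : 0 <= prob_error t.
Proof. by apply: Ex_ge0 => w; exact: sumr_ge0. Qed.

Lemma prob_error_cvg : prob_error t @[t --> \oo] --> 0.
Proof.
rewrite -[X in _ --> X](Ex_cst P 0).
apply: (@Ex_cvg _ _ _ P _ _ #|V|%:R).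
- by move=> t; exact: (mbounded_error t).1.
- move=> t w; rewrite ger0_norm ?sumr_ge0// -sum1_card natr_sum; apply: ler_sum => j _.
  have /andP[a1 a2] := p01 t w j; have /andP[b1 b2] := limit_prob01 j.
  by rewrite ler_norml; apply/andP; split; lra.
- exact: measurable_cst.
apply: filterS cvgZ => w Zw.
rewrite [X in _ --> X](_ : _ = \sum_(j : V) 0); last by rewrite big1.
apply: cvg_sumr => j; rewrite -[X in _ --> X](@normr0 _ R); apply: cvg_norm.
exact: draw_prob_cvg.
Qed.

Lemma charfun1 : exists2 r, 0 <= r & forall u th,
  `|charfun 1 u th - cos th| <= r * norm1 u /\ second_moment 1 u <= r * norm1 u ^+ 2.
Proof.
pose b := \sum_(i < nF) (1 + offset U i) * (1 + `|ZstarF U 0 i|).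
have t0 i : 0 <= (1 + offset U i) * (1 + `|ZstarF U 0 i|).
  by rewrite mulr_ge0// addr_ge0// offset_ge0.
have b0 : 0 <= b by exact: sumr_ge0.
have devb w i : `|dev 1 w 0 i| <= b.
  apply: (@le_trans _ _ ((1 + offset U i) * (1 + `|ZstarF U 0 i|))); last first.
    by rewrite /b (bigD1 i)//= lerDl sumr_ge0.
  rewrite mxE normrM ler_pM//; first by rewrite ger0_norm// addr_ge0// offset_ge0.
  apply: (le_trans (ler_normB _ _)); rewrite lerD2r mxE ger0_norm ?Z_ge0//.
  exact: (Z_le1 U chi).
have linb w u := lin_le u (devb w).
exists (b + b ^+ 2); first by rewrite addr_ge0 ?sqr_ge0.
move=> u th; have n0 := norm1_ge0 u; split.
  rewrite -[cos th](Ex_cst P).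
  apply: (@le_trans _ _ (Ex P (fun=> b * norm1 u))); last first.
    by rewrite Ex_cst ler_wpM2r// lerDl sqr_ge0.
  apply: Ex_dist_le; [exact: mbounded_cos|exact: mbounded_cst|exact: mbounded_cst|].
  move=> w; apply: le_trans (linb w u); set x := lin _ _.
  wlog x0 : x th / 0 <= x.
    move=> H; have [x0|/ltW x0] := leP 0 x; first exact: H.
    have := H (- x) (- th); rewrite oppr_ge0 -opprD !cosN normrN => /(_ x0); exact.
  by have [H _] := sin_cos_lip th x0; rewrite [x + th]addrC (ger0_norm x0).
rewrite -[leRHS](Ex_cst P); apply: Ex_le; last 1 first.
- move=> w; apply: (@le_trans _ _ ((b * norm1 u) ^+ 2)).
    by rewrite -[leLHS]real_normK ?num_real// lerXn2r ?nnegrE ?mulr_ge0.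
  by rewrite exprMn ler_wpM2r ?sqr_ge0// lerDr.
- by apply: (@mboundedM _ _ _ (fun w => lin (dev 1 w) u) (fun w => lin (dev 1 w) u)); exact: mbounded_deviation.
- exact: mbounded_cst.
Qed.

End UrnRecursion.

(** * The central limit theorem *)

(** The rate found from the spectrum may be negative, whereas the scales are compared for
    [0 <= w]. *)
Lemma drift_norm_weaken (R : realType) n (W : 'M[R]_n) N (w w' C : R) : w <= w' ->
  drift_norm W N w C -> drift_norm W N w' C.
Proof.
move=> ww' H; case: (H) => C0 H1 H2 H3 H4; split => // h u h0.
apply: (le_trans (H4 h u h0)); rewrite ler_wpM2r ?(drift_norm_ge0 H)//.
by rewrite lerD2r lerD2l ler_wpM2r.
Qed.

Lemma mx_cvg (R : realType) (T : Type) (F : set_system T) (FF : Filter F) m n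
    (f : T -> 'M[R]_(m, n)) (A : 'M[R]_(m, n)) :
  (forall i j, f x i j @[x --> F] --> A i j) -> f x @[x --> F] --> A.
Proof.
move=> fA; apply/cvg_ballP => e e0.
have : \forall x \near F, forall i j, ball (A i j) e (f x i j).
  apply: filter_forall => i; apply: filter_forall => j.
  by have /cvg_ballP := fA i j; apply.
by apply: filterS => x H; split.
Qed.

(** * The limit theorem for an abstract scale [a] *)

Section UrnCLT.
Context {R : realType} {nF nS : nat} (U : urn_network R nF nS).
Context {d : measure_display} {T : measurableType d}.
Variable P : probability T R.
Local Notation V := 'I_(nF + nS).
Variable chi : nat -> V -> T -> bool.
Hypothesis draws : urn_draws U chi P.
Hypothesis cvgZ : {ae P, forall w, ZF U chi t w @[t --> \oo] --> ZstarF U}.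
Hypothesis unitA : (1%:M - WF U) \in unitmx.
Local Notation W := (WF U).
Local Notation G := (Gamma U).

Variables (N : 'cV[R]_nF -> R) (w D : R).
Hypothesis driftN : drift_norm W N w D.
Hypothesis w0 : 0 <= w.
Variable CE : R.
Hypothesis EC : forall tau i j, 0 <= tau -> `|semigroup ((2^-1)%:M - W) tau i j| <= CE.
Variable Y : R -> 'M[R]_nF.
Hypothesis Y0 : Y 0 = 0.
Hypothesis dY : forall x, is_mxderive x Y (covariance_density W G x).

Variables (a s : nat -> R) (Sigma : 'M[R]_nF).
Hypothesis s_ge0 : forall t, 0 <= s t.
Hypothesis scale : forall C, 0 <= C -> dominating_scale w C a.
Hypothesis sa : \forall t \near \oo, s t * a t = t%:R.
Hypothesis YSigma : forall i j, t%:R / a t ^+ 2 * Y (ln t%:R) i j @[t --> \oo] --> Sigma i j.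

Lemma offset_gt0 i : 0 < offset U i.
Proof. by rewrite divr_gt0// ltr0n ?T0_gt0 ?mbar_flex_gt0. Qed.

(** Trades the normalisation [s t] for the factors [t + offset i] carried by the deviation. Since
    [s t = t / a t] eventually, such a vector has size of order [1 / a t]. *)
Let direction t (u : 'cV[R]_nF) : 'cV[R]_nF := \col_i (s t / (t%:R + offset U i) * u i 0).

Let lin_direction t x (u : 'cV[R]_nF) :
  lin (s t *: (ZF U chi t x - ZstarF U)) u = lin (deviation U chi t x) (direction t u).
Proof.
rewrite linZl !linE mulr_sumr; apply: eq_bigr => i _; rewrite !mxE.
have := offset_gt0 i => o0; have t0 : 0 <= t%:R :> R by [].
by field; lra.
Qed.

Lemma Gamma_sym : G^T = G.
Proof.
rewrite Gamma_effect raddf_sum; apply: eq_bigr => j _.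
by rewrite /= trmxZ trmx_mul trmxK.
Qed.

Let quad_cvg (A : nat -> 'M[R]_nF) (B : 'M[R]_nF) (u : nat -> 'cV[R]_nF) (v : 'cV[R]_nF) :
  (forall i j, A t i j @[t --> \oo] --> B i j) -> (forall i, u t i 0 @[t --> \oo] --> v i 0) ->
  quad (A t) (u t) @[t --> \oo] --> quad B v.
Proof.
move=> AB uv; rewrite quadE.
have -> : (fun t => quad (A t) (u t)) = fun t => \sum_i \sum_j u t i 0 * A t i j * u t j 0.
  by apply/funext => t; rewrite quadE.
apply: cvg_sumr => i; apply: cvg_sumr => j.
by apply: cvgM; [apply: cvgM|]; [exact: uv|exact: AB|exact: uv].
Qed.

Let a_near : \forall t \near \oo, 0 < a t /\ (0 < t)%N.
Proof.
have [apos _ _ _ _] := scale (lexx 0).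
by near=> t; split; [near: t|near: t; exact: nbhs_infty_gt].
Unshelve. all: by end_near. Qed.

Let scaledY t : 'M[R]_nF := (t%:R / a t ^+ 2) *: Y (ln t%:R).

Let scaledY_cvg i j : scaledY t i j @[t --> \oo] --> Sigma i j.
Proof.
have -> : (fun t => scaledY t i j) = fun t => t%:R / a t ^+ 2 * Y (ln t%:R) i j.
  by apply/funext => t; rewrite mxE.
exact: YSigma.
Qed.

Let G_psd u : 0 <= quad G u.
Proof. exact: (quad_Gamma_ge0 cvgZ). Qed.

Lemma Sigma_psd u : 0 <= quad Sigma u.
Proof.
have c : quad (scaledY t) u @[t --> \oo] --> quad Sigma u.
  by apply: quad_cvg => // i; exact: cvg_cst.
apply: (cvgr_to_ge c); apply: nearW => t.
rewrite quadZ mulr_ge0 ?divr_ge0 ?sqr_ge0//.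
by apply: (primitive_psd Y0 dY) => //; exact: ln_nat_ge0.
Qed.

Lemma Sigma_sym : Sigma^T = Sigma.
Proof.
apply/matrixP => i j; rewrite mxE.
rewrite -(cvg_lim (@Rhausdorff R) (@scaledY_cvg j i)) -(cvg_lim (@Rhausdorff R) (@scaledY_cvg i j)).
congr (limn _); apply/funext => t; rewrite !mxE; congr (_ * _).
by rewrite -[in LHS](primitive_sym Y0 dY (ln t%:R) Gamma_sym) mxE.
Qed.

Let direction_small u : \forall t \near \oo, N (direction t u) <= D * norm1 u / a t.
Proof.
near=> t; have [at0 t0] : 0 < a t /\ (0 < t)%N by near: t; exact: a_near.
have sat : s t * a t = t%:R by near: t.
have tp : 0 < t%:R :> R by rewrite ltr0n.
have st : s t = t%:R / a t by rewrite -sat mulfK// gt_eqF.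
case: driftN => D0 _ _ ND _; apply: (le_trans (ND _)); rewrite -mulrA ler_wpM2l//.
apply: (le_trans (norm1_diag (c := (a t)^-1) _ _)); last by rewrite mulrC.
move=> i; have o0 := offset_gt0 i; rewrite ger0_norm; last by rewrite divr_ge0//; lra.
rewrite st ler_pdivrMr; last by lra.
by rewrite mulrC ler_wpM2l ?invr_ge0 ?(ltW at0)//; lra.
Unshelve. all: by end_near. Qed.

(** [a t] times the direction tends to [u], because [t / (t + offset i)] tends to 1, while [scaledY]
    tends to [Sigma]. *)
Let direction_quad u : t%:R * quad (Y (ln t%:R)) (direction t u) @[t --> \oo] --> quad Sigma u.
Proof.
have c : quad (scaledY t) (a t *: direction t u) @[t --> \oo] --> quad Sigma u.
  apply: quad_cvg => // i.
  have c1 : (1 + offset U i * t%:R^-1)^-1 * u i 0 @[t --> \oo] --> u i 0.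
    rewrite [X in _ --> X](_ : _ = (1 + offset U i * 0)^-1 * u i 0); last by rewrite mulr0 addr0 invr1 mul1r.
    apply: cvgM; last exact: cvg_cst.
    apply: cvgV; first by rewrite mulr0 addr0 oner_neq0.
    by apply: cvgD; [exact: cvg_cst|apply: cvgM; [exact: cvg_cst|exact: cvg_inv_nat]].
  apply: cvg_trans c1; apply: near_eq_cvg; near=> t.
  have [at0 t0] : 0 < a t /\ (0 < t)%N by near: t; exact: a_near.
  have sat : s t * a t = t%:R by near: t.
  have tp : 0 < t%:R :> R by rewrite ltr0n.
  have st : s t = t%:R / a t by rewrite -sat mulfK// gt_eqF.
  have o0 := offset_gt0 i.
  have : 0 < t%:R + offset U i by lra.
  by rewrite !mxE st => to; field; lra.
apply: cvg_trans c; apply: near_eq_cvg; near=> t.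
have [at0 t0] : 0 < a t /\ (0 < t)%N by near: t; exact: a_near.
rewrite /scaledY quadZ.
have -> : quad (Y (ln t%:R)) (a t *: direction t u) = a t ^+ 2 * quad (Y (ln t%:R)) (direction t u).
  by rewrite -!/(bilin _ _ _) /quad -/(bilin _ _ _) bilinZl bilinZr mulrA expr2.
by field; rewrite gt_eqF.
Unshelve. all: by end_near. Qed.

Let measurable_scaled t j : measurable_fun setT (fun x => (s t *: (ZF U chi t x - ZstarF U)) 0 j).
Proof.
rewrite (_ : (fun x => _) = fun x => s t * (Z U chi t (lshift nS j) x - ZstarF U 0 j)).
  apply: measurable_funM; first exact: measurable_cst.
  by apply: measurable_funB; [exact: (measurable_Z draws)|exact: measurable_cst].
by apply/funext => x; rewrite !mxE.
Qed.

Lemma urn_clt : cvg_normal0 P (fun t x => s t *: (ZF U chi t x - ZstarF U)) Sigma.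
Proof.
have [mu mu_normal mu_cos] := gaussian_exists Sigma_sym Sigma_psd.
exists mu; split => //.
have o0 i := offset_ge0 U i.
have [C C0 NC] := drift_norm_step o0 driftN.
have [K K0 HK] := charfun_step draws unitA cvgZ.
have [r r0 Hr] := charfun1 draws.
have sc := scale C0.
apply: charfun_cvg_distribution; first exact: measurable_scaled.
  have [_ _ _ _ sV] := sc.
  have VS t u : (0 < t)%N -> second_moment U P chi t.+1 u <=
      second_moment U P chi t (drift_step W (offset U) t u)
      + #|V|%:R * (\sum_j \sum_i `|effect U j 0 i|) ^+ 2 * norm1 u ^+ 2.
    by move=> _; exact: second_moment_step.
  set M := #|V|%:R * _ in VS.
  have M0 : 0 <= M by rewrite mulr_ge0 ?sqr_ge0.
  have V1 u : second_moment U P chi 1 u <= r * norm1 u ^+ 2 by have [] := Hr u 0.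
  have VB := second_moment_bound driftN w0 C0 NC M0 r0 V1 VS.
  have nn : 0 <= r * nF%:R ^+ 2 by rewrite mulr_ge0 ?sqr_ge0.
  have nn' : 0 <= M * nF%:R ^+ 2 by rewrite mulr_ge0 ?sqr_ge0.
  have [K' HK'] := sV _ _ nn nn'.
  (* Bounds the total second moment of the normalised vector. With the threshold [sqrt ((B + 1)/e)]
     Markov's inequality gives [e], the added 1 keeping the threshold positive when [B = 0]. *)
  pose B := nF%:R * (`|K'| * D ^+ 2).
  have B0 : 0 <= B by apply: mulr_ge0 => //; apply: mulr_ge0 (sqr_ge0 _).
  move=> e e0; exists (Num.sqrt ((B + 1) / e)); first by rewrite sqrtr_gt0 divr_gt0// ltr_wpDl.
  near=> t; have [at0 t0] : 0 < a t /\ (0 < t)%N by near: t; exact: a_near.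
  have VK : growth_rec w C 2 (fun=> M * nF%:R ^+ 2) (r * nF%:R ^+ 2) t / a t ^+ 2 <= K' by near: t.
  have dsmall : forall j : 'I_nF, N (direction t (delta_mx j 0)) <= D * norm1 (delta_mx j 0 : 'cV[R]_nF) / a t.
    by near: t; apply: filter_forall => j; exact: direction_small.
  have D0 : 0 <= D by case: driftN.
  have V2 j : Ex P (fun x => (s t *: (ZF U chi t x - ZstarF U)) 0 j ^+ 2) <= `|K'| * D ^+ 2.
    have -> : (fun x => (s t *: (ZF U chi t x - ZstarF U)) 0 j ^+ 2) =
        (fun x => lin (deviation U chi t x) (direction t (delta_mx j 0)) ^+ 2).
      apply/funext => x; rewrite -lin_direction; congr (_ ^+ 2).
      by rewrite /lin -colE [RHS]mxE.
    apply: (le_trans (VB t _ t0)).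
    have dn : norm1 (delta_mx j 0 : 'cV[R]_nF) = 1.
      rewrite /norm1 (bigD1 j)//= big1 ?addr0; first by rewrite mxE !eqxx normr1.
      by move=> i ij; rewrite mxE (negPf ij) normr0.
    have := dsmall j; rewrite dn mulr1 => dj.
    have N2 : N (direction t (delta_mx j 0)) ^+ 2 <= (D / a t) ^+ 2.
      by rewrite lerXn2r ?nnegrE ?(drift_norm_ge0 driftN)// divr_ge0// ltW.
    set g := growth_rec _ _ _ _ _ _ in VK *.
    have g0 : 0 <= g by apply: growth_rec_ge0.
    apply: (le_trans (ler_wpM2l g0 N2)).
    have -> : g * (D / a t) ^+ 2 = g / a t ^+ 2 * D ^+ 2 by field; rewrite gt_eqF.
    by rewrite ler_wpM2r ?sqr_ge0// (le_trans VK)// ler_norm.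
  have bX j : mbounded (fun x => (s t *: (ZF U chi t x - ZstarF U)) 0 j).
    have -> : (fun x => (s t *: (ZF U chi t x - ZstarF U)) 0 j) = fun x => s t * (Z U chi t (lshift nS j) x - ZstarF U 0 j).
      by apply/funext => x; rewrite !mxE.
    by apply: mboundedZ; apply: mboundedB; [exact: (mbounded_Z draws)|exact: mbounded_cst].
  have bX2 j : mbounded (fun x => (s t *: (ZF U chi t x - ZstarF U)) 0 j ^+ 2).
    by apply: (@mboundedM _ _ _ (fun x => (s t *: (ZF U chi t x - ZstarF U)) 0 j)
      (fun x => (s t *: (ZF U chi t x - ZstarF U)) 0 j)).
  apply: (@le_trans _ _ (Ex P (fun x => (e / (B + 1)) * \sum_j (s t *: (ZF U chi t x - ZstarF U)) 0 j ^+ 2))).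
    apply: Ex_le; [exact: tail_mbounded|by apply: mboundedZ; exact: mbounded_sum|].
    move=> x /=; rewrite /tail ge_min; apply/orP; right.
    rewrite sqr_sqrtr; last by rewrite divr_ge0// ?addr_ge0// ltW.
    by rewrite invf_div mulrC.
  rewrite ExZ; last exact: mbounded_sum.
  rewrite Ex_sum// mulrAC ler_pdivrMr ?ltr_wpDl// ler_wpM2l ?(ltW e0)//.
  apply: (@le_trans _ _ B); last by rewrite lerDl.
  rewrite /B mulr_natl -[nF in X in _ <= X]card_ord -sumr_const.
  by apply: ler_sum => j _; exact: V2.
move=> c th; rewrite mu_cos.
have -> : (fun t => Ex P (fun x => cos (lin (s t *: (ZF U chi t x - ZstarF U)) c + th))) =
    fun t => charfun U P chi t (direction t c) th.
  by apply/funext => t; congr Ex; apply/funext => x; rewrite lin_direction.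
pose e t := (\sum_j \sum_i `|effect U j 0 i|) ^+ 2 * prob_error U P chi t.
apply: (@characteristic_limit R nF W G (offset U) o0 N w D driftN C w0 C0 NC Y Y0 dY CE EC G_psd
  (charfun U P chi) r K e a r0 K0 _ _ _ _ sc (fun t => direction t c) (D * norm1 c)).
- by move=> t; rewrite mulr_ge0 ?sqr_ge0// prob_error_ge0.
- rewrite -[X in _ --> X](mulr0 ((\sum_j \sum_i `|effect U j 0 i|) ^+ 2)).
  by apply: cvgM; [exact: cvg_cst|exact: (prob_error_cvg draws cvgZ)].
- by move=> u th'; have [] := Hr u th'.
- by move=> t u th' _; exact: HK.
- exact: direction_small.
- exact: direction_quad.
Unshelve. all: by end_near. Qed.

End UrnCLT.

Lemma cvgy_ln (R : realType) : (ln x : R) @[x --> +oo] --> +oo.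
Proof.
apply/cvgryPge => A; near=> x.
have H : expR A <= x by near: x; apply: nbhs_pinfty_ge; exact: num_real.
by rewrite -ler_expR lnK// posrE (lt_le_trans (expR_gt0 _) H).
Unshelve. all: by end_near. Qed.

Section DensityLimits.
Context {R : realType} {n : nat}.
Variables (W G : 'M[R]_n) (C g : R).
Hypothesis g0 : 0 < g.
Local Notation B := ((2^-1)%:M - W).
Local Notation E := (semigroup B).
Local Notation S := (covariance_density W G).

Lemma density_decay :
  (forall tau i j, 0 <= tau -> `|E tau i j| <= C * expR (- (tau * g))) ->
  exists K, forall i j x, 0 <= x -> `|S x i j| <= K * expR (- (x * g)).
Proof.
move=> EC; exists (n%:R * (n%:R * (`|C| * mx_bound G) * `|C|)) => i j x x0.
have e1 : expR (- (x * g)) <= 1 by rewrite -[leRHS]expR0 ler_expR oppr_le0 mulr_ge0 ?(ltW g0).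
have EC1 k l : `|E x k l| <= `|C| * expR (- (x * g)).
  by apply: (le_trans (EC x k l x0)); rewrite ler_wpM2r ?expR_ge0// ler_norm.
have EC2 k l : `|E x k l| <= `|C| by apply: (le_trans (EC1 k l)); rewrite ler_piMr.
have -> : n%:R * (n%:R * (`|C| * mx_bound G) * `|C|) * expR (- (x * g)) =
    n%:R * (n%:R * (`|C| * mx_bound G) * (`|C| * expR (- (x * g)))) by ring.
apply: mulmx_entry_le => // k l; apply: mulmx_entry_le => [k' l'|k' l']; last exact: mx_boundP.
by rewrite mxE.
Qed.

(** At the critical value the density itself need not decay, but every term of its derivative
    contains [B *m E x], in which the critical direction is killed. The density therefore
    converges. *)
Lemma density_derivative_decay :
  (forall tau i j, 0 <= tau -> `|E tau i j| <= C) ->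
  (forall tau i j, 0 <= tau -> `|(B *m E tau) i j| <= C * expR (- (tau * g))) ->
  exists K, forall i j x, 0 <= x ->
    `|(- (B^T *m S x + S x *m B)) i j| <= K * expR (- (x * g)).
Proof.
move=> EC BC; pose K := n%:R * (n%:R * (`|C| * mx_bound G) * `|C|).
exists (K + K) => i j x x0.
have BC1 k l : `|(B *m E x) k l| <= `|C| * expR (- (x * g)).
  by apply: (le_trans (BC x k l x0)); rewrite ler_wpM2r ?expR_ge0// ler_norm.
have EC2 k l : `|E x k l| <= `|C| by apply: (le_trans (EC x k l x0)); exact: ler_norm.
have cE : B *m E x = E x *m B by exact: semigroup_comm.
have -> : B^T *m S x + S x *m B = (B *m E x)^T *m G *m E x + (E x)^T *m G *m (B *m E x).
  by rewrite /covariance_density cE trmx_mul !mulmxA.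
rewrite mxE normrN mxE mulrDl; apply: (le_trans (ler_normD _ _)); apply: lerD.
  have -> : K * expR (- (x * g)) = n%:R * (n%:R * (`|C| * expR (- (x * g)) * mx_bound G) * `|C|).
    by rewrite /K; ring.
  apply: mulmx_entry_le => // k l; apply: mulmx_entry_le => [k' l'|k' l']; last exact: mx_boundP.
  by rewrite mxE.
have -> : K * expR (- (x * g)) = n%:R * (n%:R * (`|C| * mx_bound G) * (`|C| * expR (- (x * g)))).
  by rewrite /K; ring.
apply: mulmx_entry_le => // k l; apply: mulmx_entry_le => [k' l'|k' l']; last exact: mx_boundP.
by rewrite mxE.
Qed.

End DensityLimits.

(** * The two regimes *)

Section FinalAssembly.
Context {R : realType} {nF nS : nat} (U : urn_network R nF nS).
Context {d : measure_display} {T : measurableType d}.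
Variable P : probability T R.
Local Notation V := 'I_(nF + nS).
Variable chi : nat -> V -> T -> bool.
Hypothesis draws : urn_draws U chi P.
Hypothesis cvgZ : {ae P, forall w, ZF U chi t w @[t --> \oo] --> ZstarF U}.

Lemma subcritical_clt : 2^-1 < rho U ->
  (forall i j, lebesgue_measure.-integrable `[0, +oo[ (fun u => (cov_integrand U u i j)%:E)) /\
  cvg_normal0 P (fun t w => Num.sqrt t%:R *: (ZF U chi t w - ZstarF U)) (cov_integral U `[0, +oo[).
Proof.
move=> half; have unitA : (1%:M - WF U) \in unitmx.
  by apply: unitmx_lambda_min; apply: lt_trans half; rewrite invr_gt0.
have [N [w [C [g [Nw w12 g0 EC]]]]] := subcritical_spectrum half.
have [Y Y0 dY] := density_primitive (WF U) (Gamma U).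
have [K HK] := density_decay (Gamma U) g0 EC.
have Y00 i j : Y 0 i j = 0 by rewrite Y0 mxE.
have dec i j := decay_integrable (@continuous_density _ _ (WF U) (Gamma U) i j) (fun x => dY x i j)
  (Y00 i j) g0 (HK i j).
split=> [i j|]; first by have [] := dec i j.
have wle : w <= Num.max w 0 by rewrite le_max lexx.
have w0 : 0 <= Num.max w 0 by rewrite le_max lexx orbT.
have wh : Num.max w 0 < 2^-1 by rewrite gt_max; apply/andP; split=> //; lra.
have ECb tau i j : 0 <= tau -> `|semigroup ((2^-1)%:M - WF U) tau i j| <= `|C|.
  move=> t0; apply: (le_trans (EC _ i j t0)); apply: (@le_trans _ _ (`|C| * expR (- (tau * g)))).
    by rewrite ler_wpM2r ?expR_ge0// ler_norm.
  by rewrite ler_piMr// -[leRHS]expR0 ler_expR oppr_le0 mulr_ge0// ltW.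
apply: (urn_clt draws cvgZ unitA (drift_norm_weaken wle Nw) w0 ECb Y0 dY (a := fun t => Num.sqrt t%:R)).
- by move=> t; exact: sqrtr_ge0.
- by move=> C' C'0; exact: subcritical_scale.
- by apply: nearW => t; rewrite -expr2 sqr_sqrtr.
(* Here [t / a t ^ 2 = 1], so the covariance is the limit of [Y (ln t)], that is, the improper
   integral. *)
- move=> i j; have [_ c] := dec i j; rewrite [X in _ --> X]mxE.
  have := cvg_comp _ _ (@cvg_ln_nat R) c; apply: cvg_trans; apply: near_eq_cvg; near=> t.
  have t0 : (0 < t)%N by near: t; exact: nbhs_infty_gt.
  by rewrite /= sqr_sqrtr// mulfV ?mul1r// pnatr_eq0 -lt0n.
Unshelve. all: by end_near. Qed.

Lemma critical_clt : rho U = 2^-1 -> rho_mult U = 1%N ->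
  exists Sigma : 'M[R]_nF,
    (ln t)^-1 *: cov_integral U `[0, ln t] @[t --> +oo] --> Sigma /\
    cvg_normal0 P (fun t w => Num.sqrt (t%:R / ln t%:R) *: (ZF U chi t w - ZstarF U)) Sigma.
Proof.
move=> half mult; have unitA : (1%:M - WF U) \in unitmx.
  by apply: unitmx_lambda_min; rewrite -/(rho U) half invr_gt0.
have cnt : count (fun z => complex.Re z == 2^-1) (eigenvalues (1%:M - WF U)) = 1%N.
  by move: mult; rewrite /rho_mult half.
have [N [C [g [Nw g0 EC BC]]]] := critical_spectrum half cnt.
have [Y Y0 dY] := density_primitive (WF U) (Gamma U).
have [K HK] := density_derivative_decay (Gamma U) EC BC.
have lim i j := decay_cvg (fun x => density_derive (WF U) (Gamma U) x i j) g0 (HK i j).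
(* The limit of the density at infinity. Its averages over [[0, x]] have the same limit, which gives
   both the limit along real [t] in the conclusion and the one along integers used by [urn_clt]. *)
pose Sigma : 'M[R]_nF := \matrix_(i, j) sval (cid (lim i j)).
have YS i j : x^-1 * Y x i j @[x --> +oo%R] --> Sigma i j.
  by apply: (cesaro_cvg (fun x => dY x i j)); rewrite mxE; case: cid.
exists Sigma; split.
  apply: mx_cvg => i j; have := cvg_comp _ _ (@cvgy_ln R) (YS i j).
  apply: cvg_trans; apply: near_eq_cvg; near=> t.
  have l0 : 0 < ln t.
    by apply: (@lt_le_trans _ _ 1) => //; near: t; have /cvgryPge := @cvgy_ln R; apply.
  rewrite /= !mxE (ftc_Rintegral (fun x => dY x i j) _ l0); last exact: continuous_density.
  by rewrite Y0 mxE subr0.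
apply: (urn_clt draws cvgZ unitA Nw _ EC Y0 dY (a := fun t => Num.sqrt (t%:R * ln t%:R))).
- by rewrite invr_ge0.
- by move=> t; exact: sqrtr_ge0.
- by move=> C' C'0; exact: critical_scale.
- near=> t; have l1 : 1 <= ln t%:R :> R by near: t; have /cvgryPge := @cvg_ln_nat R; apply.
  rewrite -sqrtrM ?divr_ge0//; last by lra.
  have -> : t%:R / ln t%:R * (t%:R * ln t%:R) = t%:R ^+ 2 :> R by field; lra.
  by rewrite sqrtr_sqr ger0_norm.
- move=> i j; have := cvg_comp _ _ (@cvg_ln_nat R) (YS i j).
  apply: cvg_trans; apply: near_eq_cvg; near=> t.
  have l1 : 1 <= ln t%:R :> R by near: t; have /cvgryPge := @cvg_ln_nat R; apply.
  have t0 : 0 < t%:R :> R by rewrite ltr0n; near: t; exact: nbhs_infty_gt.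
  rewrite /= sqr_sqrtr ?mulr_ge0//; last by lra.
  by congr (_ * _); field; lra.
Unshelve. all: by end_near. Qed.

End FinalAssembly.

Theorem theorem4p1 (R : realType) (nF nS : nat) (U : urn_network R nF nS)
    (d : measure_display) (T : measurableType d) (P : probability T R)
    (chi : nat -> 'I_(nF + nS) -> T -> bool) :
  urn_draws U chi P ->
  ((forall i, q U i != 2^-1) ->
     diagonalizable (map_mx (real_complex R) (Wmx U))) ->
  {ae P, forall w, ZF U chi t w @[t --> \oo] --> ZstarF U} ->
  (2^-1 < rho U ->
     (forall i j, lebesgue_measure.-integrable `[0, +oo[
                    (fun u => (cov_integrand U u i j)%:E)) /\
     cvg_normal0 P
       (fun t w => Num.sqrt t%:R *: (ZF U chi t w - ZstarF U))
       (cov_integral U `[0, +oo[)) /\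
  (rho U = 2^-1 -> rho_mult U = 1%N ->
     exists Sigma : 'M[R]_nF,
       (ln t)^-1 *: cov_integral U `[0, ln t] @[t --> +oo] --> Sigma /\
       cvg_normal0 P
         (fun t w => Num.sqrt (t%:R / ln t%:R) *: (ZF U chi t w - ZstarF U))
         Sigma).
Proof.
move=> draws _ cvgZ; split; [exact: subcritical_clt|exact: critical_clt].
Qed.
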